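(* For each $n\in\mathbb{N}$, let $(X^{(n)}_t)_{t\ge 0}$ be a non-negatively curved diffusion on a probability space $(E_n,\mathcal{E}_n,\mu_n)$ (state space, generator and initial state may all depend on $n$), starting from a deterministic point $x_n\in E_n$, with spectral gap $\lambda_n>0$ and mixing times $\mathrm{t}_{\mathrm{mix}}^{(n)}(\varepsilon)$, $\varepsilon\in(0,1)$. Suppose that for some $\varepsilon_0\in(0,1)$, $$\lambda_n\times \mathrm{t}_{\mathrm{mix}}^{(n)}(\varepsilon_0)\ \xrightarrow[n\to\infty]{}\ +\infty .$$ Then a cutoff occurs, in the sense that for all $\varepsilon\in(0,1)$, $$\frac{\mathrm{t}_{\mathrm{mix}}^{(n)}(1-\varepsilon)}{\mathrm{t}_{\mathrm{mix}}^{(n)}(\varepsilon)}\ \xrightarrow[n\to\infty]{}\ 1 .$$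
   Context: Setting (for each fixed $n$; the index $n$ is dropped). Let $(E,\mathcal{E},\mu)$ be a probability space and $(P_t)_{t\ge 0}$ a strongly continuous Markov semigroup of self-adjoint operators on $L^2(\mu)$. Its infinitesimal generator is $Lf:=\lim_{t\to 0}\frac{P_tf-f}{t}$, defined for all $f\in L^2(\mu)$ such that the limit exists in $L^2(\mu)$; the set of such $f$ is $\mathrm{Dom}(L)$. The carré du champ operator is $\Gamma(f,g):=\frac12\left(L(fg)-fLg-gLf\right)$ for $f,g\in L^2(\mu)$ with $f,g,fg\in\mathrm{Dom}(L)$, and $\Gamma f:=\Gamma(f,f)$. Non-negatively curved diffusion. Let $x\in E$ be an arbitrary point and let $(X_t)_{t\ge 0}$ be a Markov process with generator $L$ (i.e. with transition semigroup $(P_t)_{t\ge0}$, $P_tf(y)=\mathbb{E}[f(X_t)\mid X_0=y]$) starting from $X_0=x$. It is called a non-negatively curved diffusion if: for each $t>0$, $X_t$ admits a density $f_t$ with respect to $\mu$; both $f_t$ and $\log f_t$ are in $\mathrm{Dom}(L)$, as well as their squares and their product; and the following two conditions hold when $f=f_t$, $g=\log f_t$ and $\phi=\log$, for each $t>0$: (i) chain rule: $\Gamma(\phi(f),g)=\phi'(f)\,\Gamma(f,g)$; (ii) non-negative curvature in the $\mathrm{CD}(0,\infty)$ sense: $\Gamma P_s g\le P_s\Gamma g$ for all $s\ge 0$ (the expressions involved being understood to be well defined). Spectral gap. The spectral gap is the largest $\lambda\ge 0$ such that $\|P_tf\|_2\le e^{-\lambda t}\|f\|_2$ (norms in $L^2(\mu)$)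 for all $t\ge 0$ and all $f\in L^2(\mu)$ with $\mu(f):=\int_E f\,\mathrm{d}\mu=0$. It is assumed to be positive. Mixing times. For an $E$-valued random variable $X$, $\mathrm{TV}(X):=\sup_{A\in\mathcal{E}}|\mathbb{P}(X\in A)-\mu(A)|$. For $\varepsilon\in(0,1)$, $\mathrm{t}_{\mathrm{mix}}(\varepsilon):=\inf\{t>0:\mathrm{TV}(X_t)\le\varepsilon\}$.
   Formalization: The Markov property of X^(n) is required for the right-continuous natural filtration, so that the start at x_n is deterministic also at time 0+; otherwise x_n could be a branching point, left at once for a random position, and cutoff can fail. *)

(* Defs.v *)
From HB Require Import structures.
From mathcomp Require Import all_boot all_order all_algebra.
From mathcomp Require Import all_classical all_reals all_analysis.

Set Implicit Arguments.
Unset Strict Implicit.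
Unset Printing Implicit Defensive.

Import Order.TTheory GRing.Theory Num.Theory.
Import numFieldNormedType.Exports.

Local Open Scope classical_set_scope.
Local Open Scope ring_scope.

(* Elements of L^2(mu) are represented by functions E -> R; every relation
   between two of them is stated mu-almost everywhere or in L^2-norm. Times are
   real numbers, of which only the nonnegative ones matter. *)

Section semigroup.
Context {R : realType} {d : measure_display} {E : measurableType d}.
Variables (mu : probability E R) (p : R -> R.-pker E ~> E).

Definition L2 (f : E -> R) : Prop := f \in Lfun mu 2%:E.

Definition L2norm (f : E -> R) : \bar R := 'N[mu]_2%:E[EFin \o f]%E.

Definition Pt (t : R) (f : E -> R) (y : E) : R := \int[p t y]_z f z.

(* A kernel operator is positive and fixes the constants; that it is well
   defined on classes of L^2(mu) is a consequence of self-adjointness. *)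
Record markov_semigroup : Prop := MarkovSemigroup {
  kernel0 : forall y B, measurable B -> p 0 y B = \d_y B;
  chapman_kolmogorov : forall (s t : R) y B, 0 <= s -> 0 <= t -> measurable B ->
    p (s + t) y B = (\int[p s y]_z p t z B)%E;
  self_adjoint : forall (t : R) f g, 0 <= t -> L2 f -> L2 g ->
    \int[mu]_y (Pt t f y * g y) = \int[mu]_y (f y * Pt t g y);
  strongly_continuous : forall f, L2 f ->
    L2norm (fun y => Pt t f y - f y) @[t --> 0^'+] --> 0%E }.

Definition is_generator (f h : E -> R) : Prop :=
  [/\ L2 f, L2 h &
    L2norm (fun y => (Pt t f y - f y) / t - h y) @[t --> 0^'+] --> 0%E].

Definition domL (f : E -> R) : Prop := exists h, is_generator f h.

(* A representative of the class L f, when f is in the domain. *)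
Definition Lgen (f : E -> R) : E -> R := get (is_generator f).

Definition carre_du_champ (f g : E -> R) (y : E) : R :=
  (Lgen (f \* g) y - f y * Lgen g y - g y * Lgen f y) / 2.

Definition contraction_rate (lam : R) : Prop :=
  forall (t : R) f, 0 <= t -> L2 f -> \int[mu]_y f y = 0 ->
    (L2norm (Pt t f) <= (expR (- lam * t))%:E * L2norm f)%E.

Definition is_spectral_gap (lam : R) : Prop :=
  [/\ 0 <= lam, contraction_rate lam &
    forall lam' : R, 0 <= lam' -> contraction_rate lam' -> lam' <= lam].

Definition chain_rule (phi : R -> R) (f g : E -> R) : Prop :=
  {ae mu, forall y, carre_du_champ (phi \o f) g y
                    = derive1 phi (f y) * carre_du_champ f g y}.

(* The two membership conditions say that Gamma (P_s g) is well defined; the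
   function Gamma g is only known to be integrable, and Pt acts on it. *)
Definition nonneg_curvature (g : E -> R) : Prop :=
  forall s : R, 0 <= s ->
    [/\ domL (Pt s g), domL (Pt s g \* Pt s g) &
      {ae mu, forall y, carre_du_champ (Pt s g) (Pt s g) y
                        <= Pt s (carre_du_champ g g) y}].

End semigroup.

Section process.
Context {R : realType} {d d' : measure_display}.
Context {E : measurableType d} {Omega : measurableType d'}.
Variables (mu : probability E R) (p : R -> R.-pker E ~> E).
Variables (P : probability Omega R) (X : R -> {RV P >-> E}).

Definition natural_filtration (s : R) : set (set Omega) :=
  <<s \bigcup_(u in `[0, s]) preimage_set_system setT (X u) measurable >>.

Definition right_filtration (s : R) : set (set Omega) :=
  \bigcap_(u in `]s, +oo[) natural_filtration u.

(* P(X_(s+t) \in B | F_(s+)) = p_t(X_s, B). The right-continuous filtration is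
   needed at s = 0: with sigma(X_0) instead, x could be a branching point, left
   at once for a random point, and X_(0+) would not be deterministic. *)
Definition markov_process : Prop :=
  forall (s t : R) A B, 0 <= s -> 0 <= t -> right_filtration s A -> measurable B ->
    P (A `&` X (s + t) @^-1` B) = (\int[P]_(w in A) p t (X s w) B)%E.

Definition is_density (t : R) (f : E -> R) : Prop :=
  [/\ measurable_fun setT f, (forall y, 0 <= f y) &
    forall B, measurable B ->
      distribution P (X t) B = (\int[mu]_(y in B) (f y)%:E)%E].

(* As ln is total with ln 0 = 0, the almost sure finiteness of log f_t, which
   membership in L^2 presupposes, has to be stated: this is f_t > 0. *)
Record nonneg_curved_diffusion (x : E) : Prop := NonnegCurvedDiffusion {
  diffusion_semigroup : markov_semigroup mu p;
  diffusion_markov : markov_process;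
  diffusion_start : {ae P, forall w, X 0 w = x};
  diffusion_density : forall t : R, 0 < t -> exists f : E -> R,
    let g := @ln R \o f in
    [/\ is_density t f,
        {ae mu, forall y, 0 < f y},
        [/\ domL mu p f, domL mu p g, domL mu p (f \* f),
            domL mu p (g \* g) & domL mu p (f \* g)],
        chain_rule mu p (@ln R) f g &
        nonneg_curvature mu p g] }.

Definition TV (Y : {RV P >-> E}) : R :=
  sup [set `| fine (P (Y @^-1` A)) - fine (mu A) | | A in measurable].

(* inf of the empty set is 0 here, but a positive spectral gap and a square
   integrable density make this set nonempty. *)
Definition tmix (eps : R) : R :=
  inf [set t : R | 0 < t /\ TV (X t) <= eps].

End process.

(* Main.v *)
(** Let h(t), V(t) and I(t) be the mean and the variance of ln f_t under the law
   of X_t, and the integral of Gamma(ln f_t) against this law. Differentiating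
   s |-> P_(t-s) ((P_s g)^2) and using Gamma P_s g <= P_s Gamma g gives the local
   Poincare inequality P_t (g^2) - (P_t g)^2 <= 2 t P_t (Gamma g), which for
   g = ln f_t at the point x becomes V(t) <= 2 t I(t). The point x is charged by
   no density, hence one first stops at a time u > 0 and then lets u tend to 0,
   using that the germ field at 0 is trivial. By the chain rule I is the Fisher
   information, and - h' >= I in the sense of Dini derivatives.

   If TV(X_t) <= 1 - eps and h(t) is large, then by Chebyshev's inequality ln f_t
   deviates from h(t) by h(t) / 2 with probability at least eps / 2, so that
   V >= c h^2. Then - h' >= c h^2 / (2 t), and h is bounded by a constant
   depending on eps and delta only at time (1 + delta) tmix(1 - eps). From bounded
   entropy the spectral gap leads to equilibrium within time C / lambda, whence
   tmix(eps') <= (1 + delta) tmix(eps) + C / lambda for all eps, eps' in (0, 1);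
   when lambda tmix tends to infinity the last term is negligible. *)

Require Import Defs.
From HB Require Import structures.
From mathcomp Require Import all_boot all_order all_algebra finmap.
From mathcomp Require Import all_classical all_reals all_analysis.
From mathcomp Require Import measurable_realfun.
From mathcomp Require Import ring lra.
Import Order.TTheory GRing.Theory Num.Theory.
Import numFieldNormedType.Exports.
Local Open Scope classical_set_scope.
Local Open Scope ring_scope.

(** Each formal step of the classical computation meets an obstacle. No function of time is known to
    be differentiable, so both differential inequalities are run through one-sided difference
    quotients ([dini_le]), arranged so that the generator only acts on one fixed function, [P_s g]
    or [ln f_t]. The function [Gamma g] is merely integrable and cannot be paired with a weight in
    L^2: the local Poincare inequality is proved against bounded weights and reaches the density
    [f_u] by truncation. The operators are given pointwise by kernels, whereas self-adjointness
    lives in L^2(mu); invariance of [mu] transfers almost everywhere statements through a kernel,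
    but says nothing at the single point [x], where Chapman-Kolmogorov has to be used pointwise.
    Finally, real integrals are total, so that [Pt p t f y] is meaningful only where [f] is
    integrable for [p t y], and this is tracked throughout. *)

(** * Induction over nonnegative measurable functions *)

Section nonneg_induction.
Context {R : realType} {d : measure_display} {T : measurableType d}.
Local Open Scope ereal_scope.
Import HBNNSimple.

(** A nonnegative measurable function is an increasing limit of simple functions, and a simple
    function is a finite combination of the indicators of its level sets. These are added one at a
    time, so closure under [f + c g] is enough. *)
Lemma nonneg_measurable_ind (Q : (T -> \bar R) -> Prop) :
  (forall A, measurable A -> Q (EFin \o \1_A)) ->
  (forall (c : R) (f g : T -> \bar R), (0 <= c)%R -> measurable_fun setT f -> measurable_fun setT g ->
     (forall x, 0 <= f x) -> (forall x, 0 <= g x) -> Q f -> Q g ->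
     Q (fun x => f x + c%:E * g x)) ->
  (forall (u : nat -> T -> \bar R) (f : T -> \bar R), (forall n, measurable_fun setT (u n)) ->
     (forall n x, 0 <= u n x) -> (forall x, nondecreasing_seq (u ^~ x)) ->
     (forall x, u ^~ x @ \oo --> f x) -> (forall n, Q (u n)) -> Q f) ->
  forall f, measurable_fun setT f -> (forall x, 0 <= f x) -> Q f.
Proof.
move=> Q1 QD Qlim f mf f0.
pose u := nnsfun_approx measurableT mf.
apply: (Qlim (fun n x => (u n x)%:E) f).
- by move=> n; exact/measurable_EFinP.
- by move=> n x; rewrite lee_fin.
- by move=> x n m nm; rewrite lee_fin; exact/lefP/nd_nnsfun_approx.
- by move=> x; exact: cvg_nnsfun_approx.
move=> n; move: (u n) => h {u Qlim f mf f0}.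
have Q0 : Q (cst 0).
  have := Q1 set0 measurable0; congr Q.
  by apply/funext => x; rewrite /= indic0.
pose g (s : seq R) x := (\sum_(r <- s) r * \1_(h @^-1` [set r]) x)%R.
(* Arbitrary lists of nonnegative levels make induction possible; measurability and sign are carried
   along because the additive closure asks for them. *)
suff Hs : forall s : seq R, (forall r, r \in s -> (0 <= r)%R) ->
  Q (EFin \o g s) /\ measurable_fun setT (g s) /\ forall x, (0 <= g s x)%R.
  have -> : (fun x => (h x)%:E) = EFin \o g (enum_fset (fset_set (range h))).
    apply/funext => x; rewrite /g/=; congr EFin.
    rewrite fimfunE fsbig_finite//=; exact: fimfunP.
  apply: (Hs _ _).1 => r; rewrite in_fset_set; last exact: fimfunP.
  by rewrite inE => -[x _ <-]; exact: fun_ge0.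
elim => [_|r s ih rs].
  have -> : g [::] = cst 0%R by apply/funext => x; rewrite /g big_nil.
  by split => //; split.
have r0 : (0 <= r)%R by apply: rs; rewrite mem_head.
have [|Qs [ms s0]] := ih; first by move=> z zs; apply: rs; rewrite inE zs orbT.
have -> : g (r :: s) = (fun x => g s x + r * \1_(h @^-1` [set r]) x)%R.
  by apply/funext => x; rewrite /g big_cons addrC.
have mr : measurable (h @^-1` [set r]) by exact: measurable_sfunP.
have m1 : measurable_fun setT (\1_(h @^-1` [set r]) : T -> R) by exact: measurable_indic.
split; last split.
- apply: (QD r (EFin \o g s) (EFin \o \1_(h @^-1` [set r]))) => //.
  + exact/measurable_EFinP.
  + exact/measurable_EFinP.
  + by move=> x /=; rewrite lee_fin.
  + exact: Q1.
- by apply: measurable_funD => //; apply: measurable_funM.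
- by move=> x; rewrite addr_ge0// mulr_ge0.
Qed.
End nonneg_induction.

(** * Square integrable functions *)

Section square_integrable.
Context {R : realType} {d : measure_display} {E : measurableType d}.
Variable mu : probability E R.
Implicit Types f g h : E -> R.

Definition integ f := mu.-integrable setT (EFin \o f).
Definition dot f g : R := \int[mu]_y (f y * g y).
Definition nrm f : R := Num.sqrt (dot f f).

Lemma integ_meas f : integ f -> measurable_fun setT f.
Proof. by move=> /measurable_int /measurable_EFinP. Qed.

Lemma integD f g : integ f -> integ g -> integ (fun y => f y + g y).
Proof. exact: integrableD. Qed.

Lemma integB f g : integ f -> integ g -> integ (fun y => f y - g y).
Proof. exact: integrableB. Qed.

Lemma integZ (c : R) f : integ f -> integ (fun y => c * f y).
Proof. exact: integrableZl. Qed.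

Lemma integ_cst (c : R) : integ (fun=> c).
Proof. exact: finite_measure_integrable_cst. Qed.

Lemma integ_abs f : integ f -> integ (fun y => `|f y|).
Proof. exact: integrable_norm. Qed.

Lemma integ_le_ae f g : measurable_fun setT f -> integ g ->
  {ae mu, forall y, `|f y| <= `|g y|} -> integ f.
Proof.
move=> mf /integrableP[mg ig] fg; apply/integrableP; split; first exact/measurable_EFinP.
apply: le_lt_trans ig; apply: ae_ge0_le_integral => //.
- by apply: measurableT_comp => //; exact/measurable_EFinP.
- exact: measurableT_comp.
- by apply: filterS fg => y fgy _; rewrite /= lee_fin.
Qed.

Lemma integ_le f g : measurable_fun setT f -> integ g ->
  (forall y, `|f y| <= `|g y|) -> integ f.
Proof. by move=> mf ig fg; apply: (integ_le_ae f g) => //; exact: aeW. Qed.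

Lemma RintB f g : integ f -> integ g ->
  \int[mu]_y (f y - g y) = \int[mu]_y f y - \int[mu]_y g y.
Proof. exact: RintegralB. Qed.

Lemma RintD f g : integ f -> integ g ->
  \int[mu]_y (f y + g y) = \int[mu]_y f y + \int[mu]_y g y.
Proof. exact: RintegralD. Qed.

Lemma RintZ (c : R) f : integ f -> \int[mu]_y (c * f y) = c * \int[mu]_y f y.
Proof. exact: RintegralZl. Qed.

Lemma Rint_cst (c : R) : \int[mu]_y c = c.
Proof. rewrite Rintegral_cst// -[RHS]mulr1; congr (_ * _).
exact: (congr1 fine (probability_setT mu)). Qed.

Lemma RintE f : integ f -> (\int[mu]_y f y)%:E = (\int[mu]_y (f y)%:E)%E.
Proof. by move=> fi; rewrite fineK//; exact: integrable_fin_num. Qed.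

Lemma Rint_ge0_ae f : integ f -> {ae mu, forall y, 0 <= f y} -> 0 <= \int[mu]_y f y.
Proof.
move=> fi f0; rewrite -lee_fin RintE//.
have -> : (\int[mu]_y (f y)%:E = \int[mu]_y (Num.max (f y) 0)%:E)%E.
  apply: ae_eq_integral => //.
  - exact: measurable_int fi.
  - by apply/measurable_EFinP; apply: measurable_maxr => //; exact: integ_meas.
  - by apply: filterS f0 => y fy _; rewrite max_l.
by apply: integral_ge0 => y _; rewrite lee_fin le_max lexx orbT.
Qed.

Lemma Rint_le_ae f g : integ f -> integ g -> {ae mu, forall y, f y <= g y} ->
  \int[mu]_y f y <= \int[mu]_y g y.
Proof.
move=> fi gi fg; rewrite -subr_ge0 -RintB//; apply: Rint_ge0_ae; first exact: integB.
by apply: filterS fg => y; rewrite subr_ge0.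
Qed.

Lemma Rint_le f g : integ f -> integ g -> (forall y, f y <= g y) ->
  \int[mu]_y f y <= \int[mu]_y g y.
Proof. by move=> fi gi fg; apply: Rint_le_ae => //; exact: aeW. Qed.

Lemma Rint_eq_ae f g : integ f -> integ g -> {ae mu, forall y, f y = g y} ->
  \int[mu]_y f y = \int[mu]_y g y.
Proof.
move=> fi gi fg; apply/eqP; rewrite eq_le !Rint_le_ae//.
- by apply: filterS fg => y ->.
- by apply: filterS fg => y ->.
Qed.

Lemma Rint_abs f : integ f -> `|\int[mu]_y f y| <= \int[mu]_y `|f y|.
Proof. exact: le_normr_Rintegral. Qed.

Lemma L2P f : L2 mu f <-> measurable_fun setT f /\ integ (fun y => f y ^+ 2).
Proof.
split=> [Lf|[mf fi]].
  split; last exact: Lfun2_integrable_sqr.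
  by move: Lf; rewrite /L2 inE => /andP[/[!inE]/=].
rewrite /L2 inE; apply/andP; split; rewrite inE//= /finite_norm unlock /Lnorm poweR_lty//.
move/integrableP : fi => [_]; apply: le_lt_trans.
apply: ge0_le_integral => //.
- by move=> y _; exact: poweR_ge0.
- have -> : (fun x => (`|(EFin \o f) x| `^ 2)%E) = EFin \o (fun x => `|f x| `^ 2) by [].
  apply/measurable_EFinP; apply: (measurableT_comp (measurable_powR _)) => //.
  exact: measurableT_comp.
- by apply: measurableT_comp => //; apply/measurable_EFinP; exact: measurable_funX.
- move=> y _; rewrite /= lee_fin powR_mulrn// normrX.
  by rewrite lexx.
Qed.

Lemma L2_meas f : L2 mu f -> measurable_fun setT f.
Proof. by move/L2P => []. Qed.

Lemma L2_sqr f : L2 mu f -> integ (fun y => f y ^+ 2).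
Proof. by move/L2P => []. Qed.

Lemma L2_mul f g : L2 mu f -> L2 mu g -> integ (fun y => f y * g y).
Proof. by move=> fi gi; exact/Lfun1_integrable/Lfun2_mul_Lfun1. Qed.

Lemma L2_integ f : L2 mu f -> integ f.
Proof.
by move=> fi; apply/Lfun1_integrable; apply: Lfun_subset12 => //; exact: fin_num_measure.
Qed.

Lemma L2_le_ae f g : measurable_fun setT f -> L2 mu g ->
  {ae mu, forall y, `|f y| <= `|g y|} -> L2 mu f.
Proof.
move=> mf /L2P[mg ig] fg; apply/L2P; split => //.
apply: (integ_le_ae _ _ _ ig); first exact: measurable_funX.
by apply: filterS fg => y fgy; rewrite !normrX lerXn2r// nnegrE.
Qed.

Lemma L2_bounded (K : R) f : measurable_fun setT f -> (forall y, `|f y| <= K) -> L2 mu f.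
Proof.
move=> mf fK; apply: (L2_le_ae f (fun=> K)) => //; first exact: Lfun_cst.
by apply: aeW => y; exact/(le_trans (fK y))/ler_norm.
Qed.

Lemma L2_cst (c : R) : L2 mu (fun=> c).
Proof. exact: Lfun_cst. Qed.

Lemma L2Z (c : R) f : L2 mu f -> L2 mu (fun y => c * f y).
Proof.
move=> /L2P[mf fi]; apply/L2P; split; first exact: measurable_funM.
rewrite (_ : (fun _ => _) = (fun y => c ^+ 2 * f y ^+ 2)); first exact: integZ.
by apply/funext => y; rewrite exprMn.
Qed.

Lemma L2D f g : L2 mu f -> L2 mu g -> L2 mu (fun y => f y + g y).
Proof.
move=> /[dup] Lf /L2P[mf fi] /[dup] Lg /L2P[mg gi]; apply/L2P; split.
  exact: measurable_funD.
rewrite (_ : (fun _ => _) = (fun y => (f y ^+ 2 + g y ^+ 2) + 2 * (f y * g y))).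
  apply: integD; first exact: integD.
  by apply: integZ; exact: L2_mul.
by apply/funext => y; ring.
Qed.

Lemma L2B f g : L2 mu f -> L2 mu g -> L2 mu (fun y => f y - g y).
Proof.
move=> Lf Lg; have := L2D _ _ Lf (L2Z (-1) _ Lg).
by under [X in L2 _ X -> _]eq_fun do rewrite mulN1r.
Qed.

Lemma L2_abs f : L2 mu f -> L2 mu (fun y => `|f y|).
Proof.
move=> Lf; apply: (L2_le_ae _ f) => //.
  by apply: measurableT_comp => //; exact: L2_meas.
by apply: aeW => y; rewrite normr_id.
Qed.

Lemma integ_bounded_mul (K : R) (w f : E -> R) : measurable_fun setT w -> (forall y, `|w y| <= K) ->
  integ f -> integ (fun y => w y * f y).
Proof.
move=> mw wK Lf; apply: (integ_le _ (fun y => K * f y)).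
- by apply: measurable_funM => //; exact: integ_meas.
- exact: integZ.
- by move=> y; rewrite !normrM ler_wpM2r// (le_trans (wK y))// ler_norm.
Qed.

Lemma dotC f g : dot f g = dot g f.
Proof. by congr fine; apply: eq_integral => y _; rewrite mulrC. Qed.

Lemma dotBl f g h : L2 mu f -> L2 mu g -> L2 mu h ->
  dot (fun y => f y - g y) h = dot f h - dot g h.
Proof.
move=> Lf Lg Lh; rewrite /dot -RintB; [|exact: L2_mul..].
by apply: eq_Rintegral => y _; rewrite mulrBl.
Qed.

Lemma dotBr f g h : L2 mu f -> L2 mu g -> L2 mu h ->
  dot h (fun y => f y - g y) = dot h f - dot h g.
Proof. by move=> *; rewrite dotC dotBl// !(dotC h). Qed.

Lemma dotDl f g h : L2 mu f -> L2 mu g -> L2 mu h ->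
  dot (fun y => f y + g y) h = dot f h + dot g h.
Proof.
move=> Lf Lg Lh; rewrite /dot -RintD; [|exact: L2_mul..].
by apply: eq_Rintegral => y _; rewrite mulrDl.
Qed.

Lemma dotDr f g h : L2 mu f -> L2 mu g -> L2 mu h ->
  dot h (fun y => f y + g y) = dot h f + dot h g.
Proof. by move=> *; rewrite dotC dotDl// !(dotC h). Qed.

Lemma dotZl (c : R) f g : L2 mu f -> L2 mu g -> dot (fun y => c * f y) g = c * dot f g.
Proof.
move=> Lf Lg; rewrite /dot -RintZ; last exact: L2_mul.
by apply: eq_Rintegral => y _; rewrite mulrA.
Qed.

Lemma dotZr (c : R) f g : L2 mu f -> L2 mu g -> dot f (fun y => c * g y) = c * dot f g.
Proof. by move=> *; rewrite dotC dotZl// dotC. Qed.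

Lemma dot_ge0 f : 0 <= dot f f.
Proof. by apply: Rintegral_ge0 => y _; rewrite -expr2 sqr_ge0. Qed.

Lemma nrm_ge0 f : 0 <= nrm f.
Proof. exact: sqrtr_ge0. Qed.

Lemma nrm_sqr f : nrm f ^+ 2 = dot f f.
Proof. by rewrite sqr_sqrtr// dot_ge0. Qed.

(** The quadratic form [s^2 a + 2 s t c + t^2 b], the squared norm of [s f + t g], is nonnegative
    for all real [s] and [t]. *)
Lemma Cauchy_Schwarz f g : L2 mu f -> L2 mu g -> `|dot f g| <= nrm f * nrm g.
Proof.
move=> Lf Lg.
rewrite -ler_sqr ?nnegrE ?mulr_ge0 ?nrm_ge0//.
rewrite real_normK ?num_real// exprMn !nrm_sqr.
set a := dot f f; set b := dot g g; set c := dot f g.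
have H (s t : R) : 0 <= s ^+ 2 * a + 2 * s * t * c + t ^+ 2 * b.
  have := dot_ge0 (fun y => s * f y + t * g y).
  rewrite dotDl ?dotDr ?dotZl ?dotZr; try by repeat first [assumption | apply: L2Z | apply: L2D].
  rewrite (dotC g f) -/a -/b -/c => /le_trans; apply.
  by rewrite le_eqVlt; apply/orP; left; apply/eqP; ring.
have a0 : 0 <= a by exact: dot_ge0.
(* If [a > 0], the pair [(c, - a)] gives [a (a b - c^2) >= 0]. If [a = 0], the pair [(- (b + 1), c)]
   gives [- (b + 2) c^2 >= 0], hence [c = 0]. *)
have := H c (- a).
have := H (c * (b + 1)) (-1).
have := H (- (b+1)) c.
have := H b (- c).
move: a0; rewrite le_eqVlt => /predU1P[<- H1 H2 H3 _|a0 _ _ _].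
  have b0 : 0 <= b by exact: dot_ge0.
  rewrite mul0r.
  nra.
nra.
Qed.

Lemma int_abs_mul f g : L2 mu f -> L2 mu g -> \int[mu]_y `|f y * g y| <= nrm f * nrm g.
Proof.
move=> Lf Lg.
have := Cauchy_Schwarz _ _ (L2_abs _ Lf) (L2_abs _ Lg).
have nE h : nrm (fun y => `|h y|) = nrm h.
  by congr Num.sqrt; apply: eq_Rintegral => y _; rewrite -expr2 real_normK ?num_real// expr2.
rewrite !nE; apply: le_trans; rewrite /dot.
under eq_Rintegral do rewrite normrM.
exact: ler_norm.
Qed.

Lemma nrmD f g : L2 mu f -> L2 mu g -> nrm (fun y => f y + g y) <= nrm f + nrm g.
Proof.
move=> Lf Lg; rewrite -ler_sqr ?nnegrE ?addr_ge0 ?nrm_ge0//.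
rewrite nrm_sqr dotDl ?dotDr//; [|exact: L2D].
have := Cauchy_Schwarz _ _ Lf Lg; have := ler_norm (dot f g).
rewrite (dotC g f) -!nrm_sqr; nra.
Qed.

Lemma nrmZ (c : R) f : L2 mu f -> nrm (fun y => c * f y) = `|c| * nrm f.
Proof.
move=> Lf; rewrite /nrm dotZl ?dotZr//; last exact: L2Z.
by rewrite mulrA -expr2 sqrtrM ?sqr_ge0// sqrtr_sqr.
Qed.

Lemma nrmB f g : L2 mu f -> L2 mu g -> nrm (fun y => f y - g y) <= nrm f + nrm g.
Proof.
move=> Lf Lg; have := nrmD _ _ Lf (L2Z (-1) _ Lg).
under [X in nrm X]eq_fun do rewrite mulN1r.
by rewrite nrmZ// normrN1 mul1r.
Qed.

Lemma nrm_le_ae f g : L2 mu f -> L2 mu g ->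
  {ae mu, forall y, `|f y| <= `|g y|} -> nrm f <= nrm g.
Proof.
move=> Lf Lg fg; apply: ler_wsqrtr; apply: Rint_le_ae; [exact: L2_mul..|].
by apply: filterS fg => y; rewrite -ler_sqr ?nnegrE// !real_normK ?num_real// !expr2.
Qed.

Lemma nrm_eq_ae f g : L2 mu f -> L2 mu g ->
  {ae mu, forall y, f y = g y} -> nrm f = nrm g.
Proof.
move=> Lf Lg fg; apply/eqP; rewrite eq_le !nrm_le_ae//; apply: filterS fg => y ->//.
Qed.

Lemma nrm_cst (c : R) : nrm (fun=> c) = `|c|.
Proof. by rewrite /nrm /dot Rint_cst -expr2 sqrtr_sqr. Qed.

Lemma nrm_bounded (K : R) f : measurable_fun setT f -> (forall y, `|f y| <= K) ->
  nrm f <= K.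
Proof.
move=> mf fK; have K0 : 0 <= K by exact: le_trans (normr_ge0 _) (fK point).
rewrite -[leRHS](ger0_norm K0) -nrm_cst; apply: nrm_le_ae.
- exact: L2_bounded fK.
- exact: L2_cst.
- by apply: aeW => y; rewrite (ger0_norm K0).
Qed.

Lemma int_abs_le_nrm f : L2 mu f -> \int[mu]_y `|f y| <= nrm f.
Proof.
move=> Lf; have := int_abs_mul _ _ Lf (L2_cst 1); rewrite nrm_cst normr1 mulr1.
by under eq_Rintegral do rewrite mulr1.
Qed.

Lemma L2normE f : L2 mu f -> L2norm mu f = (nrm f)%:E.
Proof.
move=> Lf; have mf := L2_meas _ Lf; rewrite /L2norm unlock /Lnorm.
have -> : (\int[mu]_x (`|(EFin \o f) x| `^ 2) = (dot f f)%:E)%E.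
  rewrite RintE; last exact: L2_mul.
  by apply: eq_integral => y _; rewrite /= powR_mulrn// real_normK ?num_real// expr2.
by rewrite poweR_EFin powR12_sqrt// dot_ge0.
Qed.

(** Turns the extended real limits at [0^'+] of the definitions into epsilon-delta bounds on a real
    norm, the only form in which limits in time are used afterwards. *)
Lemma L2norm_cvg0P (F : R -> E -> R) : (forall t, 0 < t -> L2 mu (F t)) ->
  L2norm mu (F t) @[t --> 0^'+] --> 0%E ->
  forall e, 0 < e -> exists2 r, 0 < r & forall t, 0 < t < r -> nrm (F t) <= e.
Proof.
move=> LF cF e e0.
have /cF : nbhs (0%E : \bar R) [set z : \bar R | (z < e%:E)%E].
  by apply: open_nbhs_nbhs; split; [exact: open_ereal_lt_ereal|rewrite /= lte_fin].
rewrite /nbhs/= => -[r /= r0 rF].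
exists r => // t /andP[t0 tr].
have : (L2norm mu (F t) < e%:E)%E.
  by apply: rF => //=; rewrite distrC subr0 gtr0_norm.
by rewrite L2normE; [rewrite lte_fin => /ltW|exact: LF].
Qed.

End square_integrable.

Ltac l2 := repeat first [assumption | apply: L2B | apply: L2D | apply: L2Z | apply: L2_abs].

(** * Positive functionals continuous along increasing sequences *)

Section daniell.
Context {R : realType} {d : measure_display} {T : measurableType d}.
Local Open Scope ereal_scope.

(* [daniell_eq] transfers an identity between such functionals from indicator
   functions to all nonnegative measurable functions. *)
Record daniell (F : (T -> \bar R) -> \bar R) : Prop := Daniell {
  daniell_ge0 : forall f, measurable_fun setT f -> (forall x, 0 <= f x) -> 0 <= F f;
  daniell_lin : forall (c : R) (f g : T -> \bar R), (0 <= c)%R ->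
    measurable_fun setT f -> measurable_fun setT g ->
    (forall x, 0 <= f x) -> (forall x, 0 <= g x) ->
    F (fun x => f x + c%:E * g x) = F f + c%:E * F g;
  daniell_le : forall f g : T -> \bar R,
    measurable_fun setT f -> measurable_fun setT g ->
    (forall x, 0 <= f x) -> (forall x, f x <= g x) -> F f <= F g;
  daniell_cvg : forall (u : nat -> T -> \bar R) (f : T -> \bar R),
    (forall n, measurable_fun setT (u n)) ->
    (forall n x, 0 <= u n x) -> (forall x, nondecreasing_seq (u ^~ x)) ->
    (forall x, u ^~ x @ \oo --> f x) -> F (u n) @[n --> \oo] --> F f }.

Lemma daniell_eq (F G : (T -> \bar R) -> \bar R) : daniell F -> daniell G ->
  (forall A, measurable A -> F (EFin \o \1_A) = G (EFin \o \1_A)) ->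
  forall f, measurable_fun setT f -> (forall x, 0 <= f x) -> F f = G f.
Proof.
move=> dF dG FG; apply: nonneg_measurable_ind => //.
- by move=> c f g c0 mf mg f0 g0 Ff Fg; rewrite !daniell_lin// Ff Fg.
- move=> u f mu u0 ndu uf FGu.
  have := daniell_cvg _ dG _ _ mu u0 ndu uf.
  have := daniell_cvg _ dF _ _ mu u0 ndu uf.
  under eq_fun do rewrite FGu.
  by move=> /cvg_lim <-// /cvg_lim <-.
Qed.

Lemma daniell_eval (x : T) : daniell (fun f => f x).
Proof. by split => //. Qed.

Lemma daniell_scale (F : (T -> \bar R) -> \bar R) (a : R) : (0 <= a)%R ->
  daniell F -> daniell (fun f => a%:E * F f).
Proof.
move=> a0 dF; split.
- by move=> f mf f0; rewrite mule_ge0// daniell_ge0.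
- move=> c f g c0 mf mg f0 g0; rewrite daniell_lin// ge0_muleDr ?daniell_ge0//.
    by rewrite muleCA.
  by rewrite mule_ge0// daniell_ge0.
- by move=> f g mf mg f0 fg; rewrite lee_wpmul2l// daniell_le.
- move=> u f mu u0 ndu uf; apply: cvgeZl => //; exact: daniell_cvg uf.
Qed.

(** Monotone convergence under the integral: a mixture of such functionals is again one. Integrals
    against measures, kernels and weights are all built from evaluations in this way. *)
Lemma daniell_integral {d' : measure_display} {S : measurableType d'}
    (m : {measure set S -> \bar R}) (A : (T -> \bar R) -> S -> \bar R) :
  (forall y, daniell (A ^~ y)) ->
  (forall f, measurable_fun setT f -> (forall x, 0 <= f x) -> measurable_fun setT (A f)) ->
  daniell (fun f => \int[m]_y A f y).
Proof.
move=> dA mA; split.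
- by move=> f mf f0; apply: integral_ge0 => y _; exact: (daniell_ge0 _ (dA y)).
- move=> c f g c0 mf mg f0 g0.
  have A0 h y : measurable_fun setT h -> (forall x, 0 <= h x) -> 0 <= A h y.
    by move=> mh h0; exact: (daniell_ge0 _ (dA y)).
  under eq_integral do rewrite (daniell_lin _ (dA _))//.
  rewrite ge0_integralD//; last 4 first.
  + by move=> y _; exact: A0.
  + exact: mA.
  + by move=> y _; apply: mule_ge0 => //; exact: A0.
  + by apply: measurable_funeM; exact: mA.
  by rewrite ge0_integralZl//; [exact: mA|move=> y _; exact: A0].
- move=> f g mf mg f0 fg; have g0 x : 0 <= g x by exact: le_trans (fg x).
  apply: ge0_le_integral => //.
  + by move=> y _; exact: (daniell_ge0 _ (dA y)).
  + exact: mA.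
  + exact: mA.
  + by move=> y _; exact: (daniell_le _ (dA y)).
- move=> u f mu u0 ndu uf.
  have AE y : A f y = limn (fun n => A (u n) y).
    by apply/esym/cvg_lim => //; exact: (daniell_cvg _ (dA y)).
  rewrite (_ : \int[m]_y A f y = \int[m]_y limn (fun n => A (u n) y)); last first.
    by apply: eq_integral => y _; exact: AE.
  apply: cvg_monotone_convergence => //.
  + by move=> n; exact: mA.
  + by move=> n y _; exact: (daniell_ge0 _ (dA y)).
  + by move=> y _ n n' nn'; apply: (daniell_le _ (dA y)) => // x; exact: ndu.
Qed.

Lemma daniell_measure (m : {measure set T -> \bar R}) : daniell (fun f => \int[m]_y f y).
Proof. by apply: daniell_integral => //; exact: daniell_eval. Qed.

End daniell.

(** * Self-adjoint Markov kernels *)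

Section kernel.
Context {R : realType} {d : measure_display} {E : measurableType d}.
Variables (mu : probability E R) (p : R -> R.-pker E ~> E).

(** The measure [p t y] as a probability of its own, so that the L^2 theory developed for [mu]
    applies to it as well. *)
Definition pk (t : R) (y : E) : set E -> \bar R := p t y.
HB.instance Definition _ t y := Measure.on (pk t y).
Lemma pk_setT t y : pk t y setT = 1%E. Proof. exact: prob_kernel. Qed.
HB.instance Definition _ t y := Measure_isProbability.Build _ _ _ (pk t y) (pk_setT t y).

Local Open Scope ereal_scope.

Lemma measurable_kernel_int t (b : E -> \bar R) : measurable_fun setT b ->
  (forall y, 0 <= b y) -> measurable_fun setT (fun y => \int[p t y]_z b z).
Proof.
move=> mb b0; apply: measurable_fun_integral_kernel => // U mU; exact: measurable_kernel.
Qed.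

Hypothesis sg : markov_semigroup mu p.

Lemma kernel_int_comp (s t : R) y (b : E -> \bar R) : (0 <= s)%R -> (0 <= t)%R ->
  measurable_fun setT b -> (forall z, 0 <= b z) ->
  \int[p (s + t) y]_z b z = \int[p s y]_z \int[p t z]_w b w.
Proof.
move=> s0 t0; move: b; apply: daniell_eq; first exact: daniell_measure.
  apply: daniell_integral; first by move=> z; exact: daniell_measure.
  by move=> b mb b0; exact: measurable_kernel_int.
move=> A mA; rewrite integral_indic// setIT (chapman_kolmogorov sg)//.
by apply: eq_integral => z _; rewrite integral_indic// setIT.
Qed.

Lemma kernel_int0 y (b : E -> R) : measurable_fun setT b ->
  (\int[p 0 y]_z b z = b y)%R.
Proof.
move=> mb; rewrite /Rintegral (@eq_measure_integral _ _ _ _ (\d_y)).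
  by rewrite integral_dirac ?diracT ?mul1e//; exact/measurable_EFinP.
by move=> A mA _; rewrite (kernel0 sg).
Qed.

Lemma Pt_meas_bounded (K : R) t (w : E -> R) : measurable_fun setT w ->
  (forall y, 0 <= w y <= K)%R -> measurable_fun setT (Pt p t w).
Proof.
move=> mw wK; apply: measurableT_comp => //; apply: measurable_kernel_int.
  exact/measurable_EFinP.
by move=> y; rewrite lee_fin; case/andP: (wK y).
Qed.

Lemma Pt_bounded (K : R) t (w : E -> R) : measurable_fun setT w ->
  (forall y, 0 <= w y <= K)%R -> forall y, (0 <= Pt p t w y <= K)%R.
Proof.
move=> mw wK y; apply/andP; split.
  by apply: Rintegral_ge0 => z _; case/andP: (wK z).
rewrite -[leRHS](Rint_cst (pk t y)); apply: (Rint_le (pk t y)).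
- apply: (L2_integ (pk t y)); apply: (L2_bounded _ K) => // z.
  by case/andP: (wK z) => w0 wz; rewrite ger0_norm.
- exact: integ_cst.
- by move=> z; case/andP: (wK z).
Qed.

(* Self-adjointness holds on indicator functions and is extended to nonnegative
   [b], so that it makes sense before [Pt] is known to act on classes. *)
Lemma kernel_symm (K t : R) (w : E -> R) (b : E -> \bar R) : (0 <= t)%R ->
  measurable_fun setT w -> (forall y, 0 <= w y <= K)%R ->
  measurable_fun setT b -> (forall y, 0 <= b y) ->
  \int[mu]_y ((w y)%:E * \int[p t y]_z b z) = \int[mu]_y ((Pt p t w y)%:E * b y).
Proof.
move=> t0 mw wK.
have w0 y : (0 <= w y)%R by case/andP: (wK y).
have Pw := Pt_bounded _ t _ mw wK.
have mPw : measurable_fun setT (Pt p t w) by exact: Pt_meas_bounded wK.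
have L2w : L2 mu w.
  by apply: (L2_bounded _ K) => // y; case/andP: (wK y) => ? ?; rewrite ger0_norm.
have L2Pw : L2 mu (Pt p t w).
  by apply: (L2_bounded _ K) => // y; case/andP: (Pw y) => ? ?; rewrite ger0_norm.
move: b; apply: daniell_eq.
- apply: daniell_integral => [y|b mb b0].
    by apply: daniell_scale => //; exact: daniell_measure.
  apply: emeasurable_funM; first exact/measurable_EFinP.
  exact: measurable_kernel_int.
- apply: daniell_integral => [y|b mb b0].
    by apply: daniell_scale; [case/andP: (Pw y)|exact: daniell_eval].
  by apply: emeasurable_funM => //; exact/measurable_EFinP.
move=> B mB.
have L2i (m : probability E R) : L2 m (\1_B : E -> R).
  apply: (L2_bounded _ 1%R) => // y.
  by rewrite indicE; case: (_ \in _); rewrite ?normr1 ?normr0.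
have i01 y : (0 <= (\1_B y : R) <= 1)%R.
  by rewrite indicE; case: (_ \in _); rewrite ?lexx ler01.
have mi : measurable_fun setT (\1_B : E -> R) by exact: measurable_indic.
have L2P1 : L2 mu (Pt p t \1_B).
  apply: (L2_bounded _ 1%R); first exact: Pt_meas_bounded i01.
  by move=> y; case/andP: (Pt_bounded _ t _ mi i01 y) => ? ?; rewrite ger0_norm.
have := self_adjoint sg t0 L2w (L2i mu).
have i1 := L2_mul mu _ _ L2Pw (L2i mu).
have i2 := L2_mul mu _ _ L2w L2P1.
move=> H; have {H} := congr1 EFin H; rewrite (RintE mu _ i1) (RintE mu _ i2) => H.
transitivity (\int[mu]_y (w y * Pt p t \1_B y)%:E); last by rewrite -H.
apply: eq_integral => y _; rewrite EFinM; congr (_ * _).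
by rewrite /Pt (RintE (pk t y))//; exact: L2_integ (L2i _).
Qed.

(** Symmetry against the constant weight 1, which [Pt] fixes. *)
Lemma invariant_measure (t : R) (b : E -> \bar R) : (0 <= t)%R ->
  measurable_fun setT b -> (forall y, 0 <= b y) ->
  \int[mu]_y \int[p t y]_z b z = \int[mu]_y b y.
Proof.
move=> t0 mb b0; have := kernel_symm 1 t (fun=> 1%R) b t0.
have P1 y : Pt p t (fun=> 1%R) y = 1%R by exact: (Rint_cst (pk t y)).
under eq_integral do rewrite mul1e.
under [in RHS]eq_integral do rewrite P1 mul1e.
by apply => // y; rewrite ler01 lexx.
Qed.


Local Close Scope ereal_scope.

(** By invariance the kernel integrals of [|f|] form a [mu]-integrable function of the starting
    point, hence are finite almost everywhere. *)
Lemma ae_kernel_integ (t : R) f : 0 <= t -> integ mu f ->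
  {ae mu, forall y, integ (pk t y) f}.
Proof.
move=> t0 fi; have mf := integ_meas mu _ fi.
have ma : measurable_fun setT (fun z => `|(f z)%:E|%E).
  by apply: measurableT_comp => //; exact/measurable_EFinP.
pose F y := (\int[p t y]_z `|(f z)%:E|)%E.
have iF : mu.-integrable setT F.
  apply/integrableP; split; first exact: measurable_kernel_int.
  under eq_integral do rewrite gee0_abs ?integral_ge0//.
  rewrite invariant_measure//; by case/integrableP : fi.
apply: filterS (integrable_ae measurableT iF) => y /(_ I) Fy.
apply/integrableP; split; first exact/measurable_EFinP.
by rewrite -ge0_fin_numE ?integral_ge0.
Qed.

Lemma Pt_meas (t : R) f : measurable_fun setT f -> measurable_fun setT (Pt p t f).
Proof.
move=> mf; apply: measurableT_comp => //.
have mE : measurable_fun setT (EFin \o f) by exact/measurable_EFinP.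
rewrite (_ : (fun y => \int[p t y]_z (f z)%:E)%E = (fun y =>
   \int[p t y]_z ((EFin \o f)^\+ z) - \int[p t y]_z ((EFin \o f)^\- z))%E); last first.
  by apply/funext => y; rewrite [LHS]integralE.
apply: emeasurable_funB; apply: measurable_kernel_int => //.
- exact: measurable_funepos.
- exact: measurable_funeneg.
Qed.

Lemma Pt_ge0 (t : R) f : (forall y, 0 <= f y) -> forall y, 0 <= Pt p t f y.
Proof. by move=> f0 y; exact: Rintegral_ge0. Qed.

Lemma Pt_cst (t c : R) y : Pt p t (fun=> c) y = c.
Proof. exact: (Rint_cst (pk t y)). Qed.

Lemma invariant_integ (t : R) f : 0 <= t -> integ mu f -> (forall y, 0 <= f y) ->
  integ mu (Pt p t f) /\ \int[mu]_y Pt p t f y = \int[mu]_y f y.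
Proof.
move=> t0 fi f0; have mf := integ_meas mu _ fi.
have H : (\int[mu]_y (Pt p t f y)%:E = \int[mu]_y (f y)%:E)%E.
  have mE : measurable_fun setT (EFin \o f) by exact/measurable_EFinP.
  have E0 y : (0 <= (EFin \o f) y)%E by rewrite lee_fin.
  rewrite -(invariant_measure t _ t0 mE E0).
  apply: ae_eq_integral => //.
  - by apply/measurable_EFinP; exact: Pt_meas.
  - by apply: measurable_kernel_int => //; exact/measurable_EFinP.
  - by apply: filterS (ae_kernel_integ t _ t0 fi) => y fy _; exact: (RintE (pk t y)).
split; last by rewrite /Rintegral H.
apply/integrableP; split; first by apply/measurable_EFinP; exact: Pt_meas.
under eq_integral do rewrite gee0_abs ?lee_fin ?Pt_ge0//.
rewrite H; case/integrableP : fi => _.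
by under [X in (X < _)%E -> _]eq_integral do rewrite gee0_abs ?lee_fin//.
Qed.

Lemma Pt_D (t : R) f g y : integ (pk t y) f -> integ (pk t y) g ->
  Pt p t (fun z => f z + g z) y = Pt p t f y + Pt p t g y.
Proof. exact: (RintD (pk t y)). Qed.

Lemma Pt_B (t : R) f g y : integ (pk t y) f -> integ (pk t y) g ->
  Pt p t (fun z => f z - g z) y = Pt p t f y - Pt p t g y.
Proof. exact: (RintB (pk t y)). Qed.

Lemma Pt_Z (t c : R) f y : integ (pk t y) f ->
  Pt p t (fun z => c * f z) y = c * Pt p t f y.
Proof. exact: (RintZ (pk t y)). Qed.

Lemma Pt_abs (t : R) f y : integ (pk t y) f -> `|Pt p t f y| <= Pt p t (fun z => `|f z|) y.
Proof. exact: (Rint_abs (pk t y)). Qed.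

Lemma Pt_integ (t : R) f : 0 <= t -> integ mu f -> integ mu (Pt p t f).
Proof.
move=> t0 fi; apply: (integ_le_ae mu _ (Pt p t (fun z => `|f z|))).
- by apply: Pt_meas; exact: integ_meas fi.
- by apply: (invariant_integ t _ t0 _ _).1 => //; exact: integ_abs.
- apply: filterS (ae_kernel_integ t _ t0 fi) => y fy.
  by rewrite [leRHS]ger0_norm ?Pt_ge0//; exact: Pt_abs.
Qed.

(** A signed function is the difference of the nonnegative functions [|f| + f] and [|f|]. The same
    splitting removes sign conditions in several lemmas below. *)
Lemma Pt_int (t : R) f : 0 <= t -> integ mu f -> \int[mu]_y Pt p t f y = \int[mu]_y f y.
Proof.
move=> t0 fi; have ai := integ_abs mu _ fi.
have [i1 e1] := invariant_integ t _ t0 ai (fun y => normr_ge0 _).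
have fpi : integ mu (fun y => `|f y| + f y) by exact: integD.
have fp0 y : 0 <= `|f y| + f y by have := ler_norm (- f y); rewrite normrN; lra.
have [i2 e2] := invariant_integ t _ t0 fpi fp0.
transitivity (\int[mu]_y (Pt p t (fun y => `|f y| + f y) y - Pt p t (fun z => `|f z|) y)).
  apply: Rint_eq_ae.
  - exact: Pt_integ.
  - exact: integB.
  - apply: filterS (ae_kernel_integ t _ t0 fi) => y fy.
    by rewrite Pt_D//; [rewrite addrC addKr|exact: (integ_abs (pk t y))].
by rewrite RintB// e1 e2 RintD// addrC addKr.
Qed.

(** Jensen's inequality for the square, as Cauchy-Schwarz against 1 in the L^2 space of [p t y]; it
    needs [f] square integrable for [p t y], which holds for almost every [y]. *)
Lemma Pt_sqr_ae (t : R) f : 0 <= t -> L2 mu f ->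
  {ae mu, forall y, Pt p t f y ^+ 2 <= Pt p t (fun z => f z ^+ 2) y}.
Proof.
move=> t0 Lf.
apply: filterS2 (ae_kernel_integ t _ t0 (L2_integ mu _ Lf))
  (ae_kernel_integ t _ t0 (L2_sqr mu _ Lf)) => y i1 i2.
have L2y : L2 (pk t y) f by apply/L2P; split => //; exact: L2_meas Lf.
have := Cauchy_Schwarz (pk t y) _ _ L2y (L2_cst (pk t y) 1).
rewrite nrm_cst normr1 mulr1 -ler_sqr ?nnegrE ?nrm_ge0// nrm_sqr real_normK ?num_real//.
rewrite /dot; under eq_Rintegral do rewrite mulr1.
by under [X in _ <= X -> _]eq_Rintegral do rewrite -expr2.
Qed.

Lemma L2_Pt (t : R) f : 0 <= t -> L2 mu f -> L2 mu (Pt p t f).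
Proof.
move=> t0 Lf; have mP : measurable_fun setT (Pt p t f) by apply: Pt_meas; exact: L2_meas Lf.
apply/L2P; split => //.
apply: (integ_le_ae mu _ (Pt p t (fun z => f z ^+ 2))).
- exact: measurable_funX.
- by apply: Pt_integ => //; exact: L2_sqr.
- apply: filterS (Pt_sqr_ae t _ t0 Lf) => y H.
  by rewrite !ger0_norm ?sqr_ge0// Pt_ge0// => z; exact: sqr_ge0.
Qed.

Lemma nrm_Pt (t : R) f : 0 <= t -> L2 mu f -> nrm mu (Pt p t f) <= nrm mu f.
Proof.
move=> t0 Lf; apply: ler_wsqrtr; rewrite /dot.
rewrite -[leRHS](_ : \int[mu]_y f y ^+ 2 = _); last first.
  by apply: eq_Rintegral => y _; rewrite expr2.
rewrite -[leLHS](_ : \int[mu]_y Pt p t f y ^+ 2 = _); last first.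
  by apply: eq_Rintegral => y _; rewrite expr2.
rewrite -(Pt_int t (fun y => f y ^+ 2))//; last exact: L2_sqr.
apply: Rint_le_ae.
- by apply: L2_sqr; exact: L2_Pt.
- by apply: Pt_integ => //; exact: L2_sqr.
- exact: Pt_sqr_ae.
Qed.

Lemma Pt_le_ae (t : R) f g : 0 <= t -> integ mu f -> integ mu g ->
  {ae mu, forall y, f y <= g y} -> {ae mu, forall y, Pt p t f y <= Pt p t g y}.
Proof.
move=> t0 fi gi fg.
have mf := integ_meas mu _ fi; have mg := integ_meas mu _ gi.
(* the positive part of [f - g] is null, and invariance transports this along the kernel *)
pose h y := Num.max (f y - g y) 0.
have hm : measurable_fun setT h.
  by apply: measurable_maxr => //; exact: measurable_funB.
have h0 y : 0 <= h y by rewrite le_max lexx orbT.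
have hi : integ mu h.
  apply: (integ_le_ae mu _ (fun=> 0)) => //; first exact: integ_cst.
  by apply: filterS fg => y fgy; rewrite /h max_r ?subr_le0.
have h_eq0 : \int[mu]_y h y = 0.
  rewrite -[RHS](Rint_cst mu); apply: Rint_eq_ae => //; first exact: integ_cst.
  by apply: filterS fg => y fgy; rewrite /h max_r ?subr_le0.
have Ph_eq0 : {ae mu, forall y, Pt p t h y = 0}.
  have [Pi Pe] := invariant_integ t _ t0 hi h0.
  have : ae_eq mu setT (EFin \o Pt p t h) (cst 0%E).
    apply/ae_eq_integral_abs => //; first exact: measurable_int Pi.
    under eq_integral do rewrite gee0_abs ?lee_fin ?Pt_ge0//.
    by rewrite -RintE// Pe h_eq0.
  by apply: filterS => y /(_ I) [].
apply: filterS3 Ph_eq0 (ae_kernel_integ t _ t0 fi)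
  (ae_kernel_integ t _ t0 gi) => y Ph ify igy.
have ihy : integ (pk t y) h.
  apply: (integ_le (pk t y) _ (fun z => f z - g z)) => //.
    exact: (integB (pk t y)).
  move=> z; rewrite /h; case: (leP (f z - g z) 0) => [H|H]; first by rewrite normr0.
  by rewrite lexx.
rewrite -subr_ge0 -Pt_B// -oppr_le0 -[leRHS]Ph -mulN1r.
rewrite -Pt_Z; last exact: (integB (pk t y)).
apply: (Rint_le (pk t y)) => //.
  by apply: (integZ (pk t y)); exact: (integB (pk t y)).
by move=> z; rewrite mulN1r opprB /h le_max lexx.
Qed.

Lemma Pt_eq_ae (t : R) f g : 0 <= t -> integ mu f -> integ mu g ->
  {ae mu, forall y, f y = g y} -> {ae mu, forall y, Pt p t f y = Pt p t g y}.
Proof.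
move=> t0 fi gi fg.
have H1 : {ae mu, forall y, f y <= g y} by apply: filterS fg => y ->.
have H2 : {ae mu, forall y, g y <= f y} by apply: filterS fg => y ->.
apply: filterS2 (Pt_le_ae t _ _ t0 fi gi H1) (Pt_le_ae t _ _ t0 gi fi H2) => y a b.
by apply/eqP; rewrite eq_le a b.
Qed.

(** The point [y] is fixed and integrability is required for [p (s + t) y] only: the lemma will be
    applied at the starting point of the process, which may be [mu]-negligible. *)
Lemma Pt_comp (s t : R) f y : 0 <= s -> 0 <= t -> integ (pk (s + t) y) f ->
  integ (pk s y) (Pt p t f) /\ Pt p (s + t) f y = Pt p s (Pt p t f) y.
Proof.
move=> s0 t0 fi.
have mf := integ_meas _ _ fi.
have nn h : (forall z, 0 <= h z) -> integ (pk (s + t) y) h ->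
    integ (pk s y) (Pt p t h) /\ Pt p (s + t) h y = Pt p s (Pt p t h) y.
  move=> h0 hi; have mh := integ_meas _ _ hi.
  have mhE : measurable_fun setT (EFin \o h) by exact/measurable_EFinP.
  have h0E z : (0 <= (h z)%:E)%E by rewrite lee_fin.
  have CK := kernel_int_comp s t y _ s0 t0 mhE h0E.
  have iK : (pk s y).-integrable setT (fun z => \int[p t z]_w (h w)%:E)%E.
    apply/integrableP; split; first exact: measurable_kernel_int.
    under eq_integral do rewrite gee0_abs ?integral_ge0//.
    rewrite -CK; case/integrableP : hi => _.
    by under [X in (X < _)%E -> _]eq_integral do rewrite gee0_abs ?lee_fin//.
  have aeE : {ae pk s y, forall z, (Pt p t h z)%:E = (\int[p t z]_w (h w)%:E)%E}.
    by apply: filterS (integrable_ae measurableT iK) => z /(_ I) fz; rewrite fineK.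
  have E1 : (\int[pk s y]_z (Pt p t h z)%:E = \int[pk s y]_z \int[p t z]_w (h w)%:E)%E.
    apply: ae_eq_integral => //.
    - by apply/measurable_EFinP; exact: Pt_meas.
    - exact: measurable_kernel_int.
    - by apply: filterS aeE.
  split; last by rewrite {2}/Pt /Rintegral E1 -CK.
  apply/integrableP; split; first by apply/measurable_EFinP; exact: Pt_meas.
  under eq_integral do rewrite gee0_abs ?lee_fin ?Pt_ge0//.
  rewrite E1 -CK; case/integrableP : hi => _.
  by under [X in (X < _)%E -> _]eq_integral do rewrite gee0_abs ?lee_fin//.
have ai := integ_abs _ _ fi.
have [i1 e1] := nn _ (fun z => normr_ge0 _) ai.
have fpi : integ (pk (s + t) y) (fun y => `|f y| + f y) by exact: integD.
have fp0 z : 0 <= `|f z| + f z by have := ler_norm (- f z); rewrite normrN; lra.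
have [i2 e2] := nn _ fp0 fpi.
have aeK : {ae pk s y, forall z, integ (pk t z) f}.
  have mhE : measurable_fun setT (fun z => `|f z|%:E).
    by apply/measurable_EFinP; exact: measurableT_comp.
  have h0E z : (0 <= `|f z|%:E)%E by rewrite lee_fin.
  have CK := kernel_int_comp s t y _ s0 t0 mhE h0E.
  have iK : (pk s y).-integrable setT (fun z => \int[p t z]_w `|f w|%:E)%E.
    apply/integrableP; split; first exact: measurable_kernel_int.
    under eq_integral do rewrite gee0_abs ?integral_ge0//.
    by rewrite -CK; case/integrableP : fi.
  apply: filterS (integrable_ae measurableT iK) => z /(_ I) fz.
  apply/integrableP; split; first exact/measurable_EFinP.
  by rewrite -ge0_fin_numE ?integral_ge0.
have aeD : {ae pk s y, forall z, Pt p t f z =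
    Pt p t (fun y => `|f y| + f y) z - Pt p t (fun z => `|f z|) z}.
  apply: filterS aeK => z fz.
  by rewrite Pt_D//; [rewrite addrC addKr|exact: (integ_abs (pk t z))].
have iPf : integ (pk s y) (Pt p t f).
  apply: (integ_le_ae (pk s y) _ (Pt p t (fun z => `|f z|))) => //.
    exact: Pt_meas.
  apply: filterS aeK => z fz.
  by rewrite [leRHS]ger0_norm ?Pt_ge0//; exact: Pt_abs.
split; first exact: iPf.
transitivity (Pt p (s + t) (fun y => `|f y| + f y) y - Pt p (s + t) (fun z => `|f z|) y).
  by rewrite (Pt_D _ (fun y => `|f y|) f)// [RHS]addrC addKr.
rewrite e1 e2 -Pt_B; [|exact: i2|exact: i1].
apply/esym/(Rint_eq_ae (pk s y)); [exact: iPf| |exact: aeD].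
by apply: (integB (pk s y)); [exact: i2|exact: i1].
Qed.

Lemma Pt_comp_ae (s t : R) f : 0 <= s -> 0 <= t -> integ mu f ->
  {ae mu, forall y, Pt p (s + t) f y = Pt p s (Pt p t f) y}.
Proof.
move=> s0 t0 fi; apply: filterS (ae_kernel_integ (s + t) _ (addr_ge0 s0 t0) fi) => y.
by move=> /Pt_comp -/(_ s0 t0)[].
Qed.

Lemma dot_Pt (t : R) f g : 0 <= t -> L2 mu f -> L2 mu g ->
  dot mu (Pt p t f) g = dot mu f (Pt p t g).
Proof. by move=> t0 Lf Lg; exact: self_adjoint. Qed.

End kernel.

(** * Comparison from one-sided difference quotients *)

(** With the slope [C + eta], the times at which the bound holds contain their supremum by the
    condition from the left, and the condition on forward increments goes beyond any such time
    before [tau]. Continuity is not assumed: upward jumps from the left are allowed. *)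
Lemma dini_le {R : realType} (psi : R -> R) (tau C : R) : 0 <= tau ->
  (forall s eta, 0 <= s < tau -> 0 < eta -> exists2 r, 0 < r &
     forall dl, 0 < dl < r -> s + dl <= tau -> psi s - psi (s + dl) <= (C + eta) * dl) ->
  (forall c e, 0 < c <= tau -> 0 < e -> exists2 r, 0 < r &
     forall s, 0 <= s -> c - r < s < c -> psi s - psi c <= e) ->
  psi 0 - psi tau <= C * tau.
Proof.
move=> tau0 dini lcont.
suff H eta : 0 < eta -> psi 0 - psi tau <= (C + eta) * tau.
  rewrite leNgt; apply/negP => lt.
  pose e := psi 0 - psi tau - C * tau.
  have e0 : 0 < e by rewrite subr_gt0.
  have /H : 0 < e / 2 / (tau + 1) by rewrite !divr_gt0//; lra.
  have : e / 2 / (tau + 1) * tau <= e / 2.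
    rewrite -mulrA ler_piMr//; first by apply: divr_ge0; lra.
    by rewrite mulrC ler_pdivrMr; lra.
  by rewrite mulrDl /e; lra.
move=> eta0; set D := C + eta.
pose S := [set s | 0 <= s <= tau /\ psi 0 - psi s <= D * s].
have S0 : S 0 by split; [rewrite lexx|rewrite subrr mulr0].
have supS : has_sup S by split; [exists 0|exists tau => s [/andP[]]].
pose c := sup S.
have c0 : 0 <= c by apply: (ub_le_sup supS.2).
have ctau : c <= tau by apply: ge_sup => [|s [/andP[]]//]; exists 0.
(* If the bound failed at [c] by [e], a point of [S] close enough to [c] would lose at most [e / 2]
   in [psi] and less than [e / 2] in the linear term, a contradiction. *)
have Sc : S c.
  split; first by rewrite c0.
  rewrite leNgt; apply/negP => lt.
  pose e := psi 0 - psi c - D * c.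
  have e0 : 0 < e by rewrite subr_gt0.
  have cgt0 : 0 < c.
    rewrite lt_neqAle c0 andbT; apply/eqP => c00.
    by move: lt; rewrite -c00 subrr mulr0 ltxx.
  have [||r r0 rP] := lcont c (e / 2); [by rewrite cgt0|lra|].
  have D1 : 0 < `|D| + 1 by have := normr_ge0 D; lra.
  have m0 : 0 < Num.min r (e / 2 / (`|D| + 1)) by rewrite lt_min r0 !divr_gt0.
  have [s Ss cs] := sup_adherent m0 supS.
  have sc : s <= c by apply: (ub_le_sup supS.2).
  have [/andP[s0 _] sP] := Ss.
  move: sc; rewrite le_eqVlt => /predU1P[sc|sc].
    by move: sP; rewrite sc leNgt lt.
  have := rP s s0.
  have -> : c - r < s < c.
    rewrite sc andbT (le_lt_trans _ cs)// lerD2l lerN2.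
    by rewrite ge_min lexx.
  move=> /(_ isT) H1.
  have H2 : c - s <= e / 2 / (`|D| + 1).
    have : sup S - e / 2 / (`|D| + 1) < s.
      by apply: le_lt_trans cs; rewrite lerD2l lerN2 ge_min lexx orbT.
    by rewrite -/c; lra.
  have H3 : D * s - D * c < e / 2.
    have := ler_norm (- D); rewrite normrN => nD.
    have H4 : (`|D| + 1) * (c - s) <= e / 2 by rewrite mulrC -ler_pdivlMr.
    have : 0 < c - s by lra.
    nra.
  by rewrite /e in H1 H3; lra.
have : c = tau.
  apply/eqP; rewrite eq_le ctau/= leNgt; apply/negP => ct.
  have [||r r0 rP] := dini c eta; [by rewrite c0|by []|].
  pose dl := Num.min (r / 2) (tau - c).
  have dl0 : 0 < dl by rewrite lt_min divr_gt0//= subr_gt0.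
  have dlr : dl < r by rewrite gt_min; apply/orP; left; lra.
  have dlt : c + dl <= tau by rewrite -lerBrDl ge_min lexx orbT.
  have := rP dl; rewrite dl0 dlr => /(_ isT dlt) H.
  have : S (c + dl).
    split; first by rewrite dlt andbT; lra.
    by have [_] := Sc; rewrite mulrDr -/D in H *; lra.
  by move/(ub_le_sup supS.2); rewrite -/c; lra.
by move=> ct; have [_] := Sc; rewrite ct.
Qed.

Lemma le0_of_eps {R : realType} (x C : R) : (forall e, 0 < e -> x <= C * e) -> x <= 0.
Proof.
move=> H; rewrite leNgt; apply/negP => x0.
have C1 : 0 < `|C| + 1 by have := normr_ge0 C; lra.
have e0 : 0 < x / 2 / (`|C| + 1) by rewrite !divr_gt0.
have := H _ e0; have := ler_norm C.
have : (`|C| + 1) * (x / 2 / (`|C| + 1)) = x / 2 by rewrite mulrC divfK// gt_eqF.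
nra.
Qed.

Lemma sqr_diff_le {R : realType} (a b n e : R) : 0 <= a -> a <= n -> 0 <= b -> b <= n ->
  0 <= e -> a <= b + e -> a ^+ 2 - b ^+ 2 <= e * (2 * n).
Proof.
move=> a0 an b0 bn e0 ab.
apply: (@le_trans _ _ (e * (a + b))); last by rewrite ler_wpM2l//; lra.
by rewrite subr_sqr ler_wpM2r//; lra.
Qed.

(** * Truncation of integrable functions *)

Section truncation.
Context {R : realType} {d : measure_display} {E : measurableType d}.
Variable mu : probability E R.

Lemma int_trunc (q : E -> R) : integ mu q -> (forall y, 0 <= q y) ->
  forall e, 0 < e -> exists N : nat, \int[mu]_y (q y - Num.min (q y) N%:R) <= e.
Proof.
move=> qi q0 e e0; have mq := integ_meas mu _ qi.
have mE (n : nat) : measurable_fun setT (fun y => Num.min (q y) n%:R).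
  exact: measurable_minr.
have mn0 n y : 0 <= Num.min (q y) (n%:R : R) by rewrite le_min q0 ler0n.
have iE (n : nat) : integ mu (fun y => Num.min (q y) n%:R).
  apply: (integ_le mu _ q) => // y.
  by rewrite !ger0_norm// ge_min lexx.
have : (\int[mu]_y (Num.min (q y) n%:R)%:E @[n --> \oo] --> \int[mu]_y (q y)%:E)%E.
  have -> : (\int[mu]_y (q y)%:E = \int[mu]_y limn (fun n => (Num.min (q y) n%:R)%:E))%E.
    apply: eq_integral => y _; apply/esym/cvg_lim => //.
    apply: cvg_near_cst.
    exists (Num.bound (q y)) => // n /= qn; rewrite min_l//.
    by apply: (le_trans (ltW (archi_boundP (q0 y)))); rewrite ler_nat.
  apply: cvg_monotone_convergence => //.
  - by move=> n; exact/measurable_EFinP.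
  - by move=> n y _; rewrite lee_fin.
  - move=> y _ n m nm; rewrite lee_fin le_min !ge_min lexx/=.
    by rewrite ler_nat nm orbT.
under eq_fun do rewrite -RintE//.
rewrite -RintE// => /fine_cvgP[_] /= /cvgrPdist_le /(_ e e0) [N _ NP].
exists N; have := NP N (leqnn N) => /=.
rewrite RintB//; apply: le_trans; exact: ler_norm.
Qed.

(** Since [q] is only integrable, smallness of [W] in L^2 does not suffice by itself. Cutting [q] at
    a level [N] bounds [|W| q] by [N |W| + K (q - min(q, N))]; the second term is small by the
    choice of [N], then the first by the choice of [eta]. It lets strong continuity act on weights
    paired with [Gamma g]. *)
Lemma small_int (K : R) (q : E -> R) : 0 <= K -> integ mu q -> (forall y, 0 <= q y) ->
  forall e, 0 < e -> exists2 eta, 0 < eta & forall W : E -> R, L2 mu W ->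
    (forall y, `|W y| <= K) -> nrm mu W <= eta -> `|\int[mu]_y (W y * q y)| <= e.
Proof.
move=> K0 qi q0 e e0; have mq := integ_meas mu _ qi.
have [|N HN] := int_trunc _ qi q0 (e / 2 / (K + 1)).
  by rewrite !divr_gt0//; lra.
exists (e / 2 / (N%:R + 1)).
  by rewrite !divr_gt0//; have := ler0n R N; lra.
move=> W LW WK Weta.
have mW := L2_meas mu _ LW.
have iWq : integ mu (fun y => W y * q y) by exact: integ_bounded_mul WK qi.
apply: le_trans (Rint_abs mu _ iWq) _.
pose m y := Num.min (q y) N%:R.
have m0 y : 0 <= m y by rewrite le_min q0 ler0n.
have mN y : m y <= N%:R by rewrite /m ge_min lexx orbT.
have mqy y : m y <= q y by rewrite /m ge_min lexx.
have mm : measurable_fun setT m by exact: measurable_minr.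
have im : integ mu m by apply: (integ_le mu _ q) => // y; rewrite !ger0_norm.
have iaW : integ mu (fun y => `|W y|) by apply: integ_abs; exact: L2_integ.
apply: (@le_trans _ _ (\int[mu]_y (N%:R * `|W y| + K * (q y - m y)))).
  apply: Rint_le.
  - exact: integ_abs.
  - by apply: integD; apply: integZ => //; exact: integB.
  - move=> y; rewrite normrM (ger0_norm (q0 y)).
    have := WK y; have := normr_ge0 (W y); have := mN y; have := mqy y; have := m0 y.
    nra.
rewrite RintD; [|by apply: integZ|by apply: integZ; exact: integB].
rewrite !RintZ//; last exact: integB.
have := int_abs_le_nrm mu _ LW => H1.
have H2 : N%:R * \int[mu]_y `|W y| <= e / 2.
  apply: (@le_trans _ _ (N%:R * (e / 2 / (N%:R + 1)))).
    by rewrite ler_wpM2l// (le_trans H1).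
  rewrite mulrA ler_pdivrMr; have := ler0n R N; nra.
have H3 : K * \int[mu]_y (q y - m y) <= e / 2.
  apply: (@le_trans _ _ (K * (e / 2 / (K + 1)))).
    by rewrite ler_wpM2l.
  by rewrite mulrA ler_pdivrMr; nra.
lra.
Qed.

End truncation.

(** * Generator and carre du champ *)

Section semigroup_calculus.
Context {R : realType} {d : measure_display} {E : measurableType d}.
Variables (mu : probability E R) (p : R -> R.-pker E ~> E).
Hypothesis sg : markov_semigroup mu p.

Lemma Pt_comp_bounded (K s t : R) (w : E -> R) : 0 <= s -> 0 <= t -> measurable_fun setT w ->
  (forall y, 0 <= w y <= K) -> Pt p (s + t) w = Pt p s (Pt p t w).
Proof.
move=> s0 t0 mw wK; apply/funext => y.
apply: (proj2 (Pt_comp mu p sg s t w y s0 t0 _)).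
apply: (L2_integ (pk p _ _)); apply: (L2_bounded _ K) => // z.
by case/andP: (wK z) => ? ?; rewrite ger0_norm.
Qed.

Lemma strong_cont f : L2 mu f -> forall e, 0 < e -> exists2 r, 0 < r &
  forall t, 0 <= t < r -> nrm mu (fun y => Pt p t f y - f y) <= e.
Proof.
move=> Lf e e0.
have [|r r0 rP] := L2norm_cvg0P mu _ _ (strongly_continuous sg Lf) e e0.
  by move=> t t0; apply: L2B => //; exact: L2_Pt (ltW t0) Lf.
exists r => // t /andP[]; rewrite le_eqVlt => /predU1P[<- _|t0 tr].
  rewrite (_ : (fun y => _) = fun=> 0); first by rewrite nrm_cst normr0 ltW.
  apply/funext => y; rewrite /Pt (kernel_int0 mu p sg) ?subrr//; exact: L2_meas Lf.
by apply: rP; rewrite t0.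
Qed.

(** The difference is [P_s] applied to [P_(t-s) f - f], and [P_s] is a contraction: the modulus of
    continuity at time 0 is valid at all times. *)
Lemma nrm_Pt_diff (s t : R) f : 0 <= s <= t -> L2 mu f ->
  nrm mu (fun y => Pt p t f y - Pt p s f y) <=
  nrm mu (fun y => Pt p (t - s) f y - f y).
Proof.
move=> /andP[s0 st] Lf; have ts0 : 0 <= t - s by rewrite subr_ge0.
have t0 : 0 <= t by exact: le_trans st.
have LP u : 0 <= u -> L2 mu (Pt p u f) by move=> u0; exact: L2_Pt.
have LD : L2 mu (fun y => Pt p (t - s) f y - f y) by apply: L2B => //; exact: LP.
apply: le_trans (nrm_Pt _ _ sg _ _ s0 LD); rewrite le_eqVlt; apply/orP; left; apply/eqP.
apply: nrm_eq_ae; [by apply: L2B; exact: LP|exact: L2_Pt|].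
apply: filterS3 (ae_kernel_integ _ _ sg s _ s0 (L2_integ _ _ (LP _ ts0)))
  (ae_kernel_integ _ _ sg s _ s0 (L2_integ _ _ Lf))
  (Pt_comp_ae _ _ sg _ _ _ s0 ts0 (L2_integ _ _ Lf)) => y i1 i2.
by rewrite subrKC => ->; rewrite Pt_B.
Qed.

Lemma gen_L2l f h : is_generator mu p f h -> L2 mu f. Proof. by case. Qed.
Lemma gen_L2r f h : is_generator mu p f h -> L2 mu h. Proof. by case. Qed.

Lemma domL_gen f : domL mu p f -> is_generator mu p f (Lgen mu p f).
Proof. by move=> [h fh]; exact: getPex (ex_intro _ h fh). Qed.

Lemma L2_gen_quot t f h : 0 <= t -> L2 mu f -> L2 mu h ->
  L2 mu (fun y => (Pt p t f y - f y) / t - h y).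
Proof.
move=> t0 Lf Lh; apply: L2B => //.
rewrite (_ : (fun y => _) = (fun y => t^-1 * (Pt p t f y - f y))).
  by apply: L2Z; apply: L2B => //; exact: L2_Pt.
by apply/funext => y; rewrite mulrC.
Qed.

Lemma gen_lim f h : is_generator mu p f h -> forall e, 0 < e -> exists2 r, 0 < r &
  forall t, 0 < t < r -> nrm mu (fun y => (Pt p t f y - f y) / t - h y) <= e.
Proof.
move=> [Lf Lh lim] e e0; apply: L2norm_cvg0P lim e e0 => t t0.
by apply: L2_gen_quot => //; exact: ltW.
Qed.

(** The difference quotients are symmetric by self-adjointness, and Cauchy-Schwarz controls both
    errors. *)
Lemma gen_dot f h f' h' : is_generator mu p f h -> is_generator mu p f' h' ->
  dot mu h f' = dot mu f h'.
Proof.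
move=> G G'; have Lf := gen_L2l _ _ G; have Lh := gen_L2r _ _ G.
have Lf' := gen_L2l _ _ G'; have Lh' := gen_L2r _ _ G'.
apply/eqP; rewrite -subr_eq0 -normr_le0.
apply: (le0_of_eps _ (nrm mu f + nrm mu f')) => e e0.
have [r r0 rP] := gen_lim _ _ G e e0; have [r' r'0 r'P] := gen_lim _ _ G' e e0.
pose t := Num.min r r' / 2.
have m0 : 0 < Num.min r r' by rewrite lt_min r0.
have t0 : 0 < t by rewrite divr_gt0.
have tr : t < r by apply: (@lt_le_trans _ _ (Num.min r r')); [rewrite /t; lra|rewrite ge_min lexx].
have tr' : t < r' by apply: (@lt_le_trans _ _ (Num.min r r')); [rewrite /t; lra|rewrite ge_min lexx orbT].
pose a y := (Pt p t f y - f y) / t - h y.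
pose a' y := (Pt p t f' y - f' y) / t - h' y.
have La : L2 mu a by apply: L2_gen_quot => //; exact: ltW.
have La' : L2 mu a' by apply: L2_gen_quot => //; exact: ltW.
have LP : L2 mu (Pt p t f) by apply: L2_Pt => //; exact: ltW.
have LP' : L2 mu (Pt p t f') by apply: L2_Pt => //; exact: ltW.
have e1 : dot mu h f' = t^-1 * (dot mu (Pt p t f) f' - dot mu f f') - dot mu a f'.
  rewrite -dotBl// -dotZl//; last by l2.
  rewrite -dotBl//; last by l2.
  by congr dot; apply/funext => y; rewrite /a; ring.
have e2 : dot mu f h' = t^-1 * (dot mu f (Pt p t f') - dot mu f f') - dot mu f a'.
  rewrite -dotBr// -dotZr//; last by l2.
  rewrite -dotBr//; last by l2.
  by congr dot; apply/funext => y; rewrite /a'; ring.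
rewrite e1 e2 (dot_Pt mu p sg)//; last exact: ltW.
have := Cauchy_Schwarz mu _ _ La Lf'; have := Cauchy_Schwarz mu _ _ Lf La'.
have := rP t; rewrite t0 tr => /(_ isT) H1.
have := r'P t; rewrite t0 tr' => /(_ isT) H2.
have := nrm_ge0 mu f; have := nrm_ge0 mu f'.
set A := dot mu a f'; set B := dot mu f a'.
move=> n1 n2 c1 c2; rewrite [X in `|X|](_ : _ = B - A); last by ring.
have := ler_normB B A.
move: H1 H2; rewrite -/a -/a' => H1 H2.
have : nrm mu a * nrm mu f' <= e * nrm mu f' by exact: ler_wpM2r.
have : nrm mu f * nrm mu a' <= nrm mu f * e by exact: ler_wpM2l.
lra.
Qed.

Lemma gen_cst1 : is_generator mu p (fun=> 1) (fun=> 0).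
Proof.
split; [exact: L2_cst..|].
rewrite (_ : (fun t => _) = (fun=> 0%E)); first exact: cvg_cst.
apply/funext => t; rewrite -(_ : (nrm mu (fun=> 0))%:E = 0%E); last by rewrite nrm_cst normr0.
rewrite -L2normE; last exact: L2_cst.
congr L2norm; apply/funext => y; rewrite (Pt_cst p); ring.
Qed.

(** Symmetry against the constant 1, whose generator is 0. *)
Lemma gen_int0 f h : is_generator mu p f h -> \int[mu]_y h y = 0.
Proof.
move=> G; have := gen_dot _ _ _ _ G gen_cst1; rewrite /dot.
under eq_Rintegral do rewrite mulr1.
move=> ->; under eq_Rintegral do rewrite mulr0.
exact: Rint_cst.
Qed.

(** The limit [k - 2 F h] is twice the carre du champ of [F]. Convergence takes place in L^1, since
    the square of [P_t F] produces products of two L^2 functions. *)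
Lemma carre_quot F h k : is_generator mu p F h -> is_generator mu p (F \* F) k ->
  forall e, 0 < e -> exists2 r, 0 < r & forall t, 0 < t < r ->
  \int[mu]_y `|(Pt p t (F \* F) y - Pt p t F y ^+ 2) / t - (k y - 2 * (F y * h y))| <= e.
Proof.
move=> G GG e e0.
have LF := gen_L2l _ _ G; have Lh := gen_L2r _ _ G.
have LFF := gen_L2l _ _ GG; have Lk := gen_L2r _ _ GG.
have nF := nrm_ge0 mu F; have nh := nrm_ge0 mu h.
pose C := 1 + 2 * nrm mu F + nrm mu h.
have C0 : 0 < C by rewrite /C; lra.
have e'0 : 0 < e / C by rewrite divr_gt0.
have [r1 r10 rP1] := gen_lim _ _ GG _ e'0.
have [r2 r20 rP2] := gen_lim _ _ G _ e'0.
have [r3 r30 rP3] := strong_cont _ LF _ e'0.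
exists (Num.min r1 (Num.min r2 r3)); first by rewrite !lt_min r10 r20.
move=> t /andP[t0]; rewrite !lt_min => /and3P[tr1 tr2 tr3].
have := rP1 t; rewrite t0 tr1 => /(_ isT) {rP1}.
have := rP2 t; rewrite t0 tr2 => /(_ isT) {rP2}.
have := rP3 t; rewrite (ltW t0) tr3 => /(_ isT) {rP3}.
set u := fun y => Pt p t F y - F y.
set a := fun y => (Pt p t F y - F y) / t - h y.
set b := fun y => (Pt p t (F \* F) y - (F \* F) y) / t - k y.
move=> Hu Ha Hb.
have La : L2 mu a by apply: L2_gen_quot => //; exact: ltW.
have Lb : L2 mu b by apply: L2_gen_quot => //; exact: ltW.
have LP : L2 mu (Pt p t F) by apply: L2_Pt => //; exact: ltW.
have Lu : L2 mu u by l2.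
pose v y := Pt p t F y + F y.
have Lv : L2 mu v by apply: L2D.
have nv : nrm mu v <= 2 * nrm mu F.
  have := nrmD mu _ _ LP LF; have := nrm_Pt mu p sg t _ (ltW t0) LF; rewrite -/v; lra.
(* From [(P_t F)^2 - F^2 = (P_t F - F)(P_t F + F)]: the error is [b - (a v + h u)], where [a], [b]
   are the errors of the two generator quotients, [u = P_t F - F] and [v = P_t F + F]. *)
rewrite (@eq_Rintegral _ _ _ mu setT (fun y => `|b y - (a y * v y + h y * u y)|)); last first.
  by move=> y _; congr `|_|; rewrite /a /b /u /v /=; field; rewrite gt_eqF.
have iav := L2_mul mu _ _ La Lv; have ihu := L2_mul mu _ _ Lh Lu.
have ib := L2_integ mu _ Lb.
apply: (@le_trans _ _ (\int[mu]_y (`|b y| + (`|a y * v y| + `|h y * u y|)))).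
  apply: Rint_le.
  - by apply: integ_abs; apply: integB => //; exact: integD.
  - by apply: integD; [exact: integ_abs|apply: integD; exact: integ_abs].
  - move=> y; rewrite (le_trans (ler_normB _ _))// lerD2l; exact: ler_normD.
rewrite RintD; [|exact: integ_abs|by apply: integD; exact: integ_abs].
rewrite RintD; [|exact: integ_abs|exact: integ_abs].
have H1 := int_abs_le_nrm mu _ Lb.
have H2 := int_abs_mul mu _ _ La Lv.
have H3 := int_abs_mul mu _ _ Lh Lu.
have na := nrm_ge0 mu a; have nv0 := nrm_ge0 mu v.
have H2' : nrm mu a * nrm mu v <= e / C * (2 * nrm mu F) by exact: ler_pM.
have H3' : nrm mu h * nrm mu u <= nrm mu h * (e / C) by exact: ler_wpM2l.
have -> : e = e / C * (1 + 2 * nrm mu F + nrm mu h) by rewrite divfK// gt_eqF.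
set ec := e / C in Ha Hb H2' H3' *; lra.
Qed.

(** The quotients of [carre_quot] are nonnegative by Jensen, so the negative part of their L^1 limit
    is dominated by the distance to them and has integral 0. *)
Lemma carre_ge0 F h k : is_generator mu p F h -> is_generator mu p (F \* F) k ->
  {ae mu, forall y, 0 <= k y - 2 * (F y * h y)}.
Proof.
move=> G GG.
have LF := gen_L2l _ _ G; have Lh := gen_L2r _ _ G.
have LFF := gen_L2l _ _ GG; have Lk := gen_L2r _ _ GG.
pose q y := k y - 2 * (F y * h y).
have qi : integ mu q.
  by apply: integB; [exact: L2_integ|apply: integZ; exact: L2_mul].
have mq := integ_meas mu _ qi.
pose m y := Num.max (- q y) 0.
have m0 y : 0 <= m y by rewrite le_max lexx orbT.
have mm : measurable_fun setT m.
  by apply: measurable_maxr => //; exact: measurableT_comp.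
have mi : integ mu m.
  apply: (integ_le mu _ q) => // y; rewrite ger0_norm// /m ge_max normr_ge0 andbT.
  by rewrite -normrN ler_norm.
have im0 : \int[mu]_y m y = 0.
  apply/eqP; rewrite eq_le; apply/andP; split; last exact: Rintegral_ge0.
  apply: (le0_of_eps _ 1) => e e0; rewrite mul1r.
  have [r r0 /(_ (r / 2)) H] := carre_quot _ _ _ G GG _ e0.
  set t := r / 2 in H.
  have t0 : 0 < t by rewrite divr_gt0.
  apply: le_trans (H _); last by rewrite t0 /t; lra.
  have LP : L2 mu (Pt p t F) by apply: L2_Pt => //; exact: ltW.
  have LPP : L2 mu (Pt p t (F \* F)) by apply: L2_Pt => //; exact: ltW.
  apply: Rint_le_ae => //.
    apply: integ_abs; apply: integB; last exact: qi.
    rewrite (_ : (fun y => _) = (fun y => t^-1 * (Pt p t (F \* F) y - Pt p t F y ^+ 2))).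
      by apply: integZ; apply: integB; [exact: L2_integ|exact: L2_sqr].
    by apply/funext => y; rewrite mulrC.
  apply: filterS (Pt_sqr_ae mu p sg t _ (ltW t0) LF) => y Hy.
  have D0 : 0 <= (Pt p t (F \* F) y - Pt p t F y ^+ 2) / t.
    apply: divr_ge0; last exact: ltW.
    by rewrite subr_ge0; move: Hy; under [X in _ <= Pt p t X y]eq_fun do rewrite expr2.
  rewrite /m ge_max normr_ge0 andbT -/(q y).
  by apply: le_trans (ler_norm _); lra.
have : ae_eq mu setT (EFin \o m) (cst 0%E).
  apply/ae_eq_integral_abs => //; first exact: measurable_int mi.
  under eq_integral do rewrite gee0_abs ?lee_fin//.
  by rewrite -RintE// im0.
apply: filterS => y /(_ I) [] my0; rewrite -/(q y).
have : - q y <= m y by rewrite le_max lexx.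
by rewrite my0; lra.
Qed.

End semigroup_calculus.

(** * Local Poincare inequality against a bounded weight *)

Section local_Poincare.
Context {R : realType} {d : measure_display} {E : measurableType d}.
Variables (mu : probability E R) (p : R -> R.-pker E ~> E).
Hypothesis sg : markov_semigroup mu p.
Variable g : E -> R.
Hypotheses (Dg : domL mu p g) (Dgg : domL mu p (g \* g)).
Hypothesis curv : nonneg_curvature mu p g.

Let L2g : L2 mu g. Proof. exact: gen_L2l (domL_gen mu p _ Dg). Qed.
Let L2gg : L2 mu (g \* g). Proof. exact: gen_L2l (domL_gen mu p _ Dgg). Qed.

Let Gam := carre_du_champ mu p g g.

Let carreE F : carre_du_champ mu p F F =
  (fun y => 2^-1 * (Lgen mu p (F \* F) y - 2 * (F y * Lgen mu p F y))).
Proof. by apply/funext => y; rewrite /carre_du_champ; field. Qed.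

Lemma carre_integ F : domL mu p F -> domL mu p (F \* F) ->
  integ mu (carre_du_champ mu p F F).
Proof.
move=> DF DFF; rewrite carreE; apply: integZ.
have G := domL_gen mu p _ DF; have GG := domL_gen mu p _ DFF.
apply: integB; first exact: L2_integ (gen_L2r _ _ _ _ GG).
by apply: integZ; apply: L2_mul; [exact: gen_L2l G|exact: gen_L2r G].
Qed.

Lemma carre_du_champ_ge0 F : domL mu p F -> domL mu p (F \* F) ->
  {ae mu, forall y, 0 <= carre_du_champ mu p F F y}.
Proof.
move=> DF DFF.
have G := domL_gen mu p _ DF; have GG := domL_gen mu p _ DFF.
rewrite carreE; apply: filterS (carre_ge0 mu p sg _ _ _ G GG) => y H.
by rewrite mulr_ge0.
Qed.

Section fixed_weight.
Variables (w : E -> R) (K tau : R).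
Hypotheses (mw : measurable_fun setT w) (wK : forall y, 0 <= w y <= K) (tau0 : 0 <= tau).

Let K0 : 0 <= K. Proof. by case/andP: (wK point) => ? ?; lra. Qed.
Let psi s := \int[mu]_y (Pt p (tau - s) w y * Pt p s g y ^+ 2).
Let W s := Pt p (tau - s) w.
Let G s := Pt p s g.

Let WK s y : 0 <= W s y <= K. Proof. exact: Pt_bounded. Qed.
Let mW s : measurable_fun setT (W s). Proof. exact: Pt_meas_bounded wK. Qed.
Let W_abs s y : `|W s y| <= K. Proof. by case/andP: (WK s y) => ? ?; rewrite ger0_norm. Qed.
Let L2W s : L2 mu (W s). Proof. exact: L2_bounded (W_abs s). Qed.
Let L2w : L2 mu w.
Proof. by apply: (L2_bounded mu K) => // y; case/andP: (wK y) => ? ?; rewrite ger0_norm. Qed.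
Let L2G s : 0 <= s -> L2 mu (G s). Proof. by move=> s0; exact: L2_Pt. Qed.
Let L2GG s : 0 <= s -> L2 mu (G s \* G s).
Proof. by move=> /curv[_ D _]; exact: gen_L2l (domL_gen mu p _ D). Qed.

(** Self-adjointness moves [P_dl] from the weight at time [s] onto the square of [P_s g], so that
    both terms carry the weight at time [s + dl]. The increment is then [dl] times a quotient as in
    [carre_quot], for the function [P_s g]. *)
Let psi_diff s dl : 0 <= s -> 0 < dl -> s + dl <= tau ->
  psi s - psi (s + dl) = \int[mu]_y (W (s + dl) y * (Pt p dl (G s \* G s) y - Pt p dl (G s) y ^+ 2)).
Proof.
move=> s0 dl0 sdl.
have dl0' := ltW dl0; have sd0 : 0 <= s + dl by rewrite addr_ge0.
have LP : L2 mu (Pt p dl (G s)) by apply: L2_Pt => //; exact: L2G.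
have LPP : L2 mu (Pt p dl (G s \* G s)) by apply: L2_Pt => //; exact: L2GG.
have -> : psi s = \int[mu]_y (W (s + dl) y * Pt p dl (G s \* G s) y).
  transitivity (dot mu (W s) (G s \* G s)).
    by apply: eq_Rintegral => y _; rewrite expr2.
  have -> : W s = Pt p dl (W (s + dl)).
    have t0 : 0 <= tau - (s + dl) by rewrite subr_ge0.
    rewrite /W -(Pt_comp_bounded mu p sg K _ _ _ dl0' t0 mw wK).
    by congr (Pt p _ w); ring.
  exact: dot_Pt mu p sg _ _ _ dl0' (L2W _) (L2GG _ s0).
have -> : psi (s + dl) = \int[mu]_y (W (s + dl) y * Pt p dl (G s) y ^+ 2).
  apply: Rint_eq_ae.
  - by apply: integ_bounded_mul (W_abs _) _ => //; apply: L2_sqr; exact: L2G.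
  - by apply: integ_bounded_mul (W_abs _) _ => //; exact: L2_sqr.
  - apply: filterS (Pt_comp_ae mu p sg dl s g dl0' s0 (L2_integ _ _ L2g)) => y.
    by rewrite addrC => ->.
rewrite -RintB.
- by apply: eq_Rintegral => y _; rewrite mulrBr.
- by apply: L2_mul => //; exact: L2W.
- by apply: integ_bounded_mul (W_abs _) _ => //; exact: L2_sqr.
Qed.

Let C := 2 * \int[mu]_y (Pt p tau w y * Gam y).

Let Gami : integ mu Gam. Proof. exact: carre_integ. Qed.
Let Gam0 : {ae mu, forall y, 0 <= Gam y}. Proof. exact: carre_du_champ_ge0. Qed.
(** A representative of [Gam] that is nonnegative everywhere, as [kernel_symm] requires. *)
Let Gp y := Num.max (Gam y) 0.
Let Gp0 y : 0 <= Gp y. Proof. by rewrite le_max lexx orbT. Qed.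
Let mGp : measurable_fun setT Gp.
Proof. by apply: measurable_maxr => //; exact: integ_meas Gami. Qed.
Let GpE : {ae mu, forall y, Gam y = Gp y}.
Proof. by apply: filterS Gam0 => y Gy; rewrite /Gp max_l. Qed.
Let Gpi : integ mu Gp.
Proof. by apply: integ_le_ae Gami _ => //; apply: filterS GpE => y ->. Qed.

(** Self-adjointness in L^2 does not apply to [Gam], which is only integrable; [kernel_symm], with a
    bounded weight and a nonnegative function, takes its place. *)
Let int_W_Gam (s : R) (v : E -> R) : 0 <= s -> measurable_fun setT v -> (forall y, 0 <= v y <= K) ->
  \int[mu]_y (v y * Pt p s Gam y) = \int[mu]_y (Pt p s v y * Gp y).
Proof.
move=> s0 mv vK.
have v0 y : 0 <= v y by case/andP: (vK y).
have vabs y : `|v y| <= K by case/andP: (vK y) => ? ?; rewrite ger0_norm.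
have Pv y : 0 <= Pt p s v y <= K by exact: Pt_bounded.
have Pvabs y : `|Pt p s v y| <= K by case/andP: (Pv y) => ? ?; rewrite ger0_norm.
have mPv : measurable_fun setT (Pt p s v) by exact: Pt_meas_bounded vK.
have i1 : integ mu (fun y => v y * Pt p s Gam y).
  by apply: integ_bounded_mul vabs _ => //; exact: Pt_integ.
have i2 : integ mu (fun y => v y * Pt p s Gp y).
  by apply: integ_bounded_mul vabs _ => //; exact: Pt_integ.
have i3 : integ mu (fun y => Pt p s v y * Gp y) by exact: integ_bounded_mul Pvabs _.
transitivity (\int[mu]_y (v y * Pt p s Gp y)).
  apply: Rint_eq_ae => //.
  by apply: filterS (Pt_eq_ae mu p sg s _ _ s0 Gami Gpi GpE) => y ->.
have mGE : measurable_fun setT (EFin \o Gp) by exact/measurable_EFinP.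
have G0E y : (0 <= (EFin \o Gp) y)%E by rewrite lee_fin.
have := kernel_symm mu p sg K s v _ s0 mv vK mGE G0E => H.
apply: EFin_inj; rewrite !RintE//.
transitivity (\int[mu]_y ((v y)%:E * \int[p s y]_z (Gp z)%:E))%E.
  apply: ae_eq_integral => //.
  - exact: measurable_int i2.
  - apply: emeasurable_funM; first exact/measurable_EFinP.
    exact: measurable_kernel_int.
  - apply: filterS (ae_kernel_integ mu p sg s _ s0 Gpi) => y Gy _.
    by rewrite EFinM (RintE (pk p s y)).
by rewrite H; apply: eq_integral => y _; rewrite EFinM.
Qed.

(* [s |-> \int W (P_s g)^2], with [W = P_(tau - s) w], has derivative
   [- 2 \int W Gamma (P_s g) >= - 2 \int W P_s (Gamma g) = - C]. *)
Lemma local_Poincare_weight :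
  \int[mu]_y (w y * Pt p tau (g \* g) y) - \int[mu]_y (w y * Pt p tau g y ^+ 2) <=
  2 * tau * \int[mu]_y (Pt p tau w y * Gam y).
Proof.
have -> : \int[mu]_y (w y * Pt p tau (g \* g) y) = psi 0.
  rewrite /psi subr0.
  transitivity (dot mu (Pt p tau w) (g \* g)); first by rewrite dot_Pt.
  apply: eq_Rintegral => y _; rewrite expr2 /Pt !(kernel_int0 mu p sg)//.
  exact: L2_meas L2g.
have -> : \int[mu]_y (w y * Pt p tau g y ^+ 2) = psi tau.
  by apply: eq_Rintegral => y _; rewrite subrr; congr (_ * _); rewrite /Pt (kernel_int0 mu p sg).
rewrite (_ : 2 * tau * _ = C * tau); last by rewrite /C; ring.
apply: dini_le => //.
- move=> s eta /andP[s0 stau] eta0.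
  have [DG DGG GP] := curv s s0.
  have gG := domL_gen mu p _ DG; have gGG := domL_gen mu p _ DGG.
  have K1 : 0 < K + 1 by have := K0; lra.
  have e10 : 0 < eta / 2 / (K + 1) by rewrite !divr_gt0.
  have [r1 r10 HD] := carre_quot mu p sg _ _ _ gG gGG _ e10.
  have [|eta' eta'0 HW] := small_int mu K Gp K0 Gpi Gp0 (eta / 4); first by rewrite divr_gt0.
  have [r2 r20 Hc] := strong_cont mu p sg w L2w eta' eta'0.
  exists (Num.min r1 r2); first by rewrite lt_min r10.
  move=> dl /andP[dl0]; rewrite lt_min => /andP[dr1 dr2] sdl.
  have dl0' := ltW dl0.
  rewrite psi_diff//.
  pose V := W (s + dl).
  pose q y := Lgen mu p (G s \* G s) y - 2 * (G s y * Lgen mu p (G s) y).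
  pose D y := (Pt p dl (G s \* G s) y - Pt p dl (G s) y ^+ 2) / dl.
  have qE y : q y = 2 * carre_du_champ mu p (G s) (G s) y.
    by rewrite carreE /q; field.
  have qi : integ mu q.
    by rewrite (funext qE); apply: integZ; exact: carre_integ.
  have Di : integ mu D.
    rewrite (_ : D = (fun y => dl^-1 * (Pt p dl (G s \* G s) y - Pt p dl (G s) y ^+ 2))).
      apply: integZ; apply: integB.
        by apply: L2_integ; apply: L2_Pt => //; exact: L2GG.
      by apply: L2_sqr; apply: L2_Pt => //; exact: L2G.
    by apply/funext => y; rewrite /D mulrC.
  have VD : integ mu (fun y => V y * D y) by exact: integ_bounded_mul (W_abs _) Di.
  have Vq : integ mu (fun y => V y * q y) by exact: integ_bounded_mul (W_abs _) qi.
  have -> : \int[mu]_y (V y * (Pt p dl (G s \* G s) y - Pt p dl (G s) y ^+ 2)) =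
      dl * \int[mu]_y (V y * D y).
    rewrite -RintZ//; apply: eq_Rintegral => y _; rewrite /D; field.
    by rewrite gt_eqF.
  rewrite mulrC ler_pM2r//.
  (* The allowance [eta] is split: [eta / 2] to replace the quotient by its limit here, and twice
     [eta / 4] in [S3] to replace [P_(tau-dl) w] by [P_tau w]. The curvature bound enters in
     [S2]. *)
  have S1 : \int[mu]_y (V y * D y) <= \int[mu]_y (V y * q y) + eta / 2.
    have Dq : integ mu (fun y => `|D y - q y|) by apply: integ_abs; exact: integB.
    apply: (@le_trans _ _ (\int[mu]_y (V y * q y + K * `|D y - q y|))).
      apply: Rint_le => //; first by apply: integD => //; exact: integZ.
      move=> y; have /andP[V0 VK] := WK (s + dl) y; rewrite -/(V y) in V0 VK.
      have := ler_norm (D y - q y); have := normr_ge0 (D y - q y); nra.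
    rewrite RintD//; last exact: integZ.
    rewrite lerD2l RintZ//.
    have := HD dl; rewrite dl0 dr1 => /(_ isT) HDl.
    apply: (@le_trans _ _ (K * (eta / 2 / (K + 1)))); first exact: ler_wpM2l.
    by rewrite mulrA ler_pdivrMr//; have := K0; nra.
  have S2 : \int[mu]_y (V y * q y) <= 2 * \int[mu]_y (V y * Pt p s Gam y).
    have i1 : integ mu (fun y => V y * Pt p s Gam y).
      by apply: integ_bounded_mul (W_abs _) _ => //; exact: Pt_integ.
    rewrite -RintZ//; apply: Rint_le_ae => //; first exact: integZ.
    apply: filterS GP => y Gy; rewrite qE mulrCA ler_pM2l//.
    by apply: ler_wpM2l => //; case/andP: (WK (s + dl) y).
  have S3 : \int[mu]_y (V y * Pt p s Gam y) <= \int[mu]_y (Pt p tau w y * Gp y) + eta / 4.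
    rewrite int_W_Gam//; [|exact: mW|exact: WK].
    have -> : Pt p s V = Pt p (tau - dl) w.
      have t0 : 0 <= tau - (s + dl) by rewrite subr_ge0.
      rewrite /V /W -(Pt_comp_bounded mu p sg K _ _ _ s0 t0 mw wK).
      by congr (Pt p _ w); ring.
    have td0 : 0 <= tau - dl by lra.
    have P1 y : 0 <= Pt p (tau - dl) w y <= K by exact: Pt_bounded.
    have P2 y : 0 <= Pt p tau w y <= K by exact: Pt_bounded.
    have i1 : integ mu (fun y => Pt p (tau - dl) w y * Gp y).
      apply: (integ_bounded_mul mu K) => //; first exact: Pt_meas_bounded wK.
      by move=> y; case/andP: (P1 y) => ? ?; rewrite ger0_norm.
    have i2 : integ mu (fun y => Pt p tau w y * Gp y).
      apply: (integ_bounded_mul mu K) => //; first exact: Pt_meas_bounded wK.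
      by move=> y; case/andP: (P2 y) => ? ?; rewrite ger0_norm.
    rewrite -lerBlDl -RintB//.
    apply: le_trans (ler_norm _) _; rewrite -normrN -mulN1r -RintZ; last exact: integB.
    under eq_Rintegral do rewrite mulN1r opprB -mulrBl.
    apply: HW.
    - by apply: L2B; apply: L2_Pt.
    - by move=> y; have := P1 y; have := P2 y; rewrite ler_norml; lra.
    - apply: le_trans (nrm_Pt_diff mu p sg _ _ _ _ L2w) _; first by rewrite td0; lra.
      by apply: Hc; rewrite (_ : tau - (tau - dl) = dl) ?dl0'//; ring.
  have S4 : \int[mu]_y (Pt p tau w y * Gp y) = \int[mu]_y (Pt p tau w y * Gam y).
    have mP : measurable_fun setT (Pt p tau w) by exact: Pt_meas_bounded wK.
    have P2 y : `|Pt p tau w y| <= K.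
      by case/andP: (Pt_bounded p K tau w mw wK y) => ? ?; rewrite ger0_norm.
    apply: Rint_eq_ae; [exact: integ_bounded_mul P2 _|exact: integ_bounded_mul P2 _|].
    by apply: filterS GpE => y ->.
  rewrite /C; lra.
(* The increment has a nonnegative integrand by Jensen, so its weight may be replaced by [K]. What
   remains is, by invariance, [K] times the difference of the squared norms of [P_s g] and [P_c g],
   small by strong continuity. *)
- move=> c e /andP[c0 ctau] e0.
  have n0 := nrm_ge0 mu g.
  pose e' := e / (K * (2 * nrm mu g) + 1).
  have D0 : 0 < K * (2 * nrm mu g) + 1 by have : 0 <= K * (2 * nrm mu g); [rewrite !mulr_ge0|lra].
  have e'0 : 0 < e' by rewrite divr_gt0.
  have [r r0 Hc] := strong_cont mu p sg g L2g e' e'0.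
  exists r => // s s0 /andP[cs sc].
  have dl0 : 0 < c - s by rewrite subr_gt0.
  have := psi_diff s (c - s) s0 dl0; rewrite subrKC => /(_ ctau) ->.
  have c0' := ltW c0.
  have LP : L2 mu (Pt p (c - s) (G s)) by exact: (L2_Pt mu p sg _ _ (ltW dl0) (L2G _ s0)).
  have LPP : L2 mu (Pt p (c - s) (G s \* G s)) by exact: (L2_Pt mu p sg _ _ (ltW dl0) (L2GG _ s0)).
  have iD : integ mu (fun y => Pt p (c - s) (G s \* G s) y - Pt p (c - s) (G s) y ^+ 2).
    by apply: integB; [exact: L2_integ|exact: L2_sqr].
  apply: (@le_trans _ _ (\int[mu]_y (K * (Pt p (c - s) (G s \* G s) y - Pt p (c - s) (G s) y ^+ 2)))).
    apply: Rint_le_ae.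
    - exact: integ_bounded_mul (W_abs _) iD.
    - exact: integZ.
    - apply: filterS (Pt_sqr_ae mu p sg (c - s) _ (ltW dl0) (L2G s s0)) => y Hy.
      have /andP[V0 VK] := WK c y.
      apply: ler_wpM2r => //; rewrite subr_ge0; move: Hy.
      by under [X in _ <= Pt p (c - s) X y -> _]eq_fun do rewrite expr2.
  rewrite RintZ//.
  have -> : \int[mu]_y (Pt p (c - s) (G s \* G s) y - Pt p (c - s) (G s) y ^+ 2) =
     nrm mu (G s) ^+ 2 - nrm mu (G c) ^+ 2.
    have ncE : nrm mu (G c) = nrm mu (Pt p (c - s) (G s)).
      apply: nrm_eq_ae; [exact: L2G|exact: LP|].
      apply: filterS (Pt_comp_ae mu p sg (c - s) s g (ltW dl0) s0 (L2_integ _ _ L2g)) => y.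
      by rewrite subrK.
    have iGG : integ mu (G s \* G s) by apply: L2_integ; exact: L2GG.
    rewrite RintB; [|exact: L2_integ|exact: L2_sqr].
    rewrite (Pt_int mu p sg _ _ (ltW dl0) iGG) ncE.
    rewrite !nrm_sqr.
    by congr (_ - _); apply: eq_Rintegral => y _; rewrite expr2.
  have H1 : nrm mu (G s) <= nrm mu (G c) + e'.
    have -> : G s = (fun y => G c y - (G c y - G s y)) by apply/funext => y; ring.
    apply: le_trans (nrmB mu _ _ _ _) _; [exact: L2G|by apply: L2B; exact: L2G|].
    rewrite lerD2l; apply: le_trans (nrm_Pt_diff mu p sg _ _ _ _ L2g) _; first by rewrite s0 ltW.
    by apply: Hc; rewrite (ltW dl0); lra.
  have H2 : nrm mu (G s) <= nrm mu g by exact: nrm_Pt.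
  have H3 : nrm mu (G c) <= nrm mu g by exact: nrm_Pt.
  have := nrm_ge0 mu (G s); have := nrm_ge0 mu (G c) => Gc0 Gs0.
  have H4 := sqr_diff_le _ _ _ _ Gs0 H2 Gc0 H3 (ltW e'0) H1.
  apply: (@le_trans _ _ (K * (e' * (2 * nrm mu g)))); first exact: ler_wpM2l.
  rewrite (_ : K * (e' * _) = e' * (K * (2 * nrm mu g))); last by ring.
  rewrite /e' mulrAC ler_pdivrMr//.
  by apply: ler_wpM2l; [exact: ltW|rewrite lerDl ler01].
Qed.

End fixed_weight.
End local_Poincare.

(** * Cauchy sequences in L^2 with a constant limit *)

Section tail_constant.
Context {R : realType} {d : measure_display} {T : measurableType d}.
Variables (P : probability T R) (M : nat -> T -> R) (c : R).

(** The event that [s (M j - c) > eta] for infinitely many [j]; the signs [s = 1] and [s = -1] cover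
    the two sides of [c]. For a martingale in reversed time this is a tail event, here an event of
    the germ field. *)
Definition often_above (s eta : R) : set T :=
  [set w | forall N : nat, exists2 j, (N <= j)%N & eta < s * (M j w - c)].

Hypothesis L2M : forall j, L2 P (M j).
Hypothesis cauchy : forall i j, (i <= j)%N ->
  \int[P]_w ((M i w - M j w) ^+ 2) <= (2^-1) ^+ (2 * i).
Hypothesis tail : forall s eta, `|s| = 1 -> 0 < eta ->
  measurable (often_above s eta) /\
  forall j, \int[P]_w (\1_(often_above s eta) w * (M j w - c)) = 0.

(** On the event [A] some [j >= N] has [s (M j - c) > eta], so [eta - s (M N - c)] is at most the
    sum of all increments [|M (i+1) - M i|] with [i >= N]. Integrated over [A], the term in [M N]
    vanishes by [tail], while the increments contribute at most the geometric sum [2 * 2^(-N)]. No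
    maximal inequality is called for. *)
Lemma often_above_null s eta : `|s| = 1 -> 0 < eta -> P (often_above s eta) = 0%E.
Proof.
move=> s1 eta0; have [mA A0] := tail s eta s1 eta0.
set A := often_above s eta in mA A0 *.
have i1 (b : T -> R) : integ P b -> integ P (fun w => \1_A w * b w).
  move=> ib; apply: (integ_bounded_mul P 1) => //.
  by move=> w; rewrite indicE; case: (_ \in _); rewrite ?normr1 ?normr0.
have iM j : integ P (fun w => M j w - c) by apply: integB; [exact: L2_integ|exact: integ_cst].
have mD i : measurable_fun setT (fun w => `|M i.+1 w - M i w|%:E).
  apply/measurable_EFinP; apply: measurableT_comp => //.
  by apply: measurable_funB; exact: L2_meas.
have ED i : (\int[P]_w `|M i.+1 w - M i w|%:E <= ((2^-1) ^+ i)%:E)%E.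
  have LD : L2 P (fun w => M i.+1 w - M i w) by exact: L2B.
  rewrite -RintE ?lee_fin; last by apply: integ_abs; exact: L2_integ.
  apply: le_trans (int_abs_le_nrm P _ LD) _.
  rewrite -ler_sqr ?nnegrE ?nrm_ge0 ?exprn_ge0 ?invr_ge0// nrm_sqr -exprM mulnC.
  apply: le_trans (cauchy i i.+1 (leqnSn i)).
  rewrite le_eqVlt; apply/orP; left; apply/eqP.
  by apply: eq_Rintegral => w _; ring.
have bound N : eta * fine (P A) <= 2 * (2^-1) ^+ N.
  pose S w := (\sum_(i <oo) `|M (N + i).+1 w - M (N + i)%N w|%:E)%E.
  have S0 w : (0 <= S w)%E by apply: nneseries_ge0 => i _ _; rewrite lee_fin.
  have mS : measurable_fun setT S.
    by apply: ge0_emeasurable_sum => [i w _ _|i _]; [rewrite lee_fin|exact: mD].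
  have IS : (\int[P]_w S w <= (2 * (2^-1) ^+ N)%:E)%E.
    rewrite integral_nneseries//.
    apply: (@le_trans _ _ (\sum_(i <oo) ((2^-1) ^+ (N + i))%:E)%E).
      by apply: lee_nneseries => [i _ _|i _]; [apply: integral_ge0 => w _; rewrite lee_fin|exact: ED].
    apply: lime_le.
      by apply: is_cvg_nneseries => i _ _; rewrite lee_fin exprn_ge0// invr_ge0.
    apply: nearW => n; rewrite sumEFin lee_fin.
    suff -> : \sum_(0 <= i < n) (2^-1 : R) ^+ (N + i) = 2 * 2^-1 ^+ N - 2 * 2^-1 ^+ (N + n).
      by rewrite gerBl mulr_ge0// exprn_ge0// invr_ge0.
    elim: n => [|n ih]; first by rewrite big_geq// addn0 subrr.
    by rewrite big_nat_recr//= ih addnS exprS; field.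
  pose h w := \1_A w * (eta - s * (M N w - c)).
  have ih : integ P h.
    by apply: i1; apply: integB; [exact: integ_cst|apply: integZ; exact: iM].
  have -> : eta * fine (P A) = \int[P]_w h w.
    transitivity (\int[P]_w (eta * \1_A w - s * (\1_A w * (M N w - c)))).
      have iA : integ P (fun w => (\1_A w : R)).
        by have := i1 _ (integ_cst P 1); under [X in integ _ X -> _]eq_fun do rewrite mulr1.
      rewrite (RintB P) ?(RintZ P _ _ iA) ?(RintZ P _ _ (i1 _ (iM N))); [|exact: integZ|].
        rewrite A0 mulr0 subr0; congr (_ * _).
        by rewrite /Rintegral integral_indic// setIT.
      by apply: integZ; exact: i1 (iM N).
    by apply: eq_Rintegral => w _; rewrite /h; ring.
  have mh := integ_meas _ _ ih.
  pose hp w := Num.max (h w) 0.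
  have hp0 w : 0 <= hp w by rewrite le_max lexx orbT.
  have mhp : measurable_fun setT hp by exact: measurable_maxr.
  have ihp : integ P hp.
    by apply: (integ_le P _ h) => // w; rewrite ger0_norm// /hp ge_max normr_ge0 ler_norm.
  apply: (@le_trans _ _ (\int[P]_w hp w)).
    by apply: Rint_le => // w; rewrite le_max lexx.
  rewrite -lee_fin RintE//; apply: le_trans IS; apply: ge0_le_integral => //.
  - by move=> w _; rewrite lee_fin.
  - exact/measurable_EFinP.
  move=> w _; rewrite /hp /h indicE.
  have [wA|_] := boolP (w \in A); last by rewrite mul0r maxxx S0.
  rewrite mul1r; have := set_mem wA => /(_ N)[j Nj sj].
  rewrite /Num.max; case: ifPn => // _.
  apply: (@le_trans _ _ (\sum_(0 <= i < j - N) `|M (N + i).+1 w - M (N + i)%N w|%:E)%E); last first.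
    by apply: nneseries_lim_ge => i _; rewrite lee_fin.
  rewrite sumEFin lee_fin.
  have -> : eta - s * (M N w - c) = (eta - s * (M j w - c)) + s * (M j w - M N w) by ring.
  apply: (@le_trans _ _ (s * (M j w - M N w))); first by lra.
  apply: (le_trans (ler_norm _)); rewrite normrM s1 mul1r.
  have -> : M j w - M N w = \sum_(0 <= i < j - N) (M (N + i).+1 w - M (N + i)%N w).
    under eq_bigr do rewrite -addnS.
    by rewrite (telescope_sumr (fun i => M (N + i)%N w))// subnKC// addn0.
  exact: ler_norm_sum.
have PA : fine (P A) <= 0.
  rewrite leNgt; apply/negP => PA0.
  have e0 : 0 < eta * fine (P A) / 4 by rewrite divr_gt0// mulr_gt0.
  have : (2^-1 : R) ^+ n @[n --> \oo] --> 0.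
    by apply: cvg_expr; rewrite ger0_norm ?invr_ge0// invf_lt1// ltr1n.
  move=> /cvgrPdist_le/(_ _ e0)[N _ /(_ N (leqnn N))] /=.
  rewrite sub0r normrN ger0_norm ?exprn_ge0 ?invr_ge0// => H.
  have := bound N; lra.
apply/eqP; rewrite -(fineK (fin_num_measure P _ mA)) eqe eq_le PA/=.
exact: fine_ge0.
Qed.

Lemma tail_constant_cvg : {ae P, forall w, M j w @[j --> \oo] --> c}.
Proof.
have : P.-negligible (\bigcup_k (often_above 1 k.+1%:R^-1 `|` often_above (-1) k.+1%:R^-1)).
  apply: negligible_bigcup => k; apply: negligibleU.
  - apply/negligibleP; first by apply: (tail _ _ _ _).1; rewrite ?normr1.
    by apply: often_above_null; rewrite ?normr1.
  - apply/negligibleP; first by apply: (tail _ _ _ _).1; rewrite ?normrN1.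
    by apply: often_above_null; rewrite ?normrN1.
apply: negligibleS => w /= nc; apply: contrapT => nU; apply: nc.
apply/cvgrPdist_le => e e0.
pose k := Num.bound e^-1.
have ke : k.+1%:R^-1 <= e.
  rewrite -[leRHS]invrK lef_pV2 ?posrE ?invr_gt0//.
  apply: (le_trans (ltW (archi_boundP _))); first by rewrite invr_ge0 ltW.
  by rewrite ler_nat.
have /not_orP[n1 n2] : ~ (often_above 1 k.+1%:R^-1 w \/ often_above (-1) k.+1%:R^-1 w).
  by move=> H; apply: nU; exists k.
have [N1 HN1] : exists N : nat, forall j, (N <= j)%N -> M j w - c <= k.+1%:R^-1.
  apply: contrapT => H; apply: n1 => N; apply: contrapT => H2; apply: H.
  exists N => j Nj; rewrite leNgt; apply/negP => H3; apply: H2.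
  by exists j => //; rewrite mul1r.
have [N2 HN2] : exists N : nat, forall j, (N <= j)%N -> c - M j w <= k.+1%:R^-1.
  apply: contrapT => H; apply: n2 => N; apply: contrapT => H2; apply: H.
  exists N => j Nj; rewrite leNgt; apply/negP => H3; apply: H2.
  by exists j => //; rewrite mulN1r opprB.
exists (maxn N1 N2) => // j /=; rewrite geq_max => /andP[j1 j2].
have := HN1 j j1; have := HN2 j j2; set z := k.+1%:R^-1 in ke * => h2 h1.
by rewrite ler_norml; apply/andP; split; lra.
Qed.

(* Unless [M] converges to [c], it stays away from [c] infinitely often on one
   side, and [M j - c] has integral zero on this tail event. *)
Lemma tail_constant_L2 N : \int[P]_w ((M N w - c) ^+ 2) <= (2^-1) ^+ (2 * N).
Proof.
pose q j w := ((M N w - M j w) ^+ 2)%:E.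
have mq j : measurable_fun setT (q j).
  apply/measurable_EFinP; apply: measurable_funX.
  by apply: measurable_funB; exact: L2_meas.
have q0 j w : (0 <= q j w)%E by rewrite lee_fin sqr_ge0.
have iN : integ P (fun w => (M N w - c) ^+ 2).
  by apply: L2_sqr; apply: L2B => //; exact: L2_cst.
rewrite -lee_fin RintE//.
(* Fatou's lemma along the almost sure limit [M j --> c]; the lower limit serves as integrand
   because it is measurable and defined everywhere. *)
have -> : (\int[P]_w ((M N w - c) ^+ 2)%:E = \int[P]_w limn_einf (q ^~ w))%E.
  apply: ae_eq_integral => //.
  - exact: measurable_int iN.
  - rewrite (_ : (fun w => _) = (fun w => - limn_esup (fun j => - q j w))%E); last first.
      apply/funext => w; rewrite -limn_einfN; congr limn_einf.
      by apply/funext => j; apply/esym; exact: oppeK.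
    apply: measurableT_comp => //; apply: measurable_fun_limn_esup => j.
    exact: measurableT_comp.
  - apply: filterS tail_constant_cvg => w Mc _.
    have : q j w @[j --> \oo] --> ((M N w - c) ^+ 2)%:E.
      apply: cvg_EFin; first by apply: nearW => j.
      by apply: cvgM; apply: cvgB => //; exact: cvg_cst.
    by move=> /cvg_limn_einf_sup[-> _].
apply: (le_trans (fatou P measurableT mq _)) => //.
rewrite limn_einf_lim; apply: lime_le; first exact: is_cvg_einfs.
apply: nearW => n; apply: (@le_trans _ _ (\int[P]_w q (maxn n N) w)%E).
  by apply: ereal_inf_lbound; exists (maxn n N) => //=; exact: leq_maxl.
rewrite -RintE ?lee_fin; first by apply: cauchy; exact: leq_maxr.
by apply: L2_sqr; exact: L2B.
Qed.

End tail_constant.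

(** * The germ field at time 0 *)

Section process.
Context {R : realType} {d d' : measure_display}.
Context {E : measurableType d} {Omega : measurableType d'}.
Variables (mu : probability E R) (p : R -> R.-pker E ~> E).
Variables (P : probability Omega R) (X : R -> {RV P >-> E}) (x : E).
Hypotheses (sg : markov_semigroup mu p) (mk : markov_process p X).
Hypothesis start : {ae P, forall w, X 0 w = x}.

Lemma right_filtrationT s : right_filtration X s setT.
Proof.
move=> u _; rewrite /natural_filtration.
have [S0 SC _] := smallest_sigma_algebra setT (\bigcup_(v in `[0, u]) preimage_set_system setT (X v) measurable).
by have := SC _ S0; rewrite setD0.
Qed.

Lemma natural_filtrationX (u v : R) B : 0 <= v <= u -> measurable B ->
  natural_filtration X u (X v @^-1` B).
Proof.
move=> vu mB; apply: sub_gen_smallest; exists v; first by rewrite /= in_itv.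
by exists B => //; rewrite setTI.
Qed.

Lemma right_filtrationX s B : 0 <= s -> measurable B -> right_filtration X s (X s @^-1` B).
Proof.
move=> s0 mB u /=; rewrite in_itv/= andbT => su.
by apply: natural_filtrationX => //; rewrite s0 ltW.
Qed.

Lemma measurable_preimX s B : measurable B -> measurable (X s @^-1` B).
Proof. by move=> mB; rewrite -[X in measurable X]setTI; exact: measurable_funP. Qed.

Lemma right_filtration_measurable s A : right_filtration X s A -> measurable A.
Proof.
have s1 : `]s, +oo[%classic (s + 1) by rewrite /= in_itv/= andbT ltrDl.
move=> /(_ _ s1); apply: smallest_sub; first exact: sigma_algebra_measurable.
by move=> _ [v _ [B mB <-]]; rewrite setTI; exact: measurable_preimX.
Qed.

Lemma measurable_compX s {d2} {T : measurableType d2} (b : E -> T) :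
  measurable_fun setT b -> measurable_fun setT (fun w => b (X s w)).
Proof. by move=> mb; apply: measurableT_comp => //; exact: measurable_funP. Qed.

Local Open Scope ereal_scope.

Lemma markov_int (s t : R) A (b : E -> \bar R) : (0 <= s)%R -> (0 <= t)%R ->
  right_filtration X s A -> measurable_fun setT b -> (forall y, 0 <= b y) ->
  \int[P]_w ((\1_A w)%:E * b (X (s + t)%R w)) =
  \int[P]_w ((\1_A w)%:E * \int[p t (X s w)]_y b y).
Proof.
move=> s0 t0 FA; have mA := right_filtration_measurable _ _ FA.
have m1 : measurable_fun setT (fun w => (\1_A w : R)%:E) by exact/measurable_EFinP.
move: b; apply: daniell_eq.
- apply: daniell_integral => [w|b mb b0].
    by apply: daniell_scale => //; exact: daniell_eval.
  by apply: emeasurable_funM => //; exact: measurable_compX.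
- apply: daniell_integral => [w|b mb b0].
    by apply: daniell_scale => //; exact: daniell_measure.
  apply: emeasurable_funM => //.
  exact: (measurable_compX s (fun y => \int[p t y]_z b z) (measurable_kernel_int _ _ _ mb b0)).
move=> B mB.
have H := mk s t A B s0 t0 FA mB.
have mXB := measurable_preimX (s + t)%R B mB.
transitivity (P (A `&` X (s + t)%R @^-1` B)).
  rewrite -[in RHS](setIT (A `&` _)) -integral_indic//; last exact: measurableI.
  by apply: eq_integral => w _ /=; rewrite indicI/= EFinM.
rewrite H integral_mkcond.
apply: eq_integral => w _; rewrite /patch indicE integral_indic// setIT.
by case: (w \in A); rewrite ?mul1e ?mul0e.
Qed.

(** The germ field at 0 is independent of [X t]: the Markov property at time 0 conditions on
    [right_filtration X 0], and [X 0] is almost surely the fixed point [x]. *)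
Lemma initial_int A (t : R) (b : E -> \bar R) : (0 <= t)%R ->
  right_filtration X 0 A -> measurable_fun setT b -> (forall y, 0 <= b y) ->
  \int[P]_w ((\1_A w)%:E * b (X t w)) = P A * \int[p t x]_y b y.
Proof.
move=> t0 FA mb b0; have mA := right_filtration_measurable _ _ FA.
have := markov_int 0 t A b (lexx _) t0 FA mb b0; rewrite add0r => ->.
have K0 y : 0 <= \int[p t y]_z b z by exact: integral_ge0.
have mK : measurable_fun setT (fun w => (\1_A w : R)%:E * \int[p t (X 0 w)]_y b y).
  apply: emeasurable_funM; first exact/measurable_EFinP.
  exact: (measurable_compX 0 (fun y => \int[p t y]_z b z) (measurable_kernel_int _ _ _ mb b0)).
transitivity (\int[P]_w ((\1_A w : R)%:E * \int[p t x]_y b y)).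
  apply: ge0_ae_eq_integral => //.
  - by apply: emeasurable_funM => //; exact/measurable_EFinP.
  - by move=> w _; rewrite mule_ge0.
  - by move=> w _; rewrite mule_ge0.
  - by apply: filterS start => w -> _.
rewrite ge0_integralZr//; last exact/measurable_EFinP.
by rewrite integral_indic// setIT.
Qed.

Lemma law_int (t : R) (b : E -> \bar R) : (0 <= t)%R ->
  measurable_fun setT b -> (forall y, 0 <= b y) ->
  \int[P]_w b (X t w) = \int[p t x]_y b y.
Proof.
move=> t0 mb b0; have := initial_int setT t b t0 (right_filtrationT 0) mb b0.
rewrite probability_setT mul1e => <-.
by apply: eq_integral => w _; rewrite indicE in_setT mul1e.
Qed.

Lemma law_X (t : R) B : (0 <= t)%R -> measurable B -> P (X t @^-1` B) = p t x B.
Proof.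
move=> t0 mB; have mXB := measurable_preimX t B mB.
have H := law_int t (EFin \o \1_B) t0 _ _.
transitivity (\int[P]_w (EFin \o \1_(X t @^-1` B)) w); first by rewrite integral_indic// setIT.
transitivity (\int[p t x]_y (EFin \o \1_B) y); last by rewrite integral_indic// setIT.
by rewrite -H//; [exact/measurable_EFinP|move=> y; rewrite /= lee_fin].
Qed.

(** Two transfers from indicators, in [b] and then in [a]. For two indicators it is the Markov
    property at time [u], with the event that [X u] lies in [A]. *)
Lemma joint_int (u t : R) (a b : E -> R) : (0 <= u)%R -> (0 <= t)%R ->
  measurable_fun setT a -> measurable_fun setT b ->
  (forall y, 0 <= a y)%R -> (forall y, 0 <= b y)%R ->
  \int[P]_w ((a (X u w))%:E * (b (X (u + t)%R w))%:E) =
  \int[p u x]_y ((a y)%:E * \int[p t y]_z (b z)%:E).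
Proof.
move=> u0 t0 ma mb a0 b0.
have mE (c : E -> R) : measurable_fun setT c -> measurable_fun setT (EFin \o c).
  by move=> mc; exact/measurable_EFinP.
have mK (c : E -> \bar R) : measurable_fun setT c -> (forall y, 0 <= c y) ->
    measurable_fun setT (fun y => \int[p t y]_z c z) by exact: measurable_kernel_int.
rewrite -(law_int u (fun y => (a y)%:E * \int[p t y]_z (b z)%:E))//; last 2 first.
- apply: emeasurable_funM; first exact: mE.
  by apply: mK; [exact: mE|move=> y; rewrite lee_fin].
- by move=> y; rewrite mule_ge0 ?lee_fin// integral_ge0// => z _; rewrite lee_fin.
pose F (c : E -> \bar R) := \int[P]_w ((a (X u w))%:E * c (X (u + t)%R w)).
pose G (c : E -> \bar R) := \int[P]_w ((a (X u w))%:E * \int[p t (X u w)]_z c z).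
have dF : daniell F.
  apply: daniell_integral => [w|c mc c0].
    by apply: daniell_scale => //; exact: daniell_eval.
  by apply: emeasurable_funM; [exact: measurable_compX (mE _ ma)|exact: measurable_compX].
have dG : daniell G.
  apply: daniell_integral => [w|c mc c0].
    by apply: daniell_scale => //; exact: daniell_measure.
  apply: emeasurable_funM; first exact: measurable_compX (mE _ ma).
  exact: measurable_compX (mK _ mc c0).
suff FG A : measurable A -> F (EFin \o \1_A) = G (EFin \o \1_A).
  by apply: (daniell_eq F G dF dG FG (EFin \o b) (mE _ mb)) => y; rewrite lee_fin.
move: A => B mB.
have fE y : (fine (p t y B))%:E = p t y B.
  by rewrite fineK//; exact: (fin_num_measure (pk p t y)).
have mpB : measurable_fun setT (fun y => fine (p t y B)).
  by apply: measurableT_comp => //; exact: measurable_kernel.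
pose F' (c : E -> \bar R) := \int[P]_w ((\1_B (X (u + t)%R w) : R)%:E * c (X u w)).
pose G' (c : E -> \bar R) := \int[P]_w ((fine (p t (X u w) B))%:E * c (X u w)).
have FE : F (EFin \o \1_B) = F' (EFin \o a) by apply: eq_integral => w _; rewrite muleC.
have GE : G (EFin \o \1_B) = G' (EFin \o a).
  by apply: eq_integral => w _; rewrite integral_indic// setIT fE muleC.
have dF' : daniell F'.
  apply: daniell_integral => [w|c mc c0].
    by apply: daniell_scale => //; exact: daniell_eval.
  apply: emeasurable_funM; last exact: measurable_compX.
  by apply/measurable_EFinP; apply: (measurable_compX (u + t)%R (\1_B : E -> R)).
have dG' : daniell G'.
  apply: daniell_integral => [w|c mc c0].
    by apply: daniell_scale; [exact: fine_ge0|exact: daniell_eval].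
  apply: emeasurable_funM; last exact: measurable_compX.
  by apply/measurable_EFinP; exact: (measurable_compX u (fun y => fine (p t y B))).
rewrite FE GE; suff FG A : measurable A -> F' (EFin \o \1_A) = G' (EFin \o \1_A).
  by apply: (daniell_eq F' G' dF' dG' FG (EFin \o a) (mE _ ma)) => y; rewrite lee_fin.
move=> mA.
have := markov_int u t _ (EFin \o \1_B) u0 t0 (right_filtrationX u A u0 mA).
have m1B : measurable_fun setT (EFin \o (\1_B : E -> R)) by apply: mE; exact: measurable_indic.
move=> /(_ m1B) H.
transitivity (\int[P]_w ((\1_(X u @^-1` A) w : R)%:E * (EFin \o \1_B) (X (u + t)%R w))).
  by apply: eq_integral => w _; rewrite muleC.
rewrite H; last by move=> y; rewrite /= lee_fin.
by apply: eq_integral => w _; rewrite integral_indic// setIT fE muleC.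
Qed.

Local Close Scope ereal_scope.

Lemma integ_law (t : R) b : 0 <= t -> integ (pk p t x) b -> integ P (fun w => b (X t w)).
Proof.
move=> t0 ib; have mb := integ_meas _ _ ib.
case/integrableP: ib => mE ib; apply/integrableP; split.
  by apply/measurable_EFinP; exact: measurable_compX.
have mab : measurable_fun setT (fun y => `|(b y)%:E|%E) by exact: measurableT_comp.
by rewrite (law_int t (fun y => `|(b y)%:E|%E)).
Qed.

Lemma Rint_law (t : R) (b : E -> R) : 0 <= t -> measurable_fun setT b -> (forall y, 0 <= b y) ->
  \int[P]_w b (X t w) = \int[pk p t x]_y b y.
Proof.
move=> t0 mb b0; rewrite /Rintegral (law_int t (EFin \o b))//.
exact/measurable_EFinP.
Qed.

Lemma Rint_initial A (t : R) b : 0 <= t -> right_filtration X 0 A ->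
  integ (pk p t x) b -> \int[P]_w (\1_A w * b (X t w)) = fine (P A) * \int[pk p t x]_y b y.
Proof.
move=> t0 FA ib; have mb := integ_meas _ _ ib.
have mA := right_filtration_measurable _ _ FA.
have i1 c : integ (pk p t x) c -> integ P (fun w => \1_A w * c (X t w)).
  move=> ic; apply: (integ_bounded_mul P 1) => //; last exact: integ_law.
  by move=> w; rewrite indicE; case: (_ \in _); rewrite ?normr1 ?normr0.
have nn c : (forall y, 0 <= c y) -> integ (pk p t x) c ->
    \int[P]_w (\1_A w * c (X t w)) = fine (P A) * \int[pk p t x]_y c y.
  move=> c0 ic; have mc := integ_meas _ _ ic.
  apply: EFin_inj; rewrite RintE; last exact: i1.
  rewrite EFinM fineK; last exact: fin_num_measure.
  rewrite (RintE (pk p t x))// -(initial_int A t (EFin \o c))//.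
  exact/measurable_EFinP.
have ai := integ_abs _ _ ib.
have fpi : integ (pk p t x) (fun y => `|b y| + b y) by exact: integD.
have fp0 y : 0 <= `|b y| + b y by have := ler_norm (- b y); rewrite normrN; lra.
have e1 := nn _ (fun y => normr_ge0 _) ai; have e2 := nn _ fp0 fpi.
transitivity (\int[P]_w (\1_A w * (`|b (X t w)| + b (X t w)) - \1_A w * `|b (X t w)|)).
  by apply: eq_Rintegral => w _; ring.
rewrite (RintB P); [|exact: i1 fpi|exact: i1 ai].
rewrite e1 e2 -mulrBr; congr (_ * _).
by rewrite -(RintB (pk p t x))//; apply: eq_Rintegral => y _; ring.
Qed.

Lemma L2_law (t : R) b : 0 <= t -> L2 (pk p t x) b -> L2 P (fun w => b (X t w)).
Proof.
move=> t0 /L2P[mb ib]; apply/L2P; split; first exact: measurable_compX.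
exact: (integ_law t (fun y => b y ^+ 2)).
Qed.

(** [Pt_comp] at [x] for [b] and for its square, together with Jensen's inequality for [p t y]. All
    of this concerns the law of the process and makes no use of [mu]-almost every point. *)
Lemma kernel_L2 (u t : R) b : 0 <= u -> 0 <= t -> L2 (pk p (u + t) x) b ->
  [/\ {ae pk p u x, forall y, L2 (pk p t y) b}, L2 (pk p u x) (Pt p t b) &
   Pt p u (Pt p t b) x = Pt p (u + t) b x].
Proof.
move=> u0 t0 Lb.
have [i1 e1] := Pt_comp mu p sg _ _ _ _ u0 t0 (L2_integ _ _ Lb).
have mb := L2_meas _ _ Lb.
have [i2 _] := Pt_comp mu p sg _ _ _ _ u0 t0 (L2_sqr _ _ Lb).
have mb2 : measurable_fun setT (fun y => ((b y) ^+ 2)%:E).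
  by apply/measurable_EFinP; exact: measurable_funX.
have b20 y : (0 <= ((b y) ^+ 2)%:E)%E by rewrite lee_fin sqr_ge0.
have aeL : {ae pk p u x, forall y, L2 (pk p t y) b}.
  have CK := kernel_int_comp mu p sg u t x _ u0 t0 mb2 b20.
  have iK : (pk p u x).-integrable setT (fun z => \int[p t z]_w ((b w) ^+ 2)%:E)%E.
    apply/integrableP; split; first exact: measurable_kernel_int.
    under eq_integral do rewrite gee0_abs ?integral_ge0//.
    rewrite -CK; have /integrableP[_] := L2_sqr _ _ Lb.
    by under [X in (X < _)%E -> _]eq_integral do rewrite gee0_abs ?lee_fin ?sqr_ge0//.
  apply: filterS (integrable_ae measurableT iK) => z /(_ I) fz.
  apply/L2P; split => //; apply/integrableP; split => //.
  under eq_integral do rewrite gee0_abs ?lee_fin ?sqr_ge0//.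
  by rewrite -ge0_fin_numE ?integral_ge0// => w _; exact: b20.
split => //.
apply/L2P; split; first exact: Pt_meas.
apply: (integ_le_ae _ _ _ _ i2); first by apply: measurable_funX; exact: Pt_meas.
apply: filterS aeL => y Ly.
rewrite !ger0_norm ?sqr_ge0 ?Pt_ge0//.
have := Cauchy_Schwarz (pk p t y) _ _ Ly (L2_cst (pk p t y) 1).
rewrite nrm_cst normr1 mulr1 -ler_sqr ?nnegrE ?nrm_ge0// nrm_sqr real_normK ?num_real//.
rewrite /dot; under eq_Rintegral do rewrite mulr1.
by under [X in _ <= X -> _]eq_Rintegral do rewrite -expr2.
Qed.

Lemma Rint_joint (u t : R) a b : 0 <= u -> 0 <= t -> L2 (pk p u x) a ->
  L2 (pk p (u + t) x) b ->
  dot P (fun w => a (X u w)) (fun w => b (X (u + t) w)) = dot (pk p u x) a (Pt p t b).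
Proof.
move=> u0 t0 La Lb.
have ut0 : 0 <= u + t by exact: addr_ge0.
have nn a' b' : (forall y, 0 <= a' y) -> (forall y, 0 <= b' y) -> L2 (pk p u x) a' ->
    L2 (pk p (u + t) x) b' ->
    dot P (fun w => a' (X u w)) (fun w => b' (X (u + t) w)) = dot (pk p u x) a' (Pt p t b').
  move=> a0 b0 La' Lb'.
  have ma := L2_meas _ _ La'; have mb := L2_meas _ _ Lb'.
  have [aeL LP _] := kernel_L2 u t b' u0 t0 Lb'.
  rewrite /dot; apply: EFin_inj.
  rewrite RintE; last by apply: L2_mul; exact: L2_law.
  rewrite (RintE (pk p u x)); last exact: L2_mul.
  transitivity (\int[P]_w ((a' (X u w))%:E * (b' (X (u + t) w))%:E))%E.
    by apply: eq_integral => w _; rewrite EFinM.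
  rewrite joint_int//; apply: ae_eq_integral => //.
  - apply: emeasurable_funM; first exact/measurable_EFinP.
    by apply: measurable_kernel_int; [exact/measurable_EFinP|move=> y; rewrite lee_fin].
  - exact: measurable_int (L2_mul _ _ _ La' LP).
  - by apply: filterS aeL => y Ly _; rewrite EFinM /Pt (RintE (pk p t y))//; exact: L2_integ.
have pos (m : probability E R) c : L2 m c -> L2 m (fun y => `|c y| + c y) by move=> ?; l2.
have pos0 (c : E -> R) y : 0 <= `|c y| + c y.
  by have := ler_norm (- c y); rewrite normrN; lra.
have semi a' : (forall y, 0 <= a' y) -> L2 (pk p u x) a' ->
    dot P (fun w => a' (X u w)) (fun w => b (X (u + t) w)) = dot (pk p u x) a' (Pt p t b).
  move=> a0 La'.
  have e1 := nn _ _ a0 (pos0 b) La' (pos _ _ Lb).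
  have e2 := nn _ _ a0 (fun y => normr_ge0 (b y)) La' (L2_abs _ _ Lb).
  have Lba := L2_law _ _ ut0 (L2_abs _ _ Lb).
  have Lbp := L2_law _ _ ut0 (pos _ _ Lb).
  have LaX := L2_law _ _ u0 La'.
  have [aeL LP _] := kernel_L2 u t b u0 t0 Lb.
  have [_ LPa _] := kernel_L2 u t _ u0 t0 (L2_abs _ _ Lb).
  have [_ LPp _] := kernel_L2 u t _ u0 t0 (pos _ _ Lb).
  transitivity (dot P (fun w => a' (X u w)) (fun w => (`|b (X (u + t) w)| + b (X (u + t) w)) - `|b (X (u + t) w)|)).
    by congr dot; apply/funext => w; ring.
  rewrite dotBr; [|exact: Lbp|exact: Lba|exact: LaX].
  rewrite e1 e2 -dotBr; [|exact: LPp|exact: LPa|exact: La'].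
  apply: Rint_eq_ae; [by apply: L2_mul => //; exact: L2B|exact: L2_mul|].
  apply: filterS aeL => y Ly; congr (_ * _).
  have iy := L2_integ _ _ Ly.
  rewrite (Pt_D p t (fun y => `|b y|) b y (integ_abs (pk p t y) _ iy) iy); ring.
have e1 := semi _ (pos0 a) (pos _ _ La).
have e2 := semi _ (fun y => normr_ge0 (a y)) (L2_abs _ _ La).
have Laa := L2_law _ _ u0 (L2_abs _ _ La).
have Lap := L2_law _ _ u0 (pos _ _ La).
have LbX := L2_law _ _ ut0 Lb.
have [_ LP _] := kernel_L2 u t b u0 t0 Lb.
transitivity (dot P (fun w => (`|a (X u w)| + a (X u w)) - `|a (X u w)|) (fun w => b (X (u + t) w))).
  by congr dot; apply/funext => w; ring.
rewrite dotBl// e1 e2 -dotBl//; [|exact: pos|exact: L2_abs].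
by congr dot; apply/funext => y; ring.
Qed.


(** For any [r > 0] the event is unchanged when the finitely many indices [j < J] are dropped, and
    for the others [u j <= 1 / (j + 1) <= r]; hence it belongs to the past of every [r > 0]. *)
Lemma right_filtration0_often_above (M : nat -> E -> R) (u : nat -> R) c s eta :
  (forall j, measurable_fun setT (M j)) -> (forall j, 0 < u j <= j.+1%:R^-1) ->
  right_filtration X 0 (often_above (fun j w => M j (X (u j) w)) c s eta).
Proof.
move=> mM uP r /=; rewrite in_itv/= andbT => r0.
pose B j := [set y | eta < s * (M j y - c)].
have mB j : measurable (B j).
  have mf : measurable_fun setT (fun y => s * (M j y - c)).
    by apply: measurable_funM => //; exact: measurable_funB.
  rewrite (_ : B j = (fun y => s * (M j y - c)) @^-1` `]eta, +oo[%classic).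
    by rewrite -[X in measurable X]setTI; exact: mf.
  by apply/seteqP; split => y; rewrite /B /= in_itv/= andbT.
pose J := Num.bound r^-1.
have FB j : (J <= j)%N -> natural_filtration X r (X (u j) @^-1` B j).
  move=> Jj; apply: natural_filtrationX => //; have /andP[u0 uj] := uP j.
  rewrite (ltW u0)/= (le_trans uj)//.
  rewrite -[leRHS]invrK lef_pV2 ?posrE ?invr_gt0//.
  apply: (le_trans (ltW (archi_boundP _))); first by rewrite invr_ge0 ltW.
  by rewrite ler_nat (leq_trans Jj).
have [_ SC SU] : sigma_algebra setT (natural_filtration X r) by exact: smallest_sigma_algebra.
rewrite (_ : often_above _ _ _ _ = \bigcap_N \bigcup_j (X (u (J + N + j)%N) @^-1` B (J + N + j)%N)).
  rewrite -[Y in natural_filtration X r Y]setCK setC_bigcap -setTD.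
  apply: (SC _); apply: (SU _) => n; rewrite -setTD; apply: (SC _); apply: (SU _) => j.
  by apply: FB; rewrite -addnA leq_addr.
apply/seteqP; split => [w wA N _|w wA N].
  have [j jN jP] := wA (J + N)%N; exists (j - (J + N))%N => //.
  by rewrite subnKC.
have [j _ jP] := wA N I; exists (J + N + j)%N => //.
by rewrite -addnA (leq_trans _ (leq_addl _ _))// leq_addr.
Qed.

(* [M_u = P_(t-u) b (X_u)] is a martingale, and its limit as [u] decreases to 0
   is measurable for the germ field at 0, on which [P_t b (x)] is the mean
   (Blumenthal's 0-1 law): the limit is this constant. *)
Lemma germ_variance (t : R) b : 0 < t -> L2 (pk p t x) b -> forall e, 0 < e ->
  exists2 u, 0 < u < t &
    \int[pk p u x]_y (Pt p (t - u) b y ^+ 2) <= Pt p t b x ^+ 2 + e.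
Proof.
move=> t0 Lb e e0.
pose N u := Pt p (t - u) b.
pose a u := \int[pk p u x]_y (N u y ^+ 2).
pose c := Pt p t b x.
have K u : 0 <= u <= t -> [/\ {ae pk p u x, forall y, L2 (pk p (t - u) y) b},
    L2 (pk p u x) (N u) & Pt p u (N u) x = c].
  move=> /andP[u0 ut]; have tu0 : 0 <= t - u by rewrite subr_ge0.
  by have := kernel_L2 u (t - u) b u0 tu0; rewrite subrKC; exact.
have LN u : 0 <= u <= t -> L2 (pk p u x) (N u) by move=> /K[].
have LM u : 0 <= u <= t -> L2 P (fun w => N u (X u w)).
  by move=> ut; apply: L2_law; [case/andP: ut|exact: LN].
(* Orthogonality of martingale increments. By the Markov property the cross term equals [a u],
   because [P_(v-u)] maps [N v] to [N u]; in particular [a] is nondecreasing. *)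
have diff u v : 0 <= u <= v -> v <= t ->
    \int[P]_w ((N u (X u w) - N v (X v w)) ^+ 2) = a v - a u.
  move=> /andP[u0 uv] vt.
  have ut : 0 <= u <= t by rewrite u0 (le_trans uv).
  have v0 : 0 <= v by exact: le_trans uv.
  have vt' : 0 <= v <= t by rewrite v0.
  have sq s : 0 <= s <= t -> dot P (fun w => N s (X s w)) (fun w => N s (X s w)) = a s.
    move=> st; transitivity (\int[P]_w (N s (X s w) ^+ 2)).
      by apply: eq_Rintegral => w _; rewrite expr2.
    apply: (Rint_law s (fun y => N s y ^+ 2)); [by case/andP: st| |by move=> y; exact: sqr_ge0].
    by apply: measurable_funX; exact: L2_meas (LN _ st).
  have cross : dot P (fun w => N u (X u w)) (fun w => N v (X v w)) = a u.
    have uvE : u + (v - u) = v by rewrite subrKC.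
    have vu0 : 0 <= v - u by rewrite subr_ge0.
    have LNv : L2 (pk p (u + (v - u)) x) (N v) by rewrite uvE; exact: LN.
    have := Rint_joint u (v - u) (N u) (N v) u0 vu0 (LN _ ut) LNv.
    rewrite uvE => ->.
    have [_ LPN _] := kernel_L2 u (v - u) (N v) u0 vu0 LNv.
    apply: Rint_eq_ae; [exact: L2_mul (LN _ ut) LPN|exact: L2_sqr (LN _ ut)|].
    have [ae _ _] := K _ ut; apply: filterS ae => y Ly.
    rewrite expr2; congr (_ * _).
    have tuE : t - u = (v - u) + (t - v) by ring.
    have tv0 : 0 <= t - v by rewrite subr_ge0.
    rewrite /N tuE in Ly *; apply/esym.
    exact: (proj2 (Pt_comp mu p sg (v - u) (t - v) b y vu0 tv0 (L2_integ _ _ Ly))).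
  have Lu := LM _ ut; have Lv := LM _ vt'.
  transitivity (dot P (fun w => N u (X u w) - N v (X v w)) (fun w => N u (X u w) - N v (X v w))).
    by apply: eq_Rintegral => w _; rewrite expr2.
  have Ld := L2B P _ _ Lu Lv.
  rewrite (dotBl P _ _ _ Lu Lv Ld) (dotBr P _ _ _ Lu Lv Lu) (dotBr P _ _ _ Lu Lv Lv).
  by rewrite (dotC P (fun w => N v (X v w))) cross !sq//; ring.
have a_nd u v : 0 <= u <= v -> v <= t -> a u <= a v.
  move=> uv vt; rewrite -subr_ge0 -diff//; apply: Rintegral_ge0 => w _; exact: sqr_ge0.
pose S := [set a u | u in [set u | 0 < u <= t]].
have infS : has_inf S.
  split; first by exists (a t); exists t => //=; rewrite t0 lexx.
  exists 0 => _ [u _ <-]; apply: Rintegral_ge0 => y _; exact: sqr_ge0.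
have Su u : 0 < u <= t -> inf S <= a u.
  by move=> ut; apply: (ge_inf infS.2); exists u.
(* As [a] is monotone, moving a near minimizer towards 0 only improves it. So [u j] can be taken
   below [1 / (j + 1)], for membership in the germ field, with [a (u j)] within [2^(-2j)] of the
   infimum, for the rate in [tail_constant_L2]. *)
have ex j : exists u, 0 < u <= j.+1%:R^-1 /\ u < t /\ a u <= inf S + (2^-1) ^+ (2 * j).
  have pj : 0 < (2^-1 : R) ^+ (2 * j) by rewrite exprn_gt0// invr_gt0.
  have [_ [u0 /= /andP[u00 u0t] <-] au0] := inf_adherent pj infS.
  have j0 : 0 < j.+1%:R^-1 :> R by rewrite invr_gt0.
  exists (Num.min u0 (Num.min (t / 2) j.+1%:R^-1)).
  have m0 : 0 < Num.min u0 (Num.min (t / 2) j.+1%:R^-1) by rewrite !lt_min u00 divr_gt0.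
  rewrite m0 !ge_min lexx !orbT; split => //; split.
    by rewrite !gt_min; apply/orP; right; apply/orP; left; lra.
  apply: le_trans (ltW au0); apply: a_nd => //.
  by rewrite (ltW m0) ge_min lexx.
have [u uP] := choice ex.
have ut j : 0 <= u j <= t.
  by have [/andP[u0 _] [ujt _]] := uP j; rewrite !ltW.
have ain j : inf S <= a (u j) <= inf S + (2^-1) ^+ (2 * j).
  have [/andP[u0 _] [ujt ->]] := uP j; rewrite andbT; apply: Su.
  by rewrite u0 ltW.
pose M j w := N (u j) (X (u j) w).
have cauchy i j : (i <= j)%N -> \int[P]_w ((M i w - M j w) ^+ 2) <= (2^-1) ^+ (2 * i).
  move=> ij; have /andP[i1 i2] := ain i; have /andP[j1 j2] := ain j.
  have pij : (2^-1 : R) ^+ (2 * j) <= (2^-1) ^+ (2 * i).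
    by apply: ler_wiXn2l; rewrite ?invr_ge0// ?invf_le1// ?ler1n// leq_mul2l ij orbT.
  have /andP[ui0 uit] := ut i; have /andP[uj0 ujt] := ut j.
  (* The times [u j] have not been chosen decreasing, so both orders occur. *)
  case: (leP (u i) (u j)) => uij.
    by rewrite /M diff ?ui0//; lra.
  have -> : \int[P]_w ((M i w - M j w) ^+ 2) = \int[P]_w ((M j w - M i w) ^+ 2).
    by apply: eq_Rintegral => w _; ring.
  by rewrite /M (diff (u j) (u i)) ?uj0 ?(ltW uij)//; lra.
have LMj j : L2 P (M j) by exact: LM.
have tail s eta : `|s| = 1 -> 0 < eta -> measurable (often_above M c s eta) /\
  forall j, \int[P]_w (\1_(often_above M c s eta) w * (M j w - c)) = 0.
  move=> _ _.
  have FA : right_filtration X 0 (often_above M c s eta).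
    apply: (right_filtration0_often_above (fun j => N (u j)) u c s eta).
      by move=> j; exact: L2_meas (LN _ (ut j)).
    by move=> j; have [] := uP j.
  split => [|j]; first exact: right_filtration_measurable FA.
  set A := often_above M c s eta in FA *.
  have uj0 : 0 <= u j by case/andP: (ut j).
  have ib : integ (pk p (u j) x) (fun y => N (u j) y - c).
    by apply: integB; [exact: L2_integ (LN _ (ut j))|exact: integ_cst].
  rewrite (Rint_initial A (u j) (fun y => N (u j) y - c) uj0 FA ib).
  rewrite (RintB (pk p (u j) x)); [|exact: L2_integ (LN _ (ut j))|exact: integ_cst].
  have [_ _ H] := K _ (ut j).
  rewrite (Rint_cst (pk p (u j) x)) (_ : \int[_]_y _ = c); last exact: H.
  by rewrite subrr mulr0.
have [n nP] : exists n : nat, (2^-1 : R) ^+ (2 * n) <= e.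
  have : (2^-1 : R) ^+ n @[n --> \oo] --> 0.
    by apply: cvg_expr; rewrite ger0_norm ?invr_ge0// invf_lt1// ltr1n.
  move=> /cvgrPdist_le/(_ _ e0)[n _ /(_ (2 * n)%N)] /=.
  rewrite leq_pmull// => /(_ isT).
  by rewrite sub0r normrN ger0_norm ?exprn_ge0 ?invr_ge0// => H; exists n.
exists (u n); first by have [/andP[-> _] [-> _]] := uP n.
have := tail_constant_L2 P M c LMj cauchy tail n.
have -> : \int[P]_w ((M n w - c) ^+ 2) = a (u n) - c ^+ 2.
  have un0 : 0 <= u n by case/andP: (ut n).
  have mN : measurable_fun setT (N (u n)) by exact: L2_meas (LN _ (ut n)).
  rewrite (Rint_law (u n) (fun y => (N (u n) y - c) ^+ 2) un0); last 2 first.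
  - by apply: measurable_funX; exact: measurable_funB.
  - by move=> y; exact: sqr_ge0.
  have i1 := L2_sqr _ _ (LN _ (ut n)).
  have i2 := L2_integ _ _ (LN _ (ut n)).
  have [_ _ H] := K _ (ut n).
  transitivity (\int[pk p (u n) x]_y (N (u n) y ^+ 2 - (2 * c * N (u n) y - c ^+ 2))).
    by apply: eq_Rintegral => y _; ring.
  have i3 := integZ (pk p (u n) x) (2 * c) _ i2.
  have i4 := integ_cst (pk p (u n) x) (c ^+ 2).
  have i5 := integB _ _ _ i3 i4.
  rewrite (RintB _ _ _ i1 i5) (RintB _ _ _ i3 i4) (RintZ _ _ _ i2) Rint_cst.
  rewrite -/(a (u n)) (_ : \int[_]_y N (u n) y = c); last exact: H.
  ring.
by rewrite -/(a (u n)) -/c; lra.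
Qed.

End process.

(** Young's inequality between [a ln a - a] and its convex conjugate [expR], from the tangent line
    of [expR] at [ln a]. At [a = 0] the default value of [ln] is harmless, being multiplied by 0. It
    is the source of all convexity estimates for the entropy. *)
Lemma gibbs {R : realType} (a v : R) : 0 <= a -> a * v <= a * ln a - a + expR v.
Proof.
rewrite le_eqVlt => /predU1P[<-|a0]; first by rewrite !mul0r subr0 add0r expR_ge0.
have := expR_ge1Dx (v - ln a).
rewrite expRB (lnK a0) ler_pdivlMr// => H.
rewrite -subr_ge0 (_ : _ - _ = expR v - (1 + (v - ln a)) * a) ?subr_ge0//; ring.
Qed.

(** * Entropy and Fisher information *)

Section density.
Context {R : realType} {d : measure_display} {E : measurableType d}.
Variables (mu : probability E R) (p : R -> R.-pker E ~> E) (x : E).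
Hypothesis sg : markov_semigroup mu p.

(** Stated for the kernel [p t x] instead of the process, whose law it is by [law_X]; square
    integrability is included because every pairing below is an L^2 product. *)
Definition has_density (t : R) (f : E -> R) : Prop :=
  [/\ (forall y, 0 <= f y), L2 mu f &
    forall B, measurable B -> p t x B = (\int[mu]_(y in B) (f y)%:E)%E].

Lemma density_int t f (b : E -> \bar R) : has_density t f ->
  measurable_fun setT b -> (forall y, 0 <= b y)%E ->
  (\int[p t x]_y b y = \int[mu]_y ((f y)%:E * b y))%E.
Proof.
move=> [f0 Lf fP]; have mf := L2_meas _ _ Lf.
move: b; apply: daniell_eq; first exact: daniell_measure.
  apply: daniell_integral => [y|b mb b0]; first by apply: daniell_scale => //; exact: daniell_eval.
  by apply: emeasurable_funM => //; exact/measurable_EFinP.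
move=> A mA; rewrite integral_indic// setIT fP// integral_mkcond.
apply: eq_integral => y _; rewrite /patch /= indicE.
by case: (y \in A); rewrite ?mule1 ?mule0.
Qed.

Lemma density_integ t f b : has_density t f -> measurable_fun setT b ->
  integ mu (fun y => f y * b y) ->
  integ (pk p t x) b /\ \int[pk p t x]_y b y = \int[mu]_y (f y * b y).
Proof.
move=> fd mb ifb; have [f0 Lf _] := fd.
have ib : integ (pk p t x) b.
  apply/integrableP; split; first exact/measurable_EFinP.
  rewrite (density_int t f (fun y => `|(EFin \o b) y|%E) fd)//; last first.
    by apply: measurableT_comp => //; exact/measurable_EFinP.
  case/integrableP : ifb => _; congr (_ < _)%E.
  by apply: eq_integral => y _; rewrite /= normrM ger0_norm// EFinM.
split=> //.
have nn (c : E -> R) : (forall y, 0 <= c y) -> measurable_fun setT c -> integ (pk p t x) c ->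
    integ mu (fun y => f y * c y) -> \int[pk p t x]_y c y = \int[mu]_y (f y * c y).
  move=> c0 mc ic ifc; apply: EFin_inj; rewrite (RintE (pk p t x))// RintE//.
  rewrite (density_int t f (EFin \o c) fd)//; last exact/measurable_EFinP.
have ai := integ_abs _ _ ib.
have mab : measurable_fun setT (fun y => `|b y|) by exact: measurableT_comp.
have fa : integ mu (fun y => f y * `|b y|).
  have := integ_abs _ _ ifb.
  by under [X in integ _ X -> _]eq_fun do rewrite normrM ger0_norm//.
have fpi : integ (pk p t x) (fun y => `|b y| + b y) by exact: integD.
have fp : integ mu (fun y => f y * (`|b y| + b y)).
  under [X in integ _ X]eq_fun do rewrite mulrDr; exact: integD.
have fp0 y : 0 <= `|b y| + b y by have := ler_norm (- b y); rewrite normrN; lra.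
have e1 := nn _ (fun y => normr_ge0 _) mab ai fa.
have e2 := nn _ fp0 (measurable_funD mab mb) fpi fp.
transitivity (\int[pk p t x]_y ((`|b y| + b y) - `|b y|)).
  by apply: eq_Rintegral => y _; ring.
rewrite (RintB (pk p t x))// e1 e2 -RintB//.
by apply: eq_Rintegral => y _; ring.
Qed.

Lemma density_L2 t f b : has_density t f -> L2 mu b ->
  integ (pk p t x) b /\ Pt p t b x = dot mu f b.
Proof.
move=> fd Lb; have [_ Lf _] := fd.
by apply: density_integ => //; [exact: L2_meas Lb|exact: L2_mul].
Qed.

Lemma density_mass t f : has_density t f -> \int[mu]_y f y = 1.
Proof.
move=> fd; have [_] := density_L2 t f _ fd (L2_cst mu 1).
rewrite (Pt_cst p) /dot => ->.
by apply: eq_Rintegral => y _; rewrite mulr1.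
Qed.

(** Chapman-Kolmogorov gives the integral of [f'] over [B] as the pairing of [f] with [P_t 1_B], and
    self-adjointness moves [P_t] onto [f]. *)
Lemma density_semigroup s t f f' : 0 <= s -> 0 <= t -> has_density s f ->
  has_density (s + t) f' -> {ae mu, forall y, f' y = Pt p t f y}.
Proof.
move=> s0 t0 fd fd'; have [f0 Lf fP] := fd; have [f'0 Lf' f'P] := fd'.
have LP : L2 mu (Pt p t f) by exact: L2_Pt.
have : ae_eq mu setT (EFin \o f') (EFin \o Pt p t f).
  apply: integral_ae_eq => //.
  - exact: L2_integ Lf'.
  - by apply/measurable_EFinP; exact: L2_meas LP.
  move=> B _ mB; rewrite -f'P// (chapman_kolmogorov sg)//.
  rewrite (density_int s f (fun z => p t z B) fd)//; last exact: measurable_kernel.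
  have L1 : L2 mu (\1_B : E -> R).
    apply: (L2_bounded _ 1%R) => // y.
    by rewrite indicE; case: (_ \in _); rewrite ?normr1 ?normr0.
  have LP1 : L2 mu (Pt p t \1_B) by exact: L2_Pt.
  have H := dot_Pt mu p sg t _ _ t0 Lf L1.
  have i1 := L2_mul _ _ _ LP L1; have i2 := L2_mul _ _ _ Lf LP1.
  transitivity (\int[mu]_y (f y * Pt p t \1_B y)%:E)%E.
    apply: eq_integral => y _; rewrite EFinM; congr (_ * _)%E.
    rewrite /Pt /Rintegral integral_indic// setIT fineK//.
    exact: (fin_num_measure (pk p t y)).
  have := congr1 EFin H; rewrite /dot (RintE _ _ i1) (RintE _ _ i2) => <-.
  rewrite [RHS]integral_mkcond; apply: eq_integral => y _.
  rewrite /patch indicE /=; by case: (y \in B); rewrite ?mulr1 ?mulr0.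
by apply: filterS => y /(_ I) [].
Qed.

Lemma density_dot s t f f' b : 0 <= s -> 0 <= t -> has_density s f ->
  has_density (s + t) f' -> L2 mu b -> dot mu f' b = dot mu f (Pt p t b).
Proof.
move=> s0 t0 fd fd' Lb; have [_ Lf _] := fd; have [_ Lf' _] := fd'.
rewrite -(dot_Pt mu p sg t _ _ t0 Lf Lb).
have LP : L2 mu (Pt p t f) by exact: L2_Pt.
apply: Rint_eq_ae; [exact: L2_mul|exact: L2_mul|].
by apply: filterS (density_semigroup s t f f' s0 t0 fd fd') => y ->.
Qed.

Lemma density_nrm s t f f' : 0 <= s -> s <= t -> has_density s f ->
  has_density t f' -> nrm mu f' <= nrm mu f.
Proof.
move=> s0 st fd fd'; have ts0 : 0 <= t - s by rewrite subr_ge0.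
have fd2 : has_density (s + (t - s)) f' by rewrite subrKC.
have [_ Lf _] := fd; have [_ Lf' _] := fd'.
have LP : L2 mu (Pt p (t - s) f) by exact: L2_Pt.
rewrite (nrm_eq_ae mu _ _ Lf' LP); first exact: nrm_Pt.
exact: density_semigroup fd fd2.
Qed.

(** Both densities are images of [f0] under the semigroup, so the modulus of continuity depends on
    [f0] only and is uniform over later times. *)
Lemma density_cont r s t f0 f f' : 0 <= r -> r <= s -> s <= t -> has_density r f0 ->
  has_density s f -> has_density t f' ->
  nrm mu (fun y => f' y - f y) <= nrm mu (fun y => Pt p (t - s) f0 y - f0 y).
Proof.
move=> r0 rs st fd0 fd fd'.
have sr0 : 0 <= s - r by rewrite subr_ge0.
have tr0 : 0 <= t - r by rewrite subr_ge0 (le_trans rs).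
have fds : has_density (r + (s - r)) f by rewrite subrKC.
have fdt : has_density (r + (t - r)) f' by rewrite subrKC.
have [_ Lf0 _] := fd0; have [_ Lf _] := fd; have [_ Lf' _] := fd'.
have LP1 : L2 mu (Pt p (s - r) f0) by exact: L2_Pt.
have LP2 : L2 mu (Pt p (t - r) f0) by exact: L2_Pt.
have -> : nrm mu (fun y => f' y - f y) =
    nrm mu (fun y => Pt p (t - r) f0 y - Pt p (s - r) f0 y).
  apply: nrm_eq_ae; [exact: L2B|exact: L2B|].
  apply: filterS2 (density_semigroup r _ _ _ r0 sr0 fd0 fds)
    (density_semigroup r _ _ _ r0 tr0 fd0 fdt) => y -> ->//.
have := nrm_Pt_diff mu p sg (s - r) (t - r) f0.
rewrite sr0 lerD2r st => /(_ isT Lf0).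
by rewrite (_ : t - r - (s - r) = t - s); last by ring.
Qed.

(** With [K] the square root of [N], the square of [f - min(f, K)] is at most [f^2 - min(f^2, N)],
    so [int_trunc] for [f^2] applies. *)
Lemma nrm_trunc f e : L2 mu f -> (forall y, 0 <= f y) -> 0 < e ->
  exists2 K, 0 <= K & nrm mu (fun y => f y - Num.min (f y) K) <= e.
Proof.
move=> Lf f0 e0; have mf := L2_meas _ _ Lf.
have e20 : 0 < e ^+ 2 by rewrite exprn_gt0.
have [N NP] := int_trunc mu _ (L2_sqr mu _ Lf) (fun y => sqr_ge0 _) _ e20.
exists (Num.sqrt N%:R); first exact: sqrtr_ge0.
set K := Num.sqrt N%:R.
have K0 : 0 <= K by exact: sqrtr_ge0.
have K2 : K ^+ 2 = N%:R by rewrite sqr_sqrtr.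
have m0 y : 0 <= Num.min (f y) K by rewrite le_min f0.
have Lm : L2 mu (fun y => Num.min (f y) K).
  apply: (L2_bounded mu K) => [|y]; first exact: measurable_minr.
  by rewrite ger0_norm// ge_min lexx orbT.
rewrite -ler_sqr ?nnegrE ?nrm_ge0// ?(ltW e0)// nrm_sqr.
apply: le_trans NP; apply: Rint_le.
- by apply: L2_mul; exact: L2B.
- apply: integB; first exact: L2_sqr.
  apply: (integ_le mu _ (fun y => f y ^+ 2)); [|exact: L2_sqr|].
    by apply: measurable_minr => //; exact: measurable_funX.
  move=> y; rewrite !ger0_norm ?sqr_ge0 ?ge_min ?lexx//.
  by rewrite le_min sqr_ge0 ler0n.
move=> y; have fy := f0 y; rewrite -K2.
case: (leP (f y) K) => fK.
  rewrite subrr mulr0 subr_ge0 ge_min lexx//.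
by rewrite min_r ?ler_sqr ?nnegrE// ?(ltW fK)//; nra.
Qed.

Definition smooth_density (t : R) (f : E -> R) : Prop :=
  let g := @ln R \o f in
  [/\ has_density t f, {ae mu, forall y, 0 < f y},
    [/\ domL mu p f, domL mu p g, domL mu p (g \* g) & domL mu p (f \* g)],
    chain_rule mu p (@ln R) f g & nonneg_curvature mu p g].

Definition entropy (f : E -> R) : R := dot mu f (@ln R \o f).
Definition varentropy (f : E -> R) : R :=
  dot mu f ((@ln R \o f) \* (@ln R \o f)) - entropy f ^+ 2.
(** The Fisher information in the form in which differentiating the entropy produces it; [fisherE]
    identifies it with the integral of [f Gamma(ln f)]. *)
Definition fisher (f : E -> R) : R := - dot mu f (Lgen mu p (@ln R \o f)).

Lemma smooth_L2 t f : smooth_density t f ->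
  [/\ L2 mu f, L2 mu (@ln R \o f) & L2 mu ((@ln R \o f) \* (@ln R \o f))].
Proof.
move=> [[_ Lf _] _ [_ Dg Dgg _] _ _]; split => //.
- exact: gen_L2l (domL_gen _ _ _ Dg).
- exact: gen_L2l (domL_gen _ _ _ Dgg).
Qed.

(** The chain rule gives [f Gamma(ln f, ln f) = Gamma(f, ln f)]. In the integral of the latter the
    term [L (f ln f)] disappears and the other two agree by symmetry of the generator. *)
Lemma fisherE t f : smooth_density t f ->
  integ mu (fun y => f y * carre_du_champ mu p (@ln R \o f) (@ln R \o f) y) /\
  \int[mu]_y (f y * carre_du_champ mu p (@ln R \o f) (@ln R \o f) y) = fisher f.
Proof.
move=> sd; have [[f0 Lf _] fpos [Df Dg Dgg Dfg] chain _] := sd.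
set g := @ln R \o f in Dg Dgg Dfg chain *.
have Gf := domL_gen _ _ _ Df; have Gg := domL_gen _ _ _ Dg.
have Ggg := domL_gen _ _ _ Dgg; have Gfg := domL_gen _ _ _ Dfg.
have mG : measurable_fun setT (carre_du_champ mu p g g).
  exact: integ_meas (carre_integ _ _ _ Dg Dgg).
have i1 := L2_mul mu _ _ Lf (gen_L2r _ _ _ _ Gg).
have i2 := L2_mul mu _ _ (gen_L2l _ _ _ _ Gg) (gen_L2r _ _ _ _ Gf).
have i3 := L2_integ mu _ (gen_L2r _ _ _ _ Gfg).
have i4 := integB mu _ _ (integB mu _ _ i3 i1) i2.
have i5 : integ mu (carre_du_champ mu p f g).
  rewrite (_ : carre_du_champ mu p f g = (fun y => 2^-1 *
     (Lgen mu p (f \* g) y - f y * Lgen mu p g y - g y * Lgen mu p f y))).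
    exact: integZ.
  by apply/funext => y; rewrite /carre_du_champ mulrC.
have aeE : {ae mu, forall y, f y * carre_du_champ mu p g g y = carre_du_champ mu p f g y}.
  apply: filterS2 chain fpos => y Cy fy.
  have D : derive1 (@ln R) (f y) = (f y)^-1.
    by rewrite derive1E; exact: (@derive_val _ _ _ _ _ _ _ (is_derive1_ln fy)).
  rewrite (_ : carre_du_champ mu p g g y = derive1 (@ln R) (f y) * carre_du_champ mu p f g y).
    by rewrite D mulVKf// gt_eqF.
  exact: Cy.
have i6 : integ mu (fun y => f y * carre_du_champ mu p g g y).
  apply: (integ_le_ae mu _ _ _ i5); first by apply: measurable_funM => //; exact: L2_meas Lf.
  by apply: filterS aeE => y ->.
split => //; rewrite (Rint_eq_ae mu _ _ i6 i5 aeE).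
rewrite (_ : carre_du_champ mu p f g = (fun y => 2^-1 *
   (Lgen mu p (f \* g) y - f y * Lgen mu p g y - g y * Lgen mu p f y))); last first.
  by apply/funext => y; rewrite /carre_du_champ mulrC.
rewrite (RintZ mu _ _ i4) (RintB mu _ _ (integB mu _ _ i3 i1) i2) (RintB mu _ _ i3 i1).
rewrite (gen_int0 mu p sg _ _ Gfg) -/(dot mu f _) -/(dot mu g _).
by rewrite (dotC mu g) (gen_dot mu p sg _ _ _ _ Gf Gg) /fisher; field.
Qed.

Lemma fisher_ge0 t f : smooth_density t f -> 0 <= fisher f.
Proof.
move=> sd; have [i1 <-] := fisherE t f sd.
have [[f0 Lf _] fpos [Df Dg Dgg Dfg] chain _] := sd.
apply: Rint_ge0_ae => //.
by apply: filterS (carre_du_champ_ge0 mu p sg _ Dg Dgg) => y Gy; rewrite mulr_ge0.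
Qed.

(** The weighted inequality for [w = min(f_u, K)]. On the right [P_tau w <= P_tau f_u = f_t] and
    [Gamma >= 0], so the bound by [fisher ft] does not depend on [K]; on the left the loss is at
    most the L^2 norm of [f_u - w] times that of [D]. *)
Lemma local_Poincare u t fu ft : 0 <= u -> u <= t -> has_density u fu -> smooth_density t ft ->
  dot mu ft ((@ln R \o ft) \* (@ln R \o ft)) -
    \int[pk p u x]_y (Pt p (t - u) (@ln R \o ft) y ^+ 2) <= 2 * (t - u) * fisher ft.
Proof.
move=> u0 ut fdu sd; have [fdt fpos [Df Dg Dgg Dfg] chain curv] := sd.
have [Lft Lg Lgg] := smooth_L2 t ft sd.
have [fu0 Lfu _] := fdu; have [ft0 _ _] := fdt.
set g := @ln R \o ft in Dg Dgg Dfg chain curv Lg Lgg *.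
set tau := t - u; have tau0 : 0 <= tau by rewrite subr_ge0.
have fdt' : has_density (u + tau) ft by rewrite subrKC.
have LP : L2 mu (Pt p tau g) by exact: L2_Pt.
have LPP : L2 mu (Pt p tau (g \* g)) by exact: L2_Pt.
have LP2 : L2 mu (fun y => Pt p tau g y ^+ 2).
  apply: (L2_le_ae mu _ _ _ LPP); first by apply: measurable_funX; exact: L2_meas LP.
  apply: filterS (Pt_sqr_ae mu p sg tau _ tau0 Lg) => y Hy.
  rewrite ger0_norm ?sqr_ge0//; apply: le_trans (ler_norm _).
  by move: Hy; under [X in _ <= Pt p tau X y -> _]eq_fun do rewrite expr2.
have [_ ->] := density_integ u fu (fun y => Pt p tau g y ^+ 2) fdu
  (L2_meas _ _ LP2) (L2_mul _ _ _ Lfu LP2).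
rewrite (density_dot u tau fu ft _ u0 tau0 fdu fdt' Lgg) -/(dot mu fu _) -dotBr//.
pose D y := Pt p tau (g \* g) y - Pt p tau g y ^+ 2.
have LD : L2 mu D by exact: L2B.
have [Gi GE] := fisherE t ft sd; rewrite -/g in Gi GE.
rewrite -subr_le0; apply: (le0_of_eps _ (nrm mu D)) => e e0.
have [K K0 KP] := nrm_trunc fu e Lfu fu0 e0.
pose w y := Num.min (fu y) K.
have mw : measurable_fun setT w by apply: measurable_minr => //; exact: L2_meas Lfu.
have wK y : 0 <= w y <= K by rewrite /w le_min fu0 K0 ge_min lexx orbT.
have Lw : L2 mu w.
  by apply: (L2_bounded mu K) => // y; case/andP: (wK y) => ? ?; rewrite ger0_norm.
have := local_Poincare_weight mu p sg g Dg Dgg curv w K tau mw wK tau0.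
rewrite -/(dot mu w _) -/(dot mu w _) -dotBr// -/D => H1.
have H2 : \int[mu]_y (Pt p tau w y * carre_du_champ mu p g g y) <= fisher ft.
  have iG := carre_integ mu p _ Dg Dgg.
  have i1 : integ mu (fun y => Pt p tau w y * carre_du_champ mu p g g y).
    apply: (integ_bounded_mul mu K) => //; first exact: Pt_meas_bounded wK.
    by move=> y; case/andP: (Pt_bounded p K tau w mw wK y) => ? ?; rewrite ger0_norm.
  rewrite -GE; apply: Rint_le_ae => //.
  have wfu : {ae mu, forall y, w y <= fu y} by apply: aeW => y; rewrite ge_min lexx.
  apply: filterS3 (carre_du_champ_ge0 mu p sg _ Dg Dgg)
    (Pt_le_ae mu p sg tau _ _ tau0 (L2_integ _ _ Lw) (L2_integ _ _ Lfu) wfu)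
    (density_semigroup u tau fu ft u0 tau0 fdu fdt') => y G0 Pw ftE.
  by rewrite ler_wpM2r// ftE.
have H3 : dot mu fu D = dot mu w D + dot mu (fun y => fu y - w y) D.
  by rewrite (dotBl mu)//; ring.
have H4 := Cauchy_Schwarz mu _ _ (L2B mu _ _ Lfu Lw) LD.
have H5 : nrm mu (fun y => fu y - w y) * nrm mu D <= e * nrm mu D.
  by rewrite ler_wpM2r// nrm_ge0.
have H6 := ler_norm (dot mu (fun y => fu y - w y) D).
have H7 : 2 * tau * \int[mu]_y (Pt p tau w y * carre_du_champ mu p g g y) <= 2 * tau * fisher ft.
  by rewrite ler_wpM2l// mulr_ge0.
rewrite -/D H3; lra.
Qed.

(* The lower Dini derivative of the entropy from the left is at least the
   Fisher information, by convexity of [a |-> a * ln a]. *)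
Lemma entropy_dini t (fd : R -> E -> R) : 0 < t -> (forall s, 0 < s -> smooth_density s (fd s)) ->
  forall eta, 0 < eta -> exists2 r, 0 < r & forall s, 0 < s -> t - r < s < t ->
    (t - s) * (fisher (fd t) - eta) <= entropy (fd s) - entropy (fd t).
Proof.
move=> t0 sd eta eta0.
have sdt := sd t t0; have [fdt fpos [_ Dg _ _] _ _] := sdt.
have [Lft Lg Lgg] := smooth_L2 t _ sdt.
set g := @ln R \o fd t in Dg Lg Lgg *.
have G := domL_gen _ _ _ Dg; set h := Lgen mu p g in G.
have Lh := gen_L2r _ _ _ _ G.
(* The density at time [t / 2] bounds the norms of all [f_s] with [s] in [[t / 2, t]] and gives them
   a common modulus of continuity. *)
have r00 : 0 < t / 2 by rewrite divr_gt0.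
have [fdr _ _ _ _] := sd _ r00; have [_ Lfr _] := fdr.
set fr := fd (t / 2) in fdr Lfr.
pose e := eta / (nrm mu fr + nrm mu h + 1).
have nh := nrm_ge0 mu h; have nfr := nrm_ge0 mu fr.
have e0 : 0 < e by rewrite divr_gt0//; lra.
have [r1 r10 H1] := gen_lim mu p sg _ _ G e e0.
have [r2 r20 H2] := strong_cont mu p sg fr Lfr e e0.
exists (Num.min (t / 2) (Num.min r1 r2)); first by rewrite !lt_min r00 r10.
move=> s s0 /andP[rs st].
have : t - s < Num.min (t / 2) (Num.min r1 r2) by lra.
rewrite !lt_min => /and3P[ts2 ts1 tsr2].
have ts0 : 0 < t - s by lra.
have sds := sd s s0; have [fds fspos _ _ _] := sds.
have [Lfs Lgs _] := smooth_L2 s _ sds.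
have {}H1 := H1 (t - s); rewrite ts0 ts1 in H1; have {}H1 := H1 isT.
have {}H2 := H2 (t - s); rewrite (ltW ts0) tsr2 in H2; have {}H2 := H2 isT.
set q := (fun y => _) in H1.
have Lq : L2 mu q by apply: L2_gen_quot => //; exact: ltW.
have rs' : t / 2 <= s by lra.
have C := density_cont (t / 2) s t fr (fd s) (fd t) (ltW r00) rs' (ltW st) fdr fds fdt.
have {}C := le_trans C H2.
have nfs := density_nrm (t / 2) s fr (fd s) (ltW r00) rs' fdr fds.
have fdt' : has_density (s + (t - s)) (fd t) by rewrite subrKC.
have E1 : dot mu (fd t) g = dot mu (fd s) (Pt p (t - s) g).
  exact: density_dot (ltW s0) (ltW ts0) fds fdt' Lg.
have LP : L2 mu (Pt p (t - s) g) by apply: L2_Pt => //; exact: ltW.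
(* [gibbs] at [a = f_s] and [v = ln f_t]; the masses cancel. Thus only [ln f_t], a fixed element of
   the domain, has to be differentiated along the semigroup. *)
have conv : dot mu (fd s) g - dot mu (fd t) g <= entropy (fd s) - entropy (fd t).
  rewrite /entropy -/g lerD2r.
  have i1 := L2_mul mu _ _ Lfs Lg; have i2 := L2_mul mu _ _ Lfs Lgs.
  have is_ := L2_integ _ _ Lfs; have it := L2_integ _ _ Lft.
  have [f0s _ _] := fds.
  apply: (@le_trans _ _ (\int[mu]_y (fd s y * ln (fd s y) - (fd s y - fd t y)))).
    apply: Rint_le_ae => //; first by apply: integB => //; exact: integB.
    apply: filterS fpos => y fy.
    have := gibbs (fd s y) (g y) (f0s y); rewrite /g /= lnK//; lra.
  rewrite (RintB mu _ _ i2 (integB mu _ _ is_ it)) (RintB mu _ _ is_ it).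
  by rewrite (density_mass s _ fds) (density_mass t _ fdt) subrr subr0.
apply: le_trans conv.
have -> : dot mu (fd s) g - dot mu (fd t) g = (t - s) * - (dot mu (fd s) h + dot mu (fd s) q).
  rewrite E1 -dotDr// -dotBr//.
  have -> : - dot mu (fd s) (fun y => h y + q y) = dot mu (fd s) (fun y => -1 * (h y + q y)).
    by rewrite dotZr ?mulN1r//; exact: L2D.
  rewrite -dotZr//; last by apply: L2Z; exact: L2D.
  congr dot; apply/funext => y; rewrite /q; field; rewrite gt_eqF//.
rewrite ler_wpM2l ?(ltW ts0)//.
have D1 : dot mu (fd s) h = dot mu (fd t) h - dot mu (fun y => fd t y - fd s y) h.
  by rewrite (dotBl mu)//; ring.
have D2 := Cauchy_Schwarz mu _ _ (L2B mu _ _ Lft Lfs) Lh.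
have D3 := Cauchy_Schwarz mu _ _ Lfs Lq.
have D4 : nrm mu (fun y => fd t y - fd s y) * nrm mu h <= e * nrm mu h.
  by rewrite ler_wpM2r.
have D5 : nrm mu (fd s) * nrm mu q <= nrm mu fr * e by rewrite ler_pM// nrm_ge0.
have D6 : e * (nrm mu fr + nrm mu h + 1) = eta by rewrite /e divfK// gt_eqF//; lra.
have D7 := ler_norm (dot mu (fd s) q).
have D8 := ler_norm (- dot mu (fun y => fd t y - fd s y) h); rewrite normrN in D8.
rewrite /fisher -/h D1; nra.
Qed.

(** [gibbs] for [f] against [P_(t-s) ln f'], then Jensen for [expR]; the two remaining masses
    cancel. Monotonicity is proved independently of [entropy_dini] because it supplies the condition
    from the left when [dini_le] is applied to the entropy. *)
Lemma entropy_le s t f f' : 0 <= s -> s <= t -> smooth_density s f -> smooth_density t f' ->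
  entropy f' <= entropy f.
Proof.
move=> s0 st sd sd'; have [fd fpos _ _ _] := sd; have [fd' fpos' _ _ _] := sd'.
have [Lf Lg _] := smooth_L2 s _ sd; have [Lf' Lg' _] := smooth_L2 t _ sd'.
have ts0 : 0 <= t - s by rewrite subr_ge0.
have fd2 : has_density (s + (t - s)) f' by rewrite subrKC.
rewrite /entropy (density_dot s _ f f' _ s0 ts0 fd fd2 Lg').
have LP : L2 mu (Pt p (t - s) (@ln R \o f')) by exact: L2_Pt.
have i1 := L2_mul mu _ _ Lf LP; have i2 := L2_mul mu _ _ Lf Lg.
have iF := L2_integ _ _ Lf.
have LPf : L2 mu (Pt p (t - s) f') by exact: L2_Pt.
have iP := L2_integ _ _ LPf.
have [f0 _ _] := fd.
apply: (@le_trans _ _ (\int[mu]_y (f y * ln (f y) - f y + Pt p (t - s) f' y))).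
  apply: Rint_le_ae => //; first by apply: integD => //; exact: integB.
  have aeE : {ae mu, forall y, f' y = expR (ln (f' y))}.
    by apply: filterS fpos' => y fy; rewrite lnK.
  have mexp : measurable_fun setT (fun y => expR (ln (f' y))).
    by apply: measurableT_comp; [exact: measurable_expR|exact: L2_meas Lg'].
  have iexp : integ mu (fun y => expR (ln (f' y))).
    by apply: integ_le_ae (L2_integ _ _ Lf') _ => //; apply: filterS aeE => y <-.
  apply: filterS3 (ae_kernel_integ mu p sg _ _ ts0 (L2_integ _ _ Lg'))
    (ae_kernel_integ mu p sg _ _ ts0 iexp)
    (Pt_eq_ae mu p sg _ _ _ ts0 (L2_integ _ _ Lf') iexp aeE) => y ig ie PE.
  apply: le_trans (gibbs _ _ (f0 y)) _; rewrite lerD2l PE.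
  (* Jensen, from the tangent line of [expR] *)
  set c := Pt p (t - s) (@ln R \o f') y.
  have -> : expR c = \int[pk p (t - s) y]_z (expR c * (1 - c) + expR c * ln (f' z)).
    rewrite (RintD _ _ _ (integ_cst _ _) (integZ _ _ _ ig)) (RintZ _ _ _ ig) Rint_cst.
    have -> : \int[pk p (t - s) y]_z (@ln R \o f') z = c by [].
    ring.
  apply: (Rint_le (pk p (t - s) y)) => //.
    by apply: integD; [exact: integ_cst|exact: integZ].
  move=> z; have := expR_ge1Dx (ln (f' z) - c); rewrite expRB.
  rewrite ler_pdivlMr ?expR_gt0//; lra.
rewrite (RintD mu _ _ (integB mu _ _ i2 iF) iP) (RintB mu _ _ i2 iF).
rewrite (Pt_int mu p sg _ _ ts0 (L2_integ _ _ Lf')).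
by rewrite (density_mass s _ fd) (density_mass t _ fd') subrK.
Qed.

End density.

(** A discrete form of: [- h' >= c0 h^2] implies [(1 / h)' >= c0], where [x] is the entropy at [t]
    and [y] the one at [t - dl]. The radius is chosen so that the second order terms are absorbed by
    half of [eta]. *)
Lemma inv_decay {R : realType} (c0 eta x : R) : 0 < c0 -> 0 < eta -> 0 < x ->
  exists2 r, 0 < r & forall dl y, 0 < dl < r -> x <= y ->
    dl * (c0 * x ^+ 2 - x ^+ 2 * eta / 2) <= y - x -> y^-1 - x^-1 <= (- c0 + eta) * dl.
Proof.
move=> c00 eta0 x0; exists (eta / (2 * x * c0 ^+ 2)).
  by rewrite divr_gt0// !mulr_gt0// exprn_gt0.
move=> dl y /andP[dl0 dlr] xy dly.
have y0 : 0 < y by exact: lt_le_trans xy.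
case: (leP c0 eta) => ce.
  apply: (@le_trans _ _ 0); first by rewrite subr_le0 lef_pV2.
  by rewrite mulr_ge0 ?(ltW dl0)//; lra.
have dlc : dl * (2 * x * c0 ^+ 2) <= eta.
  by rewrite -ler_pdivlMr ?(ltW dlr)// !mulr_gt0// exprn_gt0.
rewrite -subr_ge0 (_ : _ - _ = (y - x - (c0 - eta) * dl * x * y) / (x * y)); last first.
  by field; rewrite !gt_eqF.
apply: divr_ge0; last by rewrite mulr_ge0// ltW.
(* The claim now reads [x <= y (1 - k)]; since [k <= 1], the lower bound on [y] may be inserted. *)
set k := (c0 - eta) * dl * x.
have k0 : 0 <= k by rewrite !mulr_ge0// ?subr_ge0 ltW.
have q : dl * x * ((c0 - eta / 2) * (c0 - eta)) <= dl * x * c0 ^+ 2.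
  by rewrite ler_wpM2l ?mulr_ge0 ?(ltW dl0) ?(ltW x0)// expr2 ler_pM; lra.
have k1 : k <= 1.
  have : dl * x * c0 * (2 * c0) <= 1 * (2 * c0).
    have -> : dl * x * c0 * (2 * c0) = dl * (2 * x * c0 ^+ 2) by ring.
    by lra.
  rewrite ler_pM2r ?mulr_gt0// => H; apply: le_trans H.
  by rewrite /k (_ : _ * x = dl * x * (c0 - eta)) ?ler_wpM2l ?mulr_ge0 ?(ltW dl0) ?(ltW x0)//; [lra|ring].
have Y : (x + dl * (c0 * x ^+ 2 - x ^+ 2 * eta / 2)) * (1 - k) <= y * (1 - k).
  by rewrite ler_wpM2r//; lra.
have Z : 0 <= dl * x ^+ 2 * (eta / 2 - dl * x * ((c0 - eta / 2) * (c0 - eta))).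
  by rewrite !mulr_ge0 ?sqr_ge0 ?(ltW dl0)//; lra.
have -> : y - x - k * y = y * (1 - k) - x by ring.
rewrite subr_ge0; apply: le_trans Y; rewrite -subr_ge0.
rewrite (_ : _ - _ = dl * x ^+ 2 * (eta / 2 - dl * x * ((c0 - eta / 2) * (c0 - eta))))// /k.
by field.
Qed.

(** * Entropy, varentropy and total variation along the diffusion *)

Section diffusion.
Context {R : realType} {d d' : measure_display}.
Context {E : measurableType d} {Omega : measurableType d'}.
Variables (mu : probability E R) (p : R -> R.-pker E ~> E).
Variables (P : probability Omega R) (X : R -> {RV P >-> E}) (x : E).
Hypothesis hX : nonneg_curved_diffusion mu p X x.

Let sg : markov_semigroup mu p. Proof. exact: diffusion_semigroup hX. Qed.
Let lawX t B : 0 <= t -> measurable B -> P (X t @^-1` B) = p t x B.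
Proof. exact: (law_X p P X x (diffusion_markov hX) (diffusion_start hX) t B). Qed.

Lemma exists_densities : exists f : R -> E -> R,
  forall t, 0 < t -> smooth_density mu p x t (f t).
Proof.
suff /choice[f fP] : forall t : R, exists f : E -> R, 0 < t -> smooth_density mu p x t f.
  by exists f.
move=> t; case: (ltP 0 t) => t0; last by exists (fun=> 0); move=> ?; lra.
have [f [[mf f0 fl] fpos [Df Dg Dff Dgg Dfg] chain curv]] := diffusion_density hX t0.
exists f => _; split => //; split => //; first exact: gen_L2l (domL_gen _ _ _ Df).
by move=> B mB; rewrite -fl// -lawX// ltW.
Qed.

Lemma TV_ub t A : 0 <= t -> measurable A ->
  `|fine (p t x A) - fine (mu A)| <= TV mu (X t).
Proof.
move=> t0 mA; rewrite /TV; apply: ub_le_sup; last by exists A => //; rewrite lawX.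
exists 1 => _ [B mB <-]; rewrite lawX//.
have b01 (m : probability E R) : 0 <= fine (m B) <= 1.
  rewrite fine_ge0//= -lee_fin fineK; last exact: fin_num_measure.
  exact: probability_le1.
have := b01 mu; have := b01 (pk p t x); rewrite /pk ler_norml => /andP[a b] /andP[c e].
by apply/andP; split; lra.
Qed.

Lemma TV_le t c : 0 <= t ->
  (forall A, measurable A -> `|fine (p t x A) - fine (mu A)| <= c) -> TV mu (X t) <= c.
Proof.
move=> t0 H; apply: ge_sup => [|_ [A mA <-]]; last by rewrite lawX//; exact: H.
by exists `|fine (P (X t @^-1` set0)) - fine (mu set0)|; exists set0.
Qed.

Variable f : R -> E -> R.
Hypothesis fP : forall t, 0 < t -> smooth_density mu p x t (f t).
Let h t := entropy mu (f t).

Let fdens t : 0 < t -> has_density mu p x t (f t). Proof. by move=> /fP[]. Qed.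

(** [local_Poincare] from a time [u > 0] leaves the second moment of [P_(t-u) ln f_t] at time [u];
    by [germ_variance] it exceeds the squared entropy by at most [e] for a suitable [u]. *)
Lemma varentropy_le t : 0 < t -> varentropy mu (f t) <= 2 * t * fisher mu p (f t).
Proof.
move=> t0; have [Lf Lg Lgg] := smooth_L2 _ _ _ _ _ (fP t t0).
have [mg igg] := density_integ mu p x t _ _ (fdens t t0) (L2_meas _ _ Lgg) (L2_mul _ _ _ Lf Lgg).
have Lgk : L2 (pk p t x) (@ln R \o f t).
  apply/L2P; split; first exact: L2_meas Lg.
  by under [Y in integ _ Y]eq_fun do rewrite expr2.
have [_ Eg] := density_L2 mu p x t _ _ (fdens t t0) Lg.
rewrite -subr_le0; apply: (le0_of_eps _ 1) => e e0; rewrite mul1r.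
have [u /andP[u0 ut] H] := germ_variance mu p P X x sg (diffusion_markov hX)
  (diffusion_start hX) t _ t0 Lgk e e0.
have H2 := local_Poincare mu p x sg u t _ _ (ltW u0) (ltW ut) (fdens u u0) (fP t t0).
have I0 := fisher_ge0 mu p x sg t _ (fP t t0).
rewrite Eg in H; rewrite /varentropy /entropy.
have : 2 * (t - u) * fisher mu p (f t) <= 2 * t * fisher mu p (f t).
  by rewrite ler_wpM2r// ler_pM2l//; lra.
lra.
Qed.

Let L2ind (m : probability E R) A : measurable A -> L2 m (\1_A : E -> R).
Proof.
move=> mA; apply: (L2_bounded m 1) => // y.
by rewrite indicE; case: (_ \in _); rewrite ?normr1 ?normr0.
Qed.

Let prob_ind (m : probability E R) A : measurable A -> fine (m A) = \int[m]_y \1_A y.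
Proof. by move=> mA; rewrite /Rintegral integral_indic// setIT. Qed.

Let law_ind t A : 0 < t -> measurable A -> fine (p t x A) = dot mu (f t) \1_A.
Proof.
move=> t0 mA; rewrite (prob_ind (pk p t x))//.
by have [_ <-] := density_L2 mu p x t _ _ (fdens t t0) (L2ind mu A mA).
Qed.

(* Chebyshev under the law of [X_t] puts the mass on [ln f > h / 2], a set
   which has [mu]-measure at most [exp (- h / 2)]. *)
Lemma reverse_Pinsker t (eps : R) : 0 < t -> 0 < eps -> TV mu (X t) <= 1 - eps ->
  0 < h t -> 2 * ln (2 / eps) <= h t -> eps * h t ^+ 2 / 8 <= varentropy mu (f t).
Proof.
move=> t0 eps0 tv h0 hl.
have [Lf Lg Lgg] := smooth_L2 _ _ _ _ _ (fP t t0).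
have [fd fpos _ _ _] := fP t t0; have [f0 _ _] := fd.
set F := f t in Lf Lg Lgg fd fpos f0 *; set g := @ln R \o F in Lg Lgg *; set H := h t in h0 hl *.
pose B := [set y | H / 2 < g y].
have mB : measurable B.
  rewrite (_ : B = g @^-1` `]H / 2, +oo[%classic).
    by have mg := L2_meas _ _ Lg; rewrite -[Y in measurable Y]setTI; exact: mg.
  by apply/seteqP; split => y; rewrite /B /= in_itv/= andbT.
have L1 := L2ind mu B mB.
have i1 := L2_mul _ _ _ Lf L1; have i2 := L2_integ _ _ L1.
have iF := L2_integ _ _ Lf.
have iFg := L2_mul _ _ _ Lf Lg; have iFgg := L2_mul _ _ _ Lf Lgg.
have A1 : \int[mu]_y \1_B y <= expR (- (H / 2)).
  apply: (@le_trans _ _ (\int[mu]_y (expR (- (H / 2)) * F y))); last first.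
    by rewrite RintZ// (density_mass mu p x t)// mulr1.
  apply: Rint_le_ae => //; first exact: integZ.
  apply: filterS fpos => y Fy; rewrite indicE.
  have [yB|_] := boolP (y \in B); last by rewrite mulr_ge0// expR_ge0.
  have : H / 2 < ln (F y) by exact: set_mem yB.
  move=> /ltW; rewrite -ler_expR lnK ?posrE// => HF.
  by rewrite /= mulr1n expRN mulrC ler_pdivlMr ?expR_gt0// mul1r.
have A2 : 1 - dot mu F \1_B <= 4 / H ^+ 2 * varentropy mu F.
  have V : varentropy mu F = \int[mu]_y (F y * (g y - H) ^+ 2).
    have j1 := integZ mu (2 * H) _ iFg; have j2 := integZ mu (H ^+ 2) _ iF.
    transitivity (\int[mu]_y (F y * (g y * g y) - 2 * H * (F y * g y) + H ^+ 2 * F y)).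
      rewrite (RintD mu _ _ (integB mu _ _ iFgg j1) j2) (RintB mu _ _ iFgg j1).
      rewrite (RintZ mu _ _ iFg) (RintZ mu _ _ iF) (density_mass mu p x t F fd).
      have -> : \int[mu]_y (F y * g y) = H by [].
      by rewrite /varentropy -/(h t) -/H /dot /=; ring.
    by apply: eq_Rintegral => y _; ring.
  have iV : integ mu (fun y => F y * (g y - H) ^+ 2).
    rewrite (_ : (fun y => _) = (fun y => F y * (g y * g y) - 2 * H * (F y * g y) + H ^+ 2 * F y)).
      by apply: integD; [apply: integB => //; exact: integZ|exact: integZ].
    by apply/funext => y; ring.
  have -> : 1 - dot mu F \1_B = \int[mu]_y (F y - F y * \1_B y).
    by rewrite RintB// (density_mass mu p x t F fd).
  rewrite V -RintZ//.
  apply: Rint_le; [exact: integB|exact: integZ|].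
  move=> y; have Fy := f0 y; rewrite indicE.
  have [yB|yB] := boolP (y \in B).
    by rewrite /= mulr1 subrr mulr_ge0 ?divr_ge0 ?(mulr_ge0 Fy) ?sqr_ge0.
  rewrite /= mulr0 subr0 mulrCA ler_peMr// mulrAC ler_pdivlMr ?exprn_gt0// mul1r.
  have : g y <= H / 2.
    by rewrite leNgt; apply/negP => Hy; move/negP: yB; apply; exact/mem_set.
  nra.
have A3 := TV_ub t B (ltW t0) mB.
rewrite (law_ind t B t0 mB) (prob_ind mu B mB) -/F in A3.
have A4 := ler_norm (dot mu F \1_B - \int[mu]_y \1_B y).
(* This is what [2 ln (2 / eps) <= h] is for: [B] has [mu]-measure at most [eps / 2], hence mass at
   most [1 - eps / 2] under the law of [X t], and its complement keeps [eps / 2] for Chebyshev's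
   inequality. *)
have A5 : expR (- (H / 2)) <= eps / 2.
  rewrite expRN -[leRHS]invrK lef_pV2 ?posrE ?expR_gt0 ?invr_gt0 ?divr_gt0//.
  rewrite invf_div -[leLHS](@lnK _ (2 / eps)) ?posrE ?divr_gt0// ler_expR; lra.
have A6 : eps / 2 <= 4 / H ^+ 2 * varentropy mu F by lra.
have H20 : 0 < H ^+ 2 by rewrite exprn_gt0.
move: A6; rewrite mulrAC ler_pdivlMr//; lra.
Qed.

(** Moving [P_(t-s)] onto the indicator of [A] gives a test function with values in [[0, 1]]. Among
    these, the indicator of the set where [f_s > 1] has the largest integral against [f_s - 1]. *)
Lemma TV_noninc s t : 0 < s -> s <= t -> TV mu (X t) <= TV mu (X s).
Proof.
move=> s0 st; have t0 : 0 < t by exact: lt_le_trans st.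
have ts0 : 0 <= t - s by rewrite subr_ge0.
apply: TV_le => [|A mA]; first exact: ltW.
have [f0 Lf _] := fdens s s0.
have fdt : has_density mu p x (s + (t - s)) (f t) by rewrite subrKC; exact: fdens.
rewrite law_ind// (density_dot mu p x sg s (t - s) (f s) (f t) _ (ltW s0) ts0 (fdens s s0) fdt (L2ind mu A mA)).
rewrite prob_ind// -(Pt_int mu p sg (t - s) _ ts0 (L2_integ _ _ (L2ind mu A mA))).
set phi := Pt p (t - s) \1_A.
have i01 y : 0 <= (\1_A y : R) <= 1 by rewrite indicE; case: (_ \in _); rewrite ?lexx ler01.
have phi01 y : 0 <= phi y <= 1 by apply: Pt_bounded => //; exact: measurable_indic.
have Lphi : L2 mu phi by apply: L2_Pt => //; exact: L2ind.
pose B := [set y | 1 < f s y].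
have mB : measurable B.
  rewrite (_ : B = f s @^-1` `]1, +oo[%classic).
    by have mg := L2_meas _ _ Lf; rewrite -[Y in measurable Y]setTI; exact: mg.
  by apply/seteqP; split => y; rewrite /B /= in_itv/= andbT.
have LB := L2ind mu B mB.
have tvB := TV_ub s B (ltW s0) mB.
rewrite law_ind// prob_ind// in tvB.
have Lf1 : L2 mu (fun y => f s y - 1) by apply: L2B => //; exact: L2_cst.
have E1 b : L2 mu b -> dot mu (f s) b - \int[mu]_y b y = \int[mu]_y ((f s y - 1) * b y).
  move=> Lb; rewrite -RintB; [|exact: L2_mul|exact: L2_integ].
  by apply: eq_Rintegral => y _; ring.
rewrite E1// in tvB; rewrite E1//.
have iB := L2_mul _ _ _ Lf1 LB; have iphi := L2_mul _ _ _ Lf1 Lphi.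
have i1 := L2_integ _ _ Lf1.
have z0 : \int[mu]_y (f s y - 1) = 0.
  by rewrite RintB ?Rint_cst ?(density_mass mu p x s) ?subrr//; [exact: fdens|exact: L2_integ|exact: integ_cst].
have U : \int[mu]_y ((f s y - 1) * phi y) <= \int[mu]_y ((f s y - 1) * \1_B y).
  apply: Rint_le => // y; have /andP[p0 p1] := phi01 y; rewrite indicE.
  have [yB|yB] := boolP (y \in B).
    have : 1 < f s y by exact: set_mem yB.
    by rewrite mulr1 => fy; rewrite ler_piMr//; lra.
  have : f s y <= 1 by rewrite leNgt; apply/negP => Hy; move/negP: yB; apply; exact/mem_set.
  by move=> fy; rewrite mulr0 mulr_le0_ge0//; lra.
(* Pointwise [(f_s - 1)(phi + 1_B) >= f_s - 1], and the right-hand side has mean 0. *)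
have L : - (\int[mu]_y ((f s y - 1) * \1_B y)) <= \int[mu]_y ((f s y - 1) * phi y).
  rewrite -subr_ge0 opprK addrC -RintD// -z0.
  apply: Rint_le => //; first exact: integD.
  move=> y; have /andP[p0 p1] := phi01 y; rewrite indicE.
  have [yB|yB] := boolP (y \in B).
    have : 1 < f s y by exact: set_mem yB.
    by rewrite mulr1 => fy; rewrite lerDl mulr_ge0//; lra.
  have : f s y <= 1 by rewrite leNgt; apply/negP => Hy; move/negP: yB; apply; exact/mem_set.
  by move=> fy; rewrite mulr0 add0r; nra.
have := ler_norm (\int[mu]_y ((f s y - 1) * \1_B y)).
by rewrite ler_norml; lra.
Qed.

Lemma entropy_ge0 t : 0 < t -> 0 <= h t.
Proof.
move=> t0; have [Lf Lg _] := smooth_L2 _ _ _ _ _ (fP t t0).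
have [f0 _ _] := fdens t t0.
have i1 := L2_integ _ _ Lf.
have <- : \int[mu]_y (f t y - 1) = 0.
  by rewrite RintB ?Rint_cst ?(density_mass mu p x t) ?subrr//; [exact: fdens|exact: integ_cst].
apply: Rint_le; [by apply: integB => //; exact: integ_cst|exact: L2_mul|].
by move=> y; have := gibbs (f t y) 0 (f0 y); rewrite mulr0 expR0 /=; lra.
Qed.

(* The part of the density below [K] is contracted in L^2, the rest has mass
   at most [(h + 1) / ln K]. *)
Lemma TV_decay (lam K s u : R) : contraction_rate mu p lam -> 0 < s -> 0 <= u -> 1 < K ->
  TV mu (X (s + u)) <= (h s + 1) / ln K + K * expR (- lam * u).
Proof.
move=> rate s0 u0 K1; have su0 : 0 < s + u by lra.
have K0 : 0 < K by lra.
have lK : 0 < ln K by exact: ln_gt0.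
apply: TV_le => [|A mA]; first exact: ltW.
have [f0 Lf _] := fdens s s0; have [_ Lg _] := smooth_L2 _ _ _ _ _ (fP s s0).
have LA := L2ind mu A mA.
rewrite law_ind// (density_dot mu p x sg s u (f s) _ _ (ltW s0) u0 (fdens s s0) (fdens _ su0) LA).
rewrite prob_ind//; set m := \int[mu]_y \1_A y.
have m01 : 0 <= m <= 1.
  apply/andP; split; first by apply: Rintegral_ge0 => y _.
  rewrite -[leRHS](Rint_cst mu); apply: Rint_le; [exact: L2_integ|exact: integ_cst|].
  by move=> y; rewrite indicE; case: (_ \in _).
pose b y : R := \1_A y - m.
have Lb : L2 mu b by apply: L2B => //; exact: L2_cst.
have b0 : \int[mu]_y b y = 0.
  by rewrite RintB ?Rint_cst ?subrr//; [exact: L2_integ|exact: integ_cst].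
have babs y : `|b y| <= 1.
  rewrite /b indicE; case/andP: m01 => ? ?; case: (_ \in _) => /=;
    by rewrite ?mulr1n ?mulr0n ler_norml; apply/andP; split; lra.
have nb : nrm mu b <= 1 by apply: nrm_bounded => //; exact: L2_meas Lb.
have LPb : L2 mu (Pt p u b) by exact: L2_Pt.
have nPb : nrm mu (Pt p u b) <= expR (- lam * u).
  have := rate u b u0 Lb b0; rewrite !L2normE// -EFinM lee_fin => H.
  by apply: (le_trans H); rewrite ler_piMr// expR_ge0.
have iA y : integ (pk p u y) (\1_A : E -> R) by exact: L2_integ (L2ind _ A mA).
have PbE y : Pt p u b y = Pt p u \1_A y - m.
  by rewrite (Pt_B p u) ?(Pt_cst p)//; exact: (integ_cst (pk p u y)).
have Pb1 y : `|Pt p u b y| <= 1.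
  have ib : integ (pk p u y) b.
    by apply: (L2_integ (pk p u y)); apply: (L2_bounded _ 1) => //; exact: L2_meas Lb.
  apply: (le_trans (Pt_abs p u _ _ ib)).
  rewrite -[leRHS](Rint_cst (pk p u y)); apply: (Rint_le (pk p u y)) => //.
    exact: (integ_abs (pk p u y)).
  exact: (integ_cst (pk p u y)).
have -> : dot mu (f s) (Pt p u \1_A) - m = dot mu (f s) (Pt p u b).
  rewrite (funext PbE) dotBr//; [|exact: L2_Pt|exact: L2_cst].
  congr (_ - _); rewrite /dot RintegralZr//; last exact: L2_integ Lf.
  by rewrite (density_mass mu p x s) ?mul1r//; exact: fdens.
have i1 := L2_mul _ _ _ Lf LPb; have i2 := L2_mul _ _ _ Lf Lg.
have i3 : integ mu (fun y => `|Pt p u b y|) by apply: integ_abs; exact: L2_integ.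
have i4 : integ mu (fun y => f s y * ln (f s y) + 1) by apply: integD => //; exact: integ_cst.
apply: (le_trans (Rint_abs mu _ i1)).
apply: (@le_trans _ _ (\int[mu]_y ((ln K)^-1 * (f s y * ln (f s y) + 1) + K * `|Pt p u b y|))).
  apply: Rint_le; [exact: integ_abs|by apply: integD; exact: integZ|].
  move=> y; have fy := f0 y; rewrite normrM (ger0_norm fy).
  have P0 := normr_ge0 (Pt p u b y).
  (* The function [f ln f] takes negative values; adding 1 makes it nonnegative, which is the origin
     of [h s + 1]. *)
  have G : 0 <= f s y * ln (f s y) + 1.
    by have := gibbs (f s y) 0 fy; rewrite mulr0 expR0 /=; lra.
  have Q0 : 0 <= (ln K)^-1 * (f s y * ln (f s y) + 1) by rewrite mulr_ge0// invr_ge0 ltW.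
  case: (leP (f s y) K) => fK.
    by apply: ler_wpDl => //; exact: ler_wpM2r.
  apply: ler_wpDr; first by rewrite mulr_ge0// ltW.
  apply: (@le_trans _ _ (f s y)); first by rewrite ler_piMr.
  rewrite mulrC ler_pdivlMr//.
  have : ln K <= ln (f s y) by rewrite ler_ln ?posrE// ?(ltW fK)//; lra.
  by move=> lKf; apply: ler_wpDr => //; rewrite ler_wpM2l.
rewrite RintD; [|exact: integZ|exact: integZ].
rewrite !RintZ// RintD//; last exact: integ_cst.
rewrite Rint_cst mulrC lerD2l ler_pM2l//.
exact: le_trans (int_abs_le_nrm mu _ LPb) nPb.
Qed.

End diffusion.

(** * Mixing times *)

Section mixing.
Context {R : realType} {d d' : measure_display}.
Context {E : measurableType d} {Omega : measurableType d'}.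
Variables (mu : probability E R) (p : R -> R.-pker E ~> E).
Variables (P : probability Omega R) (X : R -> {RV P >-> E}) (x : E).
Hypothesis hX : nonneg_curved_diffusion mu p X x.

Section densities.
Variable f : R -> E -> R.
Hypothesis fP : forall t, 0 < t -> smooth_density mu p x t (f t).
Let h t := entropy mu (f t).

(* While the total variation distance is at most [1 - eps] and the entropy is
   large, [h' <= - eps h^2 / (16 t)], so that [1 / h] grows linearly. *)
Lemma entropy_bound (t0 del eps : R) : 0 < t0 -> 0 < del -> 0 < eps ->
  TV mu (X t0) <= 1 - eps ->
  h ((1 + del) * t0) <= Num.max (2 * ln (2 / eps)) (16 * (1 + del) / (eps * del)).
Proof.
move=> t00 del0 eps0 tv; set t1 := (1 + del) * t0.
have sg := diffusion_semigroup hX.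
have hle s t : 0 < s -> s <= t -> h t <= h s.
  move=> s0 st; apply: (entropy_le mu p x sg s t _ _ (ltW s0) st (fP s s0)).
  by apply: fP; exact: lt_le_trans st.
have t01 : t0 < t1 by rewrite /t1 mulrDl mul1r ltrDl mulr_gt0.
have t10 : 0 < t1 by exact: lt_trans t01.
rewrite leNgt; apply/negP; rewrite gt_max => /andP[hl hd].
have h10 : 0 < h t1.
  by apply: lt_trans hd; rewrite divr_gt0 ?mulr_gt0//; lra.
(* From [eps h^2 / 8 <= varentropy <= 2 t I <= 2 t1 I]. *)
pose c0 := eps / (16 * t1).
have c00 : 0 < c0 by rewrite divr_gt0// mulr_gt0.
have fish t : t0 < t -> t <= t1 -> c0 * h t ^+ 2 <= fisher mu p (f t).
  move=> tt0 tt1; have t_gt0 : 0 < t by exact: lt_trans tt0.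
  have ht := hle t t1 t_gt0 tt1.
  have tvt : TV mu (X t) <= 1 - eps.
    exact: le_trans (TV_noninc mu p P X x hX f fP t0 t t00 (ltW tt0)) tv.
  have V1 := reverse_Pinsker mu p P X x hX f fP t eps t_gt0 eps0 tvt
    (lt_le_trans h10 ht) (le_trans (ltW hl) ht).
  have V2 := varentropy_le mu p P X x hX f fP t t_gt0.
  have I0 := fisher_ge0 mu p x sg t _ (fP t t_gt0).
  have V3 : 2 * t * fisher mu p (f t) <= 2 * t1 * fisher mu p (f t).
    by rewrite ler_wpM2r// ler_pM2l.
  have -> : c0 * h t ^+ 2 = eps * h t ^+ 2 / (16 * t1) by rewrite /c0 mulrAC.
  have t16 : 0 < 16 * t1 by rewrite mulr_gt0.
  have := le_trans V1 (le_trans V2 V3); rewrite !ler_pdivrMr//.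
  by rewrite (_ : fisher mu p (f t) * _ = 2 * t1 * fisher mu p (f t) * 8); [exact|ring].
have tau0 : 0 <= t1 - t0 by rewrite subr_ge0 ltW.
(* Time runs backwards from [t1] because [entropy_dini] controls the entropy just before a given
   time. *)
pose psi r := - (h (t1 - r))^-1.
have : psi 0 - psi (t1 - t0) <= - c0 * (t1 - t0).
  apply: dini_le => //; rewrite /psi.
  - move=> s eta /andP[s0 stau] eta0; set t := t1 - s.
    have tt0 : t0 < t by rewrite /t; lra.
    have tt1 : t <= t1 by rewrite /t; lra.
    have t_gt0 : 0 < t by exact: lt_trans tt0.
    have ht : 0 < h t by exact: lt_le_trans (hle t t1 t_gt0 tt1).
    have eta'0 : 0 < h t ^+ 2 * eta / 2 by rewrite divr_gt0// mulr_gt0// exprn_gt0.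
    have [r1 r10 H1] := entropy_dini mu p x sg t f t_gt0 fP _ eta'0.
    have [r2 r20 H2] := inv_decay c0 eta (h t) c00 eta0 ht.
    exists (Num.min r1 r2); first by rewrite lt_min r10.
    move=> dl /andP[dl0]; rewrite lt_min => /andP[dl1 dl2] dltau.
    have tdl0 : 0 < t - dl by rewrite /t; lra.
    have -> : t1 - (s + dl) = t - dl by rewrite /t; ring.
    rewrite opprK addrC; apply: H2; [by rewrite dl0|by apply: hle => //; lra|].
    have tdl : t - r1 < t - dl < t by apply/andP; split; lra.
    have := H1 (t - dl) tdl0 tdl; rewrite (_ : t - (t - dl) = dl); last by ring.
    apply: le_trans; rewrite ler_wpM2l ?(ltW dl0)// lerD2r.
    exact: fish.
  (* By monotonicity of the entropy [psi] is nondecreasing, so any radius will do. *)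
  - move=> c e /andP[c0' ctau] e0; exists 1 => // s s0 /andP[_ sc].
    have A : h (t1 - s) <= h (t1 - c) by apply: hle; lra.
    have B : h t1 <= h (t1 - s) by apply: hle; lra.
    apply: (@le_trans _ _ 0); last exact: ltW.
    rewrite opprK addrC subr_le0 lef_pV2// posrE; first exact: lt_le_trans (le_trans B A).
    exact: lt_le_trans B.
rewrite /psi subr0 (_ : t1 - (t1 - t0) = t0); last by ring.
move=> Q.
have h0 : 0 < h t0 by exact: lt_le_trans (hle _ _ t00 (ltW t01)).
have hi0 : 0 < (h t0)^-1 by rewrite invr_gt0.
have : c0 * (t1 - t0) < (h t1)^-1 by lra.
(* As [t1 - t0 = del t0] and [t1 = (1 + del) t0], the time scale cancels and a constant in [eps] and
   [del] remains. *)
have -> : c0 * (t1 - t0) = (16 * (1 + del) / (eps * del))^-1.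
  by rewrite /c0 /t1; field; rewrite !gt_eqF//; lra.
rewrite ltf_pV2 ?posrE//; first lra.
by rewrite divr_gt0 ?mulr_gt0//; lra.
Qed.

(** In [TV_decay] take the level [K = exp(k)] with [k = 2 (H + 1) / eps]: the part above [K] costs
    at most [eps / 2]. The waiting time [(k + ln (2 / eps)) / lam] first cancels the factor [K] and
    then brings the other part down to [eps / 2]. *)
Lemma TV_small (lam H s eps : R) : contraction_rate mu p lam -> 0 < lam ->
  0 < s -> h s <= H -> 0 < eps <= 1 ->
  TV mu (X (s + (2 * (H + 1) / eps + ln (2 / eps)) / lam)) <= eps.
Proof.
move=> rate lam0 s0 hH /andP[eps0 eps1].
have h0 := entropy_ge0 mu p x f fP s s0.
have H0 : 0 <= H by exact: le_trans hH.
set k := 2 * (H + 1) / eps.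
have k0 : 0 < k by rewrite divr_gt0//; lra.
have l0 : 0 <= ln (2 / eps) by rewrite ln_ge0// ler_pdivlMr//; lra.
have u0 : 0 <= (k + ln (2 / eps)) / lam by rewrite divr_ge0 ?(ltW lam0)// addr_ge0// ltW.
have K1 : 1 < expR k by rewrite expR_gt1.
apply: (le_trans (TV_decay mu p P X x hX f fP lam (expR k) s _ rate s0 u0 K1)).
rewrite expRK (_ : - lam * _ = - (k + ln (2 / eps))); last by field; rewrite gt_eqF.
rewrite -expRD (_ : k - _ = - ln (2 / eps)); last by ring.
rewrite expRN lnK ?posrE ?divr_gt0// [(2 / eps)^-1]invf_div.
rewrite [leRHS]splitr lerD2r.
rewrite ler_pdivrMr// /k (_ : eps / 2 * _ = H + 1); first by rewrite lerD2r.
by field; rewrite gt_eqF.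
Qed.

End densities.

Lemma has_lbound_mix (eps : R) : has_lbound [set t : R | 0 < t /\ TV mu (X t) <= eps].
Proof. by exists 0 => t [/ltW]. Qed.

(** The infimum defining [tmix] need not be attained, so the bound is shown for every admissible
    time [t]. The constant [C] involves only [eps], [eps'] and [del], hence can serve a whole
    sequence of diffusions. *)
Lemma tmix_le (lam eps eps' del C H : R) :
  contraction_rate mu p lam -> 0 < lam -> 0 < eps < 1 -> 0 < eps' < 1 -> 0 < del ->
  H = Num.max (2 * ln (2 / (1 - eps))) (16 * (1 + del) / ((1 - eps) * del)) ->
  C = 2 * (H + 1) / eps' + ln (2 / eps') ->
  tmix mu X eps' <= (1 + del) * tmix mu X eps + C / lam.
Proof.
move=> rate lam0 /andP[eps0 eps1] /andP[eps'0 eps'1] del0 HE CE.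
have [f fP] := exists_densities mu p P X x hX.
have d1 : 0 < 1 + del by lra.
rewrite -lerBlDr [(1 + del) * _]mulrC -ler_pdivrMr//; apply: lb_le_inf.
  (* Admissible times exist: the entropy at time 1 is finite, and the spectral gap does the rest. *)
  exists (1 + (2 * (entropy mu (f 1) + 1) / eps + ln (2 / eps)) / lam); split.
    rewrite ltr_pwDl// divr_ge0 ?(ltW lam0)// addr_ge0//.
      rewrite divr_ge0 ?(ltW eps0)// mulr_ge0// addr_ge0//.
      exact: (entropy_ge0 mu p x f fP).
    by rewrite ln_ge0// ler_pdivlMr//; lra.
  by apply: (TV_small f fP) => //; rewrite eps0 ltW.
move=> t [t0 tv]; rewrite ler_pdivrMr// lerBlDr mulrC.
have hb : entropy mu (f ((1 + del) * t)) <= H.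
  by rewrite HE; apply: (entropy_bound f fP) => //; lra.
have s0 : 0 < (1 + del) * t by exact: mulr_gt0.
apply: ge_inf; first exact: has_lbound_mix.
split; last by rewrite CE; apply: (TV_small f fP) => //; rewrite eps'0 ltW.
rewrite ltr_pwDl// divr_ge0 ?(ltW lam0)// CE addr_ge0//.
  rewrite divr_ge0 ?(ltW eps'0)// mulr_ge0// addr_ge0//.
  exact: le_trans (entropy_ge0 mu p x f fP _ s0) hb.
by rewrite ln_ge0// ler_pdivlMr//; lra.
Qed.

End mixing.

(** * Cutoff *)

Lemma ratio_near1 (R : realType) (a b e : R) : 0 < b -> 0 < e ->
  a <= (1 + e) * b -> b <= (1 + e) * a -> `|1 - a / b| <= e.
Proof.
move=> b0 e0 ab ba; rewrite distrC ler_distl; apply/andP; split.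
  rewrite ler_pdivlMr//; nra.
by rewrite ler_pdivrMr.
Qed.

Theorem corollary1 (R : realType)
  (d : nat -> measure_display) (E : forall n, measurableType (d n))
  (mu : forall n, probability (E n) R)
  (p : forall n, R -> R.-pker (E n) ~> (E n))
  (d' : nat -> measure_display) (Omega : forall n, measurableType (d' n))
  (P : forall n, probability (Omega n) R)
  (X : forall n, R -> {RV (P n) >-> (E n)})
  (x : forall n, E n) (lam : nat -> R)
  (hX : forall n, nonneg_curved_diffusion (mu n) (p n) (X n) (x n))
  (hlam : forall n, is_spectral_gap (mu n) (p n) (lam n))
  (lam_gt0 : forall n, 0 < lam n)
  (eps0 : R) (heps0 : 0 < eps0 < 1)
  (hprod : lam n * tmix (mu n) (X n) eps0 @[n --> \oo] --> +oo) :
  forall eps : R, 0 < eps < 1 ->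
    tmix (mu n) (X n) (1 - eps) / tmix (mu n) (X n) eps @[n --> \oo] --> (1 : R).
Proof.
(* Multiplied by [lam n], the additive term becomes a constant independent of [n]. *)
have bound e e' del : 0 < e < 1 -> 0 < e' < 1 -> 0 < del -> exists C, forall n,
    lam n * tmix (mu n) (X n) e' <= (1 + del) * (lam n * tmix (mu n) (X n) e) + C.
  move=> e01 e'01 del0; eexists => n; have [_ rate _] := hlam n.
  have := tmix_le (mu n) (p n) (P n) (X n) (x n) (hX n) (lam n) e e' del _ _
    rate (lam_gt0 n) e01 e'01 del0 erefl erefl.
  rewrite -(ler_pM2l (lam_gt0 n)) mulrDr mulrCA [lam n * (_ / _)]mulrC divfK ?gt_eqF//.
  exact.
(* The divergence spreads from [eps0] to every level: with [del = 1], the quantity at [eps0] is at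
   most twice the one at [e] plus a constant. *)
have big e : 0 < e < 1 -> lam n * tmix (mu n) (X n) e @[n --> \oo] --> +oo.
  move=> e01; have [C H] := bound e eps0 1 e01 heps0 ltr01.
  apply/cvgryPge => A; near=> n; have := H n.
  have : 2 * A + C <= lam n * tmix (mu n) (X n) eps0.
    by near: n; move/cvgryPge : hprod; exact.
  lra.
move=> eps eps01; have eps01' : 0 < 1 - eps < 1 by lra.
apply/cvgrPdist_le => e e0; have e20 : 0 < e / 2 by rewrite divr_gt0.
have [C H] := bound _ _ _ eps01 eps01' e20.
have [C' H'] := bound _ _ _ eps01' eps01 e20.
near=> n.
(* The bound 1 keeps the denominator positive, as an infimum it could be 0; the bound [2 C / e]
   turns the constant [C] into the second half of the factor [1 + e]. *)
have lb : Num.max 1 (2 * C / e) <= lam n * tmix (mu n) (X n) eps.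
  by near: n; move/cvgryPge : (big eps eps01); exact.
have la : Num.max 1 (2 * C' / e) <= lam n * tmix (mu n) (X n) (1 - eps).
  by near: n; move/cvgryPge : (big _ eps01'); exact.
move: lb la (H n) (H' n).
set a := tmix _ _ (1 - eps); set b := tmix _ _ eps; rewrite !ge_max !ler_pdivrMr// => /andP[b1 bC] /andP[a1 aC] Ha Hb.
have l0 := lam_gt0 n.
have b0 : 0 < b by rewrite -(pmulr_rgt0 _ l0); lra.
apply: ratio_near1 => //; rewrite -(ler_pM2l l0); lra.
Unshelve. all: by end_near.
Qed.
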